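(* Let $A$ be a quasi-category, $X$ a simplicial set and $k\colon K\to A^X$ a functor of quasi-categories (a family of diagrams of shape $X$). Then $A$ admits limits of the family $k$ if and only if there exist a functor $\mathrm{ran}\colon K\to A^{\Delta^0\star X}$ and a 2-cell $\lambda\colon\mathrm{res}\cdot\mathrm{ran}\Rightarrow k$ in $\mathrm{qCat}_2$ displaying $\mathrm{ran}$ as an absolute right lifting of $k$ through $\mathrm{res}\colon A^{\Delta^0\star X}\to A^X$, the restriction isofibration given by precomposition with the inclusion $X\hookrightarrow\Delta^0\star X$. Furthermore, when these equivalent conditions hold, $\lambda$ is necessarily an isomorphism and $\mathrm{ran}$ may be chosen so that $\lambda$ is an identity.
   Context: A quasi-category is a simplicial set with fillers for all inner horns; functors are simplicial maps between quasi-categories. $\mathrm{qCat}_2$ is the strict 2-category of quasi-categories with hom-categories $\hom'(A,B)=h(B^A)$, where $B^A$ is the internal hom and $h\colon\mathrm{sSet}\to\mathrm{Cat}$ is left adjoint to the nerve. A 2-cell $\lambda\colon f\ell\Rightarrow g$ (with $f\colon B\to A$, $g\colon C\to A$, $\ell\colon C\to B$) displays $\ell$ as an absolute right lifting of $g$ through $f$ if for all $b\colon Y\to B$, $y\colon Y\to C$ and every 2-cell $\chi\colon fb\Rightarrow gy$ there is a unique 2-cell $\zeta\colon b\Rightarrow\ell y$ with $\chi=\lambda y\cdot f\zeta$. $A$ admits limits of the family $k\colon K\to A^X$ if $k$ has an absolute right lifting through the constant diagram functor $c\colon A\to A^X$ (the transpose of the projection $A\times X\to A$). Join: regarding simplicial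 sets as having exactly one $(-1)$-simplex, the $n$-simplices of $Y\star X$ are pairs $(y,x)\in Y_r\times X_s$ with $r,s\ge-1$ and $r+s+1=n$; an operator $\alpha\colon[m]\to[r+s+1]$ decomposes uniquely as an ordinal sum of $\alpha_1\colon[m_1]\to[r]$ and $\alpha_2\colon[m_2]\to[s]$ and acts by $(y\cdot\alpha_1,x\cdot\alpha_2)$. The inclusion $X\hookrightarrow Y\star X$ consists of the pairs whose first component is the $(-1)$-simplex. *)

(* Defs.v *)
Set Warnings "-notation-overridden".
From mathcomp Require Import all_boot.
From mathcomp Require Import boolp.

Set Implicit Arguments.
Unset Strict Implicit.
Unset Printing Implicit Defensive.

(* [op k l] consists of the monotone maps between the ordinals with k and l
   elements, so [m] -> [n] is [op m.+1 n.+1] and the empty ordinal [-1] is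
   allowed. *)
Record op (k l : nat) := Op {
  op_fun :> 'I_k -> 'I_l;
  op_mono : forall i j : 'I_k, i <= j -> op_fun i <= op_fun j }.

Definition op_id k : op k k := @Op k k id (fun _ _ h => h).

Definition op_comp k l m (a : op l m) (b : op k l) : op k m :=
  @Op k m (fun i => a (b i)) (fun i j h => op_mono a (op_mono b h)).

Lemma op_ext k l (a b : op k l) : (forall i, a i = b i :> nat) -> a = b.
Proof.
case: a => f p; case: b => g q /= H.
have E : f = g by apply/funext => i; apply/val_inj/H.
by subst g; rewrite (Prop_irrelevance p q).
Qed.

Lemma op_eq k l (a : op k l) (i j : 'I_k) :
  i = j :> nat -> a i = a j :> nat.
Proof. by move/val_inj->. Qed.

Record sSet := SSet {
  splx :> nat -> Type;
  act : forall m n, op m.+1 n.+1 -> splx n -> splx m;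
  act_id : forall n (x : splx n), act (op_id n.+1) x = x;
  act_comp : forall k m n (a : op m.+1 n.+1) (b : op k.+1 m.+1) (x : splx n),
    act (op_comp a b) x = act b (act a x) }.
Arguments act {s m n} _ _.

Record sMap (X Y : sSet) := SMap {
  smap :> forall n, X n -> Y n;
  smap_act : forall m n (a : op m.+1 n.+1) (x : X n),
    smap (act a x) = act a (smap x) }.
Arguments smap {X Y} _ {n} _.

Lemma sMap_ext (X Y : sSet) (f g : sMap X Y) :
  (forall n (x : X n), smap f x = smap g x) -> f = g.
Proof.
case: f => f p; case: g => g q /= H.
have E : f = g by apply: functional_extensionality_dep => n; apply/funext/H.
by subst g; rewrite (Prop_irrelevance p q).
Qed.

Definition sid X : sMap X X := @SMap X X (fun n x => x) (fun _ _ _ _ => erefl).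

Definition scomp X Y Z (f : sMap Y Z) (g : sMap X Y) : sMap X Z.
Proof.
exists (fun n x => smap f (smap g x)).
by move=> m n a x; rewrite !smap_act.
Defined.

Infix "\s" := scomp (at level 50, left associativity).

Lemma scompA W X Y Z (f : sMap Y Z) (g : sMap X Y) (e : sMap W X) :
  f \s (g \s e) = f \s g \s e.
Proof. exact: sMap_ext. Qed.

Definition sprod (X Y : sSet) : sSet.
Proof.
exists (fun n => (X n * Y n)%type) (fun m n a x => (act a x.1, act a x.2)).
- by move=> n [x y] /=; rewrite !act_id.
- by move=> k m n a b [x y] /=; rewrite !act_comp.
Defined.

Infix "\x" := sprod (at level 40, left associativity).

Definition sfst X Y : sMap (X \x Y) X :=
  @SMap (X \x Y) X (fun n x => x.1) (fun _ _ _ _ => erefl).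

Definition sprod_map X X' Y Y' (f : sMap X X') (g : sMap Y Y') :
  sMap (X \x Y) (X' \x Y').
Proof.
exists (fun n x => (smap f x.1, smap g x.2)).
by move=> m n a x /=; rewrite !smap_act.
Defined.

Definition Delta (n : nat) : sSet.
Proof.
exists (fun m => op m.+1 n.+1) (fun k m b a => op_comp a b).
- by move=> m a; apply: op_ext.
- by move=> k l m a b c; apply: op_ext.
Defined.

Definition Delta_map m n (a : op m.+1 n.+1) : sMap (Delta m) (Delta n).
Proof.
exists (fun k (b : Delta m k) => op_comp a b : Delta n k).
by move=> k l b c; apply: op_ext.
Defined.

(* [sexp B A] is the internal hom B^A. *)
Definition sexp (B A : sSet) : sSet.
Proof.
exists (fun n => sMap (A \x Delta n) B)
       (fun m n a s => s \s sprod_map (sid A) (Delta_map a)).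
- move=> n s; apply: sMap_ext => m [x b] /=.
  by congr (smap s (_, _)); apply: op_ext.
- move=> k m n a b s; apply: sMap_ext => l [x c] /=.
  by congr (smap s (_, _)); apply: op_ext.
Defined.

Definition postcomp (B A Y : sSet) (f : sMap B A) : sMap (sexp B Y) (sexp A Y).
Proof.
exists (fun n (s : sexp B Y n) => f \s s : sexp A Y n).
by move=> m n a s; apply: sMap_ext.
Defined.

Definition precomp (A Y Z : sSet) (i : sMap Y Z) : sMap (sexp A Z) (sexp A Y).
Proof.
exists (fun n (s : sexp A Z n) =>
          s \s sprod_map i (sid (Delta n)) : sexp A Y n).
by move=> m n a s; apply: sMap_ext.
Defined.

Definition transpose (A X B : sSet) (f : sMap (A \x X) B) : sMap A (sexp B X).
Proof.
unshelve eexists (fun n (a : A n) => (_ : sexp B X n)).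
- exists (fun m (x : (X \x Delta n) m) =>
            smap f ((act (x.2 : op m.+1 n.+1) a, x.1) : (A \x X) m)).
  by move=> k m b [x c] /=; rewrite act_comp -smap_act.
- move=> m n b a; apply: sMap_ext => k [x c] /=.
  by rewrite act_comp.
Defined.

Definition const_diag (A X : sSet) : sMap A (sexp A X) := transpose (@sfst A X).

(* The k-th horn: the operators [m] -> [n] missing some i other than k. *)
Definition horn (n : nat) (k : 'I_n.+1) : sSet.
Proof.
unshelve eexists (fun m => {a : op m.+1 n.+1 |
            exists i, i <> k /\ forall j, a j <> i}) _.
- move=> m l b a; exists (op_comp (sval a) b).
  by case: a => a [i [ik H]]; exists i; split=> // j; apply: H.
- by move=> m [a H]; apply: eq_exist; apply: op_ext.
- by move=> ? ? ? a b [c H]; apply: eq_exist; apply: op_ext.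
Defined.

Definition horn_incl n (k : 'I_n.+1) : sMap (horn k) (Delta n) :=
  @SMap (horn k) (Delta n) (fun m a => sval a) (fun _ _ _ _ => erefl).

Definition quasi_category (A : sSet) : Prop :=
  forall (n : nat) (k : 'I_n.+1), 0 < k < n ->
  forall u : sMap (horn k) A, exists v : sMap (Delta n) A,
    v \s horn_incl k = u.

(* [aug X k] is the set of (k-1)-simplices of X, with one (-1)-simplex. *)
Definition aug (X : sSet) (k : nat) : Type :=
  if k is n.+1 then X n else unit.

Definition aug_act (X : sSet) (k l : nat) : op k l -> aug X l -> aug X k :=
  match k, l return op k l -> aug X l -> aug X k with
  | 0, _ => fun _ _ => tt
  | m.+1, 0 => fun a _ => False_rect _ (notF (ltn_ord (a ord0)))
  | m.+1, n.+1 => fun a x => act a x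
  end.

Lemma aug_act_id X k (x : aug X k) : aug_act (op_id k) x = x.
Proof. by case: k x => [[]|n x] //=; rewrite act_id. Qed.

Lemma aug_act_comp X k l m (a : op l m) (b : op k l) (x : aug X m) :
  aug_act (op_comp a b) x = aug_act b (aug_act a x).
Proof.
case: k b => [|k] b //.
case: l a b => [|l] a b; first by case: (b ord0).
case: m a x => [|m] a x; first by case: (a ord0).
exact: act_comp.
Qed.

(* For a : [m] -> [r+s+1] and p = r+1, the unique decomposition of a as an
   ordinal sum of [op_left a p] and [op_right a p]: [cut a p] is the number of
   elements that a sends into the first summand. *)
Definition cut m n (a : op m n) (p : nat) : nat := #|[pred i | a i < p]|.

Lemma cut_le m n (a : op m n) p : cut a p <= m.
Proof. by rewrite -[X in _ <= X]card_ord max_card. Qed.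

Lemma card_ord_lt m (i : nat) : i <= m -> #|[pred j : 'I_m | j < i]| = i.
Proof.
move=> im; rewrite -sum1_card (eq_bigl (fun j : 'I_m => j < i)) //.
by rewrite -(big_ord_widen m (fun=> 1) im) sum1_card card_ord.
Qed.

Lemma cutP m n (a : op m n) p (i : 'I_m) : (i < cut a p) = (a i < p).
Proof.
apply/idP/idP => H.
- rewrite ltnNge; apply/negP => pa.
  suff : cut a p <= i by rewrite leqNgt H.
  rewrite -[X in _ <= X](card_ord_lt (ltnW (ltn_ord i))).
  apply/subset_leq_card/subsetP => j; rewrite !inE => aj.
  rewrite ltnNge; apply/negP => ij.
  by have := leq_trans pa (op_mono a ij); rewrite leqNgt aj.
- rewrite -[X in X <= _](card_ord_lt (ltn_ord i)).
  apply/subset_leq_card/subsetP => j; rewrite !inE ltnS => ji.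
  exact: leq_ltn_trans (op_mono a ji) H.
Qed.

Lemma op_left_subproof m n (a : op m n) p (i : 'I_(cut a p)) :
  a (widen_ord (cut_le a p) i) < p.
Proof. by rewrite -cutP; apply: (ltn_ord i). Qed.

Definition op_left m n (a : op m n) p : op (cut a p) p :=
  @Op _ _ (fun i => Ordinal (op_left_subproof i))
    (fun i j h => @op_mono _ _ a (widen_ord _ i) (widen_ord _ j) h).

Definition rshift_cut m n (a : op m n) p (i : 'I_(m - cut a p)) : 'I_m :=
  cast_ord (subnKC (cut_le a p)) (rshift (cut a p) i).

Lemma op_right_subproof m n p q (e : p + q = n) (a : op m n)
  (i : 'I_(m - cut a p)) : a (rshift_cut i) - p < q.
Proof.
subst n; have := ltn_ord (a (rshift_cut i)).
have : p <= a (rshift_cut i) by rewrite leqNgt -cutP -leqNgt leq_addr.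
by move=> h; rewrite ltn_subLR.
Qed.

Lemma op_right_mono m n p q (e : p + q = n) (a : op m n)
  (i j : 'I_(m - cut a p)) : i <= j ->
  Ordinal (op_right_subproof e i) <= Ordinal (op_right_subproof e j).
Proof. by move=> h; rewrite leq_sub2r // op_mono // leq_add2l. Qed.

Definition op_right m n p q (e : p + q = n) (a : op m n) :
  op (m - cut a p) q := Op (op_right_mono e (a := a)).

(* The simplices of Y * X of dimension n-1: pairs (y, x) in Y_r x X_s with
   r, s >= -1, where jl = r+1 and jr = s+1. *)
Record join_splx (Y X : sSet) (n : nat) := JoinSplx {
  jl : nat;
  jr : nat;
  jlr : jl + jr = n;
  jy : aug Y jl;
  jx : aug X jr }.
Arguments JoinSplx {Y X n jl jr} _ _ _.

Definition join_act Y X m n (a : op m n) (z : join_splx Y X n) :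
  join_splx Y X m :=
  JoinSplx (subnKC (cut_le a (jl z)))
    (aug_act (op_left a (jl z)) (jy z))
    (aug_act (op_right (jlr z) a) (jx z)).

Lemma join_splx_eq Y X n p q p' q' (e : p + q = n) (e' : p' + q' = n) l r
    (u : op p l) (u' : op p' l) (v : op q r) (v' : op q' r)
    (y : aug Y l) (x : aug X r) :
  p = p' ->
  (forall (i : 'I_p) (i' : 'I_p'), i = i' :> nat -> u i = u' i' :> nat) ->
  (forall (i : 'I_q) (i' : 'I_q'), i = i' :> nat -> v i = v' i' :> nat) ->
  JoinSplx e (aug_act u y) (aug_act v x) =
  JoinSplx e' (aug_act u' y) (aug_act v' x).
Proof.
move=> pp; subst p'.
have qq : q = q' by apply/eqP; rewrite -(eqn_add2l p) e e'.
subst q' => Hu Hv.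
have -> : u = u' by apply: op_ext => i; apply: Hu.
have -> : v = v' by apply: op_ext => i; apply: Hv.
by rewrite (eq_irrelevance e e').
Qed.

Lemma cut_id n p : p <= n -> cut (op_id n) p = p.
Proof. exact: card_ord_lt. Qed.

Lemma cut_comp k m n (a : op m n) (b : op k m) p :
  cut (op_comp a b) p = cut b (cut a p).
Proof. by apply: eq_card => i; rewrite !inE /= cutP. Qed.

Definition join (Y X : sSet) : sSet.
Proof.
exists (fun n => join_splx Y X n.+1)
       (fun m n a z => join_act a z).
- move=> n [p q e y x]; rewrite -{2}(aug_act_id y) -{2}(aug_act_id x).
  have pn : p <= n.+1 by rewrite -e leq_addr.
  apply: join_splx_eq => [|i i' ii|i i' ii] /=; first exact: cut_id.
  - exact: ii.
  - rewrite -[RHS](addKn p) -ii; congr (_ + _ - _); exact: cut_id.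
- move=> k m n a b [p q e y x]; rewrite /join_act /= -!aug_act_comp.
  apply: join_splx_eq => [|i i' ii|i i' ii] /=; first exact: cut_comp.
  - by do 2!apply: op_eq.
  - congr (_ - _); apply: op_eq => /=.
    rewrite subnKC; last by rewrite leqNgt -cutP -leqNgt leq_addr.
    by apply: op_eq; rewrite /= ii; congr (_ + _); apply: cut_comp.
Defined.

Definition join_incl (Y X : sSet) : sMap X (join Y X).
Proof.
exists (fun n (x : X n) =>
  @JoinSplx Y X n.+1 0 n.+1 (add0n n.+1) tt x : join Y X n).
move=> m n a x /=; rewrite /join_act /=.
have c0 : cut a 0 = 0 by apply: eq_card0 => i; rewrite !inE.
apply: (@join_splx_eq Y X m.+1 0 m.+1 _ _ _ _ 0 n.+1 (op_id 0) _ a _ tt x).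
- by rewrite c0.
- by case.
- move=> i i' ii /=; rewrite subn0; apply: op_eq.
  by rewrite /= -ii c0.
Defined.

Record category := Category {
  cob :> Type;
  hom : cob -> cob -> Type;
  idm : forall x, hom x x;
  cmp : forall x y z, hom y z -> hom x y -> hom x z;
  cmp1m : forall x y (u : hom x y), cmp (idm y) u = u;
  cmpm1 : forall x y (u : hom x y), cmp u (idm x) = u;
  cmpA : forall x y z t (w : hom z t) (v : hom y z) (u : hom x y),
    cmp w (cmp v u) = cmp (cmp w v) u }.
Arguments hom {c} _ _.
Arguments idm {c} _.
Arguments cmp {c x y z} _ _.

Definition iso (C : category) (x y : C) (u : hom x y) : Prop :=
  exists v : hom y x, cmp v u = idm x /\ cmp u v = idm y.

Definition hom_cast (C : category) (x x' y y' : C) (ex : x = x') (ey : y = y')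
  (u : hom x y) : hom x' y' :=
  match ex in _ = x', ey in _ = y' return hom x' y' with
  | erefl, erefl => u
  end.

Record functor (C D : category) := Functor {
  fob :> C -> D;
  fmap : forall x y, hom x y -> hom (fob x) (fob y);
  fmap1 : forall x, fmap (idm x) = idm (fob x);
  fmapM : forall x y z (v : hom y z) (u : hom x y),
    fmap (cmp v u) = cmp (fmap v) (fmap u) }.
Arguments fmap {C D} _ {x y} _.

Definition fcomp C D E (G : functor D E) (F : functor C D) : functor C E.
Proof.
exists (fun x => G (F x)) (fun x y u => fmap G (fmap F u)).
- by move=> x; rewrite !fmap1.
- by move=> x y z v u; rewrite !fmapM.
Defined.

Lemma functor_ext (C D : category) (ob : C -> D)
    (f g : forall x y, hom x y -> hom (ob x) (ob y)) f1 fM g1 gM :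
  (forall x y u, f x y u = g x y u) ->
  @Functor C D ob f f1 fM = @Functor C D ob g g1 gM.
Proof.
move=> H; have E : f = g.
  apply: functional_extensionality_dep => x.
  by apply: functional_extensionality_dep => y; apply/funext/H.
by subst g; rewrite (Prop_irrelevance f1 g1) (Prop_irrelevance fM gM).
Qed.

Definition ordcat (n : nat) : category.
Proof.
exists 'I_n.+1 (fun i j => is_true (i <= j)) (fun i => leqnn i)
       (fun i j k v u => leq_trans u v);
  by move=> *; apply: bool_irrelevance.
Defined.

Definition ordcat_map m n (a : op m.+1 n.+1) : functor (ordcat m) (ordcat n).
Proof.
exists (fun i : ordcat m => a i : ordcat n)
       (fun (i j : 'I_m.+1) (h : i <= j) => op_mono a h);
  by move=> *; apply: bool_irrelevance.
Defined.

Definition nerve (C : category) : sSet.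
Proof.
exists (fun n => functor (ordcat n) C)
       (fun m n a s => fcomp s (ordcat_map a)).
- move=> n [ob f f1 fM]; apply: functor_ext => i j u /=.
  by congr f; apply: bool_irrelevance.
- move=> k m n a b [ob f f1 fM]; apply: functor_ext => i j u /=.
  by congr f; apply: bool_irrelevance.
Defined.

Definition nerve_map (C D : category) (F : functor C D) :
  sMap (nerve C) (nerve D).
Proof.
exists (fun n (s : nerve C n) => fcomp F s : nerve D n).
by move=> m n a s; apply: functor_ext.
Defined.

Definition coface n (i : 'I_n.+1) : op n n.+1 :=
  @Op n n.+1 (lift i)
    (fun j k h => eq_ind_r is_true h (leq_bump2 i j k)).

Definition codegen : op 2 1 := @Op 2 1 (fun=> ord0) (fun _ _ _ => leqnn 0).

Definition src (X : sSet) (e : X 1) : X 0 := act (@coface 1 (@Ordinal 2 1 isT)) e.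
Definition tgt (X : sSet) (e : X 1) : X 0 := act (@coface 1 (@Ordinal 2 0 isT)) e.
Definition degen (X : sSet) (x : X 0) : X 1 := act codegen x.
Definition face2 (X : sSet) (i : 'I_3) (t : X 2) : X 1 :=
  act (coface i) t.

Notation d2 := (face2 (@Ordinal 3 2 isT)).
Notation d1 := (face2 (@Ordinal 3 1 isT)).
Notation d0 := (face2 (@Ordinal 3 0 isT)).

(* [hCat X] is generated by the graph of 0- and 1-simplices of X, subject to the
   relations that degenerate edges are identities and that each 2-simplex t
   gives d_0 t . d_2 t = d_1 t. Arrows are classes of formal composites.
   This is the left adjoint of the nerve: [hCat_adjoint] is the universal
   property of the unit [hunit], and [hmap_hunit] its naturality. *)
Inductive word (X : sSet) : X 0 -> X 0 -> Type :=
| Wid x : word x x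
| Wedge x y (e : X 1) : src e = x -> tgt e = y -> word x y
| Wcmp x y z : word y z -> word x y -> word x z.
Arguments Wid {X} x.
Arguments Wedge {X x y} e _ _.
Arguments Wcmp {X x y z} _ _.

Inductive weq (X : sSet) : forall x y : X 0, word x y -> word x y -> Prop :=
| weq_refl x y (u : word x y) : weq u u
| weq_sym x y (u v : word x y) : weq u v -> weq v u
| weq_trans x y (u v w : word x y) : weq u v -> weq v w -> weq u w
| weq_cmp x y z (v v' : word y z) (u u' : word x y) :
    weq v v' -> weq u u' -> weq (Wcmp v u) (Wcmp v' u')
| weq_1m x y (u : word x y) : weq (Wcmp (Wid y) u) u
| weq_m1 x y (u : word x y) : weq (Wcmp u (Wid x)) u
| weq_A x y z t (w : word z t) (v : word y z) (u : word x y) :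
    weq (Wcmp w (Wcmp v u)) (Wcmp (Wcmp w v) u)
| weq_degen x (p : src (degen x) = x) (q : tgt (degen x) = x) :
    weq (Wedge (degen x) p q) (Wid x)
| weq_face x y z (t : X 2)
    (p2 : src (d2 t) = x) (q2 : tgt (d2 t) = y)
    (p0 : src (d0 t) = y) (q0 : tgt (d0 t) = z)
    (p1 : src (d1 t) = x) (q1 : tgt (d1 t) = z) :
    weq (Wcmp (Wedge (d0 t) p0 q0) (Wedge (d2 t) p2 q2))
        (Wedge (d1 t) p1 q1).

Definition hhom (X : sSet) (x y : X 0) : Type :=
  {c : word x y -> Prop | exists u, c = weq u}.

Definition cls (X : sSet) (x y : X 0) (u : word x y) : hhom x y :=
  exist _ (weq u) (ex_intro _ u erefl).

Definition rep (X : sSet) (x y : X 0) (c : hhom x y) : word x y :=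
  sval (cid (svalP c)).

Lemma cls_eqP (X : sSet) (x y : X 0) (u v : word x y) : cls u = cls v <-> weq u v.
Proof.
split=> [/(f_equal sval) /= E|uv]; first by rewrite E; apply: weq_refl.
apply: eq_exist; apply/funext => w; apply: propext; split=> H.
- exact: weq_trans (weq_sym uv) H.
- exact: weq_trans uv H.
Qed.

Lemma repK (X : sSet) (x y : X 0) (c : hhom x y) : cls (rep c) = c.
Proof.
have E : sval c = weq (rep c) := svalP (cid (svalP c)).
by case: c E => P H /= E; apply: eq_exist.
Qed.

Lemma weq_rep (X : sSet) (x y : X 0) (u : word x y) : weq (rep (cls u)) u.
Proof. by apply/cls_eqP; rewrite repK. Qed.

Lemma cls_ind (X : sSet) (x y : X 0) (P : hhom x y -> Prop) :
  (forall u, P (cls u)) -> forall c, P c.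
Proof. by move=> H c; rewrite -(repK c). Qed.

Definition hcmp (X : sSet) (x y z : X 0) (d : hhom y z) (c : hhom x y) : hhom x z :=
  cls (Wcmp (rep d) (rep c)).

Lemma cls_cmp (X : sSet) (x y z : X 0) (v : word y z) (u : word x y) :
  hcmp (cls v) (cls u) = cls (Wcmp v u).
Proof. by apply/cls_eqP/weq_cmp; apply: weq_rep. Qed.

Definition hCat (X : sSet) : category.
Proof.
exists (X 0) (@hhom X) (fun x => cls (Wid x)) (@hcmp X).
- move=> x y; elim/cls_ind => u; rewrite cls_cmp; apply/cls_eqP/weq_1m.
- move=> x y; elim/cls_ind => u; rewrite cls_cmp; apply/cls_eqP/weq_m1.
- move=> x y z t; elim/cls_ind => w; elim/cls_ind => v; elim/cls_ind => u.
  rewrite !cls_cmp; apply/cls_eqP/weq_A.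
Defined.

Fixpoint word_map (X Y : sSet) (f : sMap X Y) (x y : X 0) (u : word x y) :
  word (smap f x) (smap f y) :=
  match u with
  | Wid x => Wid (smap f x)
  | Wedge x y e p q =>
      Wedge (smap f e)
        (etrans (esym (smap_act f _ e)) (f_equal (@smap _ _ f 0) p))
        (etrans (esym (smap_act f _ e)) (f_equal (@smap _ _ f 0) q))
  | Wcmp x y z v u => Wcmp (word_map f v) (word_map f u)
  end.

Lemma Wedge_eq (X : sSet) (x y : X 0) (e e' : X 1) p q p' q' :
  e = e' -> @Wedge X x y e p q = @Wedge X x y e' p' q'.
Proof.
by move=> E; subst e'; rewrite (Prop_irrelevance p p') (Prop_irrelevance q q').
Qed.

Lemma Wedge_mv (X : sSet) (x y : X 0) (e e' : X 1) (E : e = e') p q :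
  exists p' q', @Wedge X x y e p q = @Wedge X x y e' p' q'.
Proof. by subst e'; exists p, q. Qed.

Lemma weq_map (X Y : sSet) (f : sMap X Y) (x y : X 0) (u v : word x y) :
  weq u v -> weq (word_map f u) (word_map f v).
Proof.
elim=> {x y u v} /=.
- by move=> *; apply: weq_refl.
- by move=> *; apply: weq_sym.
- by move=> x y u v w _ H1 _; apply: weq_trans.
- by move=> *; apply: weq_cmp.
- by move=> *; apply: weq_1m.
- by move=> *; apply: weq_m1.
- by move=> *; apply: weq_A.
- move=> x p q; have E := smap_act f codegen x.
  have p' : src (degen (smap f x)) = smap f x.
    by rewrite /degen -E -[in RHS]p; apply/esym/smap_act.
  have q' : tgt (degen (smap f x)) = smap f x.
    by rewrite /degen -E -[in RHS]q; apply/esym/smap_act.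
  rewrite (Wedge_eq _ _ p' q' E); exact: weq_degen.
- move=> x y z t p2 q2 p0 q0 p1 q1.
  have E i : smap f (face2 i t) = face2 i (smap f t) by apply: smap_act.
  have S i w : src (face2 i t) = w -> src (face2 i (smap f t)) = smap f w.
    by move=> <-; rewrite -E; apply/esym/smap_act.
  have T i w : tgt (face2 i t) = w -> tgt (face2 i (smap f t)) = smap f w.
    by move=> <-; rewrite -E; apply/esym/smap_act.
  rewrite (Wedge_eq _ _ (S _ _ p2) (T _ _ q2) (E _)).
  rewrite (Wedge_eq _ _ (S _ _ p0) (T _ _ q0) (E _)).
  rewrite (Wedge_eq _ _ (S _ _ p1) (T _ _ q1) (E _)).
  exact: weq_face.
Qed.

Definition hmap (X Y : sSet) (f : sMap X Y) : functor (hCat X) (hCat Y).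
Proof.
exists (fun x : hCat X => smap f x : hCat Y)
       (fun x y (c : hhom x y) => cls (word_map f (rep c))).
- by move=> x; apply/cls_eqP/(@weq_map _ _ f _ _ _ (Wid x))/weq_rep.
- move=> x y z v u /=; rewrite cls_cmp; apply/cls_eqP.
  exact/(@weq_map _ _ f _ _ _ (Wcmp (rep v) (rep u)))/weq_rep.
Defined.

Lemma hmap_cls (X Y : sSet) (f : sMap X Y) (x y : X 0) (u : word x y) :
  fmap (hmap f) (cls u : @hom (hCat X) x y) = cls (word_map f u).
Proof. exact/cls_eqP/weq_map/weq_rep. Qed.

Definition vert n (i : 'I_n) : op 1 n := @Op 1 n (fun=> i) (fun _ _ _ => leqnn i).

Definition edge n (i j : 'I_n) (ij : i <= j) : op 2 n.
Proof.
exists (fun t => if t == 0 :> nat then i else j).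
by move=> [[|[|s]] ?] [[|[|t]] ?] //=.
Defined.

Definition triangle n (i j k : 'I_n) (ij : i <= j) (jk : j <= k) : op 3 n.
Proof.
exists (fun t => if t == 0 :> nat then i else if t == 1 :> nat then j else k).
by move=> [[|[|[|s]]] ?] [[|[|[|t]]] ?] //= _; apply: leq_trans jk.
Defined.

Lemma src_edge (X : sSet) n (x : X n) (i j : 'I_n.+1) (ij : i <= j) :
  src (act (edge ij) x) = act (vert i) x.
Proof.
by rewrite /src -act_comp; congr (act _ x); apply: op_ext => -[[|//] ?].
Qed.

Lemma tgt_edge (X : sSet) n (x : X n) (i j : 'I_n.+1) (ij : i <= j) :
  tgt (act (edge ij) x) = act (vert j) x.
Proof.
by rewrite /tgt -act_comp; congr (act _ x); apply: op_ext => -[[|//] ?].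
Qed.

Definition hunit_functor (X : sSet) n (x : X n) : functor (ordcat n) (hCat X).
Proof.
exists (fun i : ordcat n => act (vert i) x : hCat X)
       (fun i j (ij : @hom (ordcat n) i j) =>
          cls (Wedge (act (edge ij) x) (src_edge x ij) (tgt_edge x ij))).
- move=> i; apply/cls_eqP.
  have E : act (edge (idm i)) x = degen (act (vert i) x).
    rewrite /degen -act_comp; congr (act _ x).
    by apply: op_ext => -[[|[|//]] ?].
  have [p [q ->]] := Wedge_mv E (src_edge x _) (tgt_edge x _).
  exact: weq_degen.
- move=> i j k jk ij /=; rewrite cls_cmp; apply/cls_eqP/weq_sym.
  set t := act (triangle ij jk) x.
  have E0 : act (edge jk) x = d0 t.
    by rewrite /face2 -act_comp; congr (act _ x);
       apply: op_ext => -[[|[|//]] ?].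
  have E1 : act (edge (cmp jk ij)) x = d1 t.
    by rewrite /face2 -act_comp; congr (act _ x);
       apply: op_ext => -[[|[|//]] ?].
  have E2 : act (edge ij) x = d2 t.
    by rewrite /face2 -act_comp; congr (act _ x);
       apply: op_ext => -[[|[|//]] ?].
  have [p0 [q0 ->]] := Wedge_mv E0 (src_edge x _) (tgt_edge x _).
  have [p1 [q1 ->]] := Wedge_mv E1 (src_edge x _) (tgt_edge x _).
  have [p2 [q2 ->]] := Wedge_mv E2 (src_edge x _) (tgt_edge x _).
  exact: weq_face.
Defined.

Lemma functor_eq (C D : category) (F G : functor C D)
    (E : forall x, F x = G x) :
  (forall x y (u : hom x y), hom_cast (E x) (E y) (fmap F u) = fmap G u) ->
  F = G.
Proof.
case: F E => F f f1 fM; case: G => G g g1 gM /= E H.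
have FG : F = G by apply/funext.
subst G; apply: functor_ext => x y u; rewrite -H.
by rewrite (Prop_irrelevance (E x) erefl) (Prop_irrelevance (E y) erefl).
Qed.

Lemma cast_Wedge (X : sSet) (x x' y y' : hCat X) (ex : x = x') (ey : y = y')
    (e e' : X 1) p q p' q' : e = e' ->
  hom_cast ex ey (cls (@Wedge X x y e p q) : @hom (hCat X) x y) =
  cls (@Wedge X x' y' e' p' q').
Proof. by move=> E; subst x' y'; rewrite /= (Wedge_eq p q p' q' E). Qed.

Definition hunit (X : sSet) : sMap X (nerve (hCat X)).
Proof.
exists (fun n (x : X n) => hunit_functor x : nerve (hCat X) n).
move=> m n a x.
have E i : hunit_functor (act a x) i = act a (hunit_functor x : nerve _ n) i.
  by rewrite /= -act_comp; congr (act _ x); apply: op_ext.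
apply: (functor_eq (E := E)) => i j ij /=.
apply: cast_Wedge; rewrite -act_comp; congr (act _ x).
by apply: op_ext => -[[|[|//]] ?].
Defined.

Lemma hmap_hunit (X Y : sSet) (f : sMap X Y) :
  nerve_map (hmap f) \s hunit X = hunit Y \s f.
Proof.
apply: sMap_ext => n x.
have E i : fcomp (hmap f) (hunit_functor x) i = hunit_functor (smap f x) i.
  by rewrite /= smap_act.
apply: (functor_eq (E := E)) => i j ij.
rewrite [X in hom_cast _ _ X](hmap_cls f (Wedge _ _ _)) /=.
apply: cast_Wedge; exact: smap_act.
Qed.

Lemma cast_edge (C : category) (s s' : functor (ordcat 1) C)
    (i j : ordcat 1) (u : hom i j) x y p q p' q' :
  s = s' -> @hom_cast C (s i) x (s j) y p q (fmap s u) =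
            @hom_cast C (s' i) x (s' j) y p' q' (fmap s' u).
Proof.
by move=> E; subst s'; rewrite (Prop_irrelevance p p') (Prop_irrelevance q q').
Qed.

Lemma cast_ordcat n (C : category) (s : functor (ordcat n) C)
    (i j k i' j' k' : ordcat n) (jk : hom j' k) (ij : hom i j)
    (ik : hom i' k') x y z p q r t v w :
  i = i' -> j = j' -> k = k' ->
  cmp (@hom_cast C (s j') y (s k) z r t (fmap s jk))
      (@hom_cast C (s i) x (s j) y p q (fmap s ij)) =
  @hom_cast C (s i') x (s k') z v w (fmap s ik).
Proof.
move=> Ei Ej Ek; subst i' j' k' x y z.
rewrite (Prop_irrelevance r erefl) (Prop_irrelevance v erefl).
rewrite (Prop_irrelevance w erefl) /= -fmapM.
by congr (fmap s _); apply: bool_irrelevance.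
Qed.

Lemma cast_ordcat_id n (C : category) (s : functor (ordcat n) C)
    (i j : ordcat n) (ij : hom i j) x p q :
  i = j -> @hom_cast C (s i) x (s j) x p q (fmap s ij) = idm x.
Proof.
move=> E; subst j x; rewrite (Prop_irrelevance q erefl) -fmap1.
by congr (fmap s _); apply: bool_irrelevance.
Qed.

Lemma cast_ordcat_inv n (C : category) (s : functor (ordcat n) C)
    (i j : ordcat n) (ij ij' : hom i j) x y p q p' q' :
  @hom_cast C x (s i) y (s j) p' q' (@hom_cast C (s i) x (s j) y p q (fmap s ij))
  = fmap s ij'.
Proof.
subst x y; rewrite (Prop_irrelevance p' erefl) (Prop_irrelevance q' erefl) /=.
by congr (fmap s _); apply: bool_irrelevance.
Qed.

Lemma cast_cast (C : category) (x x' x'' y y' y'' : C) (p : x = x') (q : y = y')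
    (p' : x' = x'') (q' : y' = y'') (u : hom x y) :
  hom_cast p' q' (hom_cast p q u) = hom_cast (etrans p p') (etrans q q') u.
Proof. by subst x'' y'' x' y'. Qed.

Lemma cast_cmp (C : category) (x x' y y' z z' : C) (p : x = x') (q : y = y')
    (r : z = z') (v : hom y z) (u : hom x y) :
  hom_cast p r (cmp v u) = cmp (hom_cast q r v) (hom_cast p q u).
Proof. by subst x' y' z'. Qed.

Lemma cast_id (C : category) (x y : C) (p : x = y) :
  hom_cast p p (idm x) = idm y.
Proof. by subst y. Qed.

Lemma cast_fmap (C D : category) (G : functor C D) (x x' y y' : C)
    (u : hom x y) (p : x = x') (q : y = y') P Q :
  @hom_cast D (G x) (G x') (G y) (G y') P Q (fmap G u) = fmap G (hom_cast p q u).
Proof.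
by subst x' y'; rewrite (Prop_irrelevance P erefl) (Prop_irrelevance Q erefl).
Qed.

Theorem hCat_adjoint (X : sSet) (C : category) (F : sMap X (nerve C)) :
  exists! G : functor (hCat X) C, nerve_map G \s hunit X = F.
Proof.
pose ob (x : X 0) : C := (smap F x : functor (ordcat 0) C) ord0.
pose i0 : ordcat 1 := @Ordinal 2 0 isT; pose i1 : ordcat 1 := @Ordinal 2 1 isT.
pose h01 : hom i0 i1 := isT.
have Fob m n (a : op m.+1 n.+1) x (i : ordcat m) :
    (smap F (act a x) : functor _ _) i = (smap F x : functor _ _) (a i).
  by rewrite smap_act.
have psrc (e : X 1) x : src e = x -> (smap F e : functor (ordcat 1) C) i0 = ob x.
  move=> <-; rewrite /ob /src Fob; congr (fob _ _); exact: val_inj.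
have ptgt (e : X 1) x : tgt e = x -> (smap F e : functor (ordcat 1) C) i1 = ob x.
  move=> <-; rewrite /ob /tgt Fob; congr (fob _ _); exact: val_inj.
pose g := fix g (x y : X 0) (u : word x y) : hom (ob x) (ob y) :=
  match u with
  | Wid x => idm (ob x)
  | Wedge x y e p q =>
     hom_cast (psrc e x p) (ptgt e y q) (fmap (smap F e : functor _ _) h01)
  | Wcmp x y z v u => cmp (g _ _ v) (g _ _ u)
  end.
have gE x y (u v : word x y) : weq u v -> g _ _ u = g _ _ v.
  elim=> {x y u v} //=.
  - by move=> x y u v w _ -> _ ->.
  - by move=> x y z v v' u u' _ -> _ ->.
  - by move=> *; apply: cmp1m.
  - by move=> *; apply: cmpm1.
  - by move=> *; apply: cmpA.
  - move=> x p q; have E := smap_act F codegen x.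
    have p' : (act codegen (smap F x) : functor _ _) i0 = ob x.
      by rewrite -E; exact (psrc _ _ p).
    have q' : (act codegen (smap F x) : functor _ _) i1 = ob x.
      by rewrite -E; exact (ptgt _ _ q).
    rewrite (cast_edge _ _ _ p' q' E) /=.
    exact: cast_ordcat_id.
  - move=> x y z t p2 q2 p0 q0 p1 q1.
    have E (i : 'I_3) := smap_act F (@coface 2 i) t.
    have P i w : src (face2 i t) = w ->
        (act (@coface 2 i) (smap F t) : functor _ _) i0 = ob w.
      by rewrite -E; exact (psrc _ w).
    have Q i w : tgt (face2 i t) = w ->
        (act (@coface 2 i) (smap F t) : functor _ _) i1 = ob w.
      by rewrite -E; exact (ptgt _ w).
    rewrite (cast_edge _ _ _ (P _ _ p0) (Q _ _ q0) (E _)).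
    rewrite (cast_edge _ _ _ (P _ _ p1) (Q _ _ q1) (E _)).
    rewrite (cast_edge _ _ _ (P _ _ p2) (Q _ _ q2) (E _)) /=.
    by apply: cast_ordcat; apply: val_inj.
pose gm (x y : hCat X) (c : hom x y) : hom (ob x) (ob y) := g x y (rep c).
have gmE x y (u : word x y) : gm x y (cls u) = g x y u by apply/gE/weq_rep.
have gm1 (x : hCat X) : gm x x (idm x) = idm (ob x) by apply: gmE.
have gmM (x y z : hCat X) (v : hom y z) (u : hom x y) :
  gm x z (cmp v u) = cmp (gm y z v) (gm x y u) by apply: gmE.
pose G := @Functor (hCat X) C ob gm gm1 gmM; exists G; split.
- apply: sMap_ext => n x.
  have E i : ob (act (vert i) x) = (smap F x : functor _ _) i.
    by rewrite /ob Fob.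
  apply: (@functor_eq (ordcat n) C (fcomp G (hunit_functor x)) _ E) => i j ij.
  rewrite [fmap (fcomp _ _) _]/= gmE /=.
  have EE := smap_act F (edge ij) x.
  have p : (act (edge ij) (smap F x) : functor _ _) i0 = ob (act (vert i) x).
    by rewrite -EE; exact (psrc _ _ (src_edge x ij)).
  have q : (act (edge ij) (smap F x) : functor _ _) i1 = ob (act (vert j) x).
    by rewrite -EE; exact (ptgt _ _ (tgt_edge x ij)).
  rewrite (cast_edge _ _ _ p q EE) /=.
  exact: cast_ordcat_inv.
- move=> G' H.
  have E (x : hCat X) : G x = G' x.
    rewrite /G /= /ob -H /=; congr (fob G' _).
    rewrite -[RHS]act_id; congr (act _ x); apply: op_ext => k.
    by rewrite (ord1 k).
  apply: (functor_eq (E := E)) => x y c; rewrite -(repK c) [fmap G _]gmE.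
  elim: {c}(rep c) => {x y} [x|x y e p q|x y z v IHv u IHu] /=.
  + by rewrite cast_id -fmap1.
  + have He : smap F e = fcomp G' (hunit_functor e) by rewrite -H.
    rewrite cast_cast.
    have p' : fcomp G' (hunit_functor e) i0 = G' x by rewrite -He -E; exact (psrc _ _ p).
    have q' : fcomp G' (hunit_functor e) i1 = G' y by rewrite -He -E; exact (ptgt _ _ q).
    rewrite (cast_edge _ _ _ p' q' He) /=.
    have E0 : act (edge h01) e = e.
      by rewrite -[RHS]act_id; congr (act _ e); apply: op_ext => -[[|[|//]] ?].
    have p2 : (act (vert i0) e : hCat X) = x by rewrite -(src_edge e h01) E0.
    have q2 : (act (vert i1) e : hCat X) = y by rewrite -(tgt_edge e h01) E0.
    rewrite (cast_fmap _ p2 q2); congr (fmap G' _).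
    exact: cast_Wedge.
  + by rewrite -cls_cmp fmapM -IHv -IHu (cast_cmp _ (E y)).
Qed.

Definition homcat (A B : sSet) : category := hCat (sexp B A).

(* The functor f as an object of hom'(A, B), that is as a vertex
   A x Delta^0 -> B of B^A. *)
Definition name (A B : sSet) (f : sMap A B) : homcat A B :=
  (f \s @sfst A (Delta 0) : sexp B A 0).

Definition cell (A B : sSet) (f g : sMap A B) : Type :=
  @hom (homcat A B) (name f) (name g).

Definition vcomp (A B : sSet) (f g k : sMap A B) (mu : cell g k)
  (la : cell f g) : cell f k := cmp mu la.

Definition cell_cast (A B : sSet) (f f' g g' : sMap A B) (ef : f = f')
  (eg : g = g') (la : cell f g) : cell f' g' :=
  hom_cast (f_equal (@name A B) ef) (f_equal (@name A B) eg) la.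

(* The identity 2-cell, between 1-cells that are equal but possibly not
   convertible. *)
Definition eq_cell (A B : sSet) (f g : sMap A B) (e : f = g) : cell f g :=
  cell_cast erefl e (idm (name f) : cell f f).

Lemma name_postcomp (Y B A : sSet) (f : sMap B A) (b : sMap Y B) :
  smap (postcomp Y f) (name b : sexp B Y 0) = name (f \s b) :> homcat Y A.
Proof. exact: sMap_ext. Qed.

Lemma name_precomp (Y C A : sSet) (u : sMap C A) (y : sMap Y C) :
  smap (precomp A y) (name u : sexp A C 0) = name (u \s y) :> homcat Y A.
Proof. exact: sMap_ext. Qed.

(* The whiskered 2-cells f zeta and la y. *)
Definition whiskerl (Y B A : sSet) (f : sMap B A) (b b' : sMap Y B)
  (zeta : cell b b') : cell (f \s b) (f \s b') :=
  hom_cast (name_postcomp f b) (name_postcomp f b')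
           (fmap (hmap (postcomp Y f)) zeta).

Definition whiskerr (Y C A : sSet) (u v : sMap C A) (la : cell u v)
  (y : sMap Y C) : cell (u \s y) (v \s y) :=
  hom_cast (name_precomp u y) (name_precomp v y)
           (fmap (hmap (precomp A y)) la).

Definition cell_iso (A B : sSet) (f g : sMap A B) (la : cell f g) : Prop :=
  @iso (homcat A B) (name f) (name g) la.

(* To be used for quasi-categories A, B and C; for b : Y -> B and y : Y -> C,
   every chi : f b => g y is la y . f zeta for a unique zeta : b => l y. The
   cast is along f (l y) = (f l) y. *)
Definition abs_right_lifting (A B C : sSet) (f : sMap B A) (g : sMap C A)
  (l : sMap C B) (la : cell (f \s l) g) : Prop :=
  forall Y : sSet, quasi_category Y ->
  forall (b : sMap Y B) (y : sMap Y C) (chi : cell (f \s b) (g \s y)),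
  exists! zeta : cell b (l \s y),
    chi = vcomp (whiskerr la y)
                (cell_cast erefl (scompA f l y) (whiskerl f zeta)).

Definition admits_limits (A X K : sSet) (k : sMap K (sexp A X)) : Prop :=
  exists (l : sMap K A) (la : cell (const_diag A X \s l) k),
    abs_right_lifting la.

Definition res (A X : sSet) : sMap (sexp A (join (Delta 0) X)) (sexp A X) :=
  precomp A (join_incl (Delta 0) X).

(* Main.v *)
(* A cone with a moving apex over a fixed base has two kinds of edges: those
   moving the apex and those moving the base.  Edges with fixed apex are the
   maps out of Delta^0 * (Delta^1 x X), and the simplicial set of "special"
   simplices Delta^0 * (Delta^n x X) -> A lifts left horns against the diagrams
   A^X, since adding the apex turns a left horn into an inner one.  With n = 1
   this transports a cone along a 2-cell of its base; with n = 2 it makes the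
   cell to b from the constant cone at the apex of b weakly cocartesian over
   A^X, and it inverts special edges over identities.

   Given l and lambda : c l => k, transporting the constant cone c' l along
   lambda gives ran with res ran = k.  The existence of factorizations through
   ran follows from that of l and weak cocartesianness.  They are constructed once,
   over the comma object of res and k, so that naturality of the universal one
   gives omega xi = zeta for any factorization xi, where zeta depends only on
   the cell to be factored and omega is the universal factorization at ran.
   Writing omega = nu q with q special, q is invertible and nu has a right
   inverse mu; then omega = omega (q^-1 mu) = nu mu = 1, which gives uniqueness.

   Conversely evaluation at the apex is right adjoint to the constant cone
   functor c', with strict triangle identities, and c = res c'. *)

From mathcomp Require Import all_boot boolp zify.
From mathcomp Require classical_sets.
Require Import Defs.

Set Implicit Arguments.
Unset Strict Implicit.
Unset Printing Implicit Defensive.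

(** * Extension along subcomplexes of Delta^N x J *)

(** All fillers come from one extension theorem. A partial map into a quasi-category, defined on
    part of a subcomplex of Delta^N x J, is extended one inner horn at a time; Zorn's lemma
    concludes. The closure condition [saturated] on the subcomplex keeps each step inside it. With
    the whole product this theorem gives internal homs and comma objects; with [fibred], N = n+1 and
    k = 1 it gives the lifting of left horns.

    What shapes the uniqueness argument is that a cell of cones over a given cell of bases is
    obtained by a choice, and choices made separately for each cell need not be natural in it. A
    single choice over the comma object is natural, because a factorization is itself an edge
    between two maps into that object. Absolute liftings are tested on quasi-categories only, so the
    comma object has to be one. *)

Definition mk_op k l (f : nat -> nat) (fl : forall i, i < k -> f i < l)
  (fm : forall i j, i <= j -> j < k -> f i <= f j) : op k l :=
  @Op k l (fun i => Ordinal (fl i (ltn_ord i)))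
      (fun i j h => fm i j h (ltn_ord j)).

Lemma op_ex k l (f : nat -> nat) :
  (forall i, i < k -> f i < l) ->
  (forall i j, i <= j -> j < k -> f i <= f j) ->
  exists a : op k l, forall i, a i = f i :> nat.
Proof. by move=> fl fm; exists (mk_op fl fm). Qed.

Lemma face_bound q n i : i < n -> bump q i < n.+1.
Proof. by rewrite /bump; lia. Qed.
Lemma face_mono q n i j : i <= j -> j < n -> bump q i <= bump q j.
Proof. by rewrite /bump; lia. Qed.
(** The index is a natural number, not an ordinal as in [coface], so that simplicial identities need
    no casts and reduce to arithmetic. *)
Definition face_op n q : op n n.+1 := mk_op (@face_bound q n) (@face_mono q n).

Lemma dgn_bound n (q : 'I_n) i : i < n.+1 -> unbump q i < n.
Proof. by rewrite /unbump; have := ltn_ord q; lia. Qed.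
Lemma dgn_mono q n i j : i <= j -> j < n -> unbump q i <= unbump q j.
Proof. by rewrite /unbump; lia. Qed.
Definition dgn_op n (q : 'I_n) : op n.+1 n :=
  mk_op (@dgn_bound n q) (@dgn_mono q n.+1).

Lemma op_compA k l m n (a : op m n) (b : op l m) (c : op k l) :
  op_comp a (op_comp b c) = op_comp (op_comp a b) c.
Proof. exact: op_ext. Qed.

Lemma op_id_l k l (a : op k l) : op_comp (op_id l) a = a.
Proof. exact: op_ext. Qed.

Lemma op_id_r k l (a : op k l) : op_comp a (op_id k) = a.
Proof. exact: op_ext. Qed.


(** Operators as functions on naturals, for linear arithmetic; 0 is a default outside the domain. *)
Definition op_nat k l (a : op k l) (t : nat) : nat :=
  if insub t is Some i then a (i : 'I_k) else 0.

Lemma op_natE k l (a : op k l) (i : 'I_k) : op_nat a i = a i.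
Proof. by rewrite /op_nat valK. Qed.

Lemma op_nat_lt k l (a : op k l) t : t < k -> op_nat a t < l.
Proof. by move=> tk; rewrite (op_natE a (Ordinal tk)). Qed.

Lemma op_nat_mono k l (a : op k l) t t' : t <= t' -> t' < k ->
  op_nat a t <= op_nat a t'.
Proof.
move=> tt tk.
rewrite (op_natE a (Ordinal tk)) (op_natE a (Ordinal (leq_ltn_trans tt tk))).
exact: op_mono.
Qed.

Lemma face_factor k n (a : op k n.+1) i : i <= n -> (forall t, a t <> i :> nat) ->
  exists a' : op k n, a = op_comp (face_op n i) a'.
Proof.
move=> i_n ai.
have ai' t : t < k -> op_nat a t <> i.
  by move=> tk; rewrite (op_natE a (Ordinal tk)).
have [a' Ha'] := @op_ex k n (fun t => unbump i (op_nat a t))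
  (fun t tk => ltac:(have := ai' t tk; have := op_nat_lt a tk; rewrite /unbump; lia))
  (fun t t' tt tk => ltac:(have := op_nat_mono a tt tk; rewrite /unbump; lia)).
exists a'; apply: op_ext => t; rewrite /= Ha' op_natE.
by have := ai t; rewrite /bump /unbump; lia.
Qed.

(** Any choice of preimages is monotone, since [a] is monotone and [bump p] strictly increasing. *)
Lemma op_section k n (a : op k n.+1) p (c : 'I_n -> 'I_k) :
  (forall i, a (c i) = bump p i :> nat) ->
  exists2 b : op n k, op_comp a b = face_op n p & forall i, b i = c i.
Proof.
move=> ac.
have mono (i j : 'I_n) : i <= j -> c i <= c j.
  rewrite leq_eqVlt => /orP[/eqP/val_inj->//|ij].
  rewrite leqNgt; apply/negP => /ltnW/(op_mono a); rewrite !ac /bump; lia.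
by exists (@Op _ _ c mono) => //; apply: op_ext => i /=; rewrite ac.
Qed.

Lemma op_endo_id n (d : op n n) : injective d -> d = op_id n.
Proof.
move=> inj; apply: op_ext => i /=.
have incr (j j' : 'I_n) : j < j' -> d j < d j'.
  move=> jj; have := op_mono d (ltnW jj).
  rewrite leq_eqVlt => /orP[/eqP/val_inj/inj E|//]; by rewrite E ltnn in jj.
have lo m (mn : m < n) : m <= d (Ordinal mn).
  elim: m mn => [//|m IH] mn; apply: leq_ltn_trans (IH (ltnW mn)) _.
  exact: incr.
have hi m (mn : n - m.+1 < n) : m < n -> d (Ordinal mn) <= n - m.+1.
  elim: m mn => [|m IH] mn mn'; first by have := ltn_ord (d (Ordinal mn)); lia.
  have mn2 : n - m.+1 < n by lia.
  have := IH mn2 (ltnW mn').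
  have := incr (Ordinal mn) (Ordinal mn2); rewrite /=; lia.
have := lo i (ltn_ord i).
have ri : n - (n - i.+1).+1 < n by have := ltn_ord i; lia.
have := hi (n - i.+1) ri.
have -> : Ordinal ri = i by apply: val_inj => /=; have := ltn_ord i; lia.
have -> : Ordinal (ltn_ord i) = i by apply: val_inj.
by have := ltn_ord i; lia.
Qed.

(** The chosen preimages of the vertices other than [p] form an endomorphism [d]. It is injective
    because [e] composed with it is a coface, so it is the identity. *)
Lemma op_hits_face n (e : op n n.+1) p : p <= n ->
  (forall i, i <= n -> i <> p -> exists t, e t = i :> nat) -> e = face_op n p.
Proof.
move=> pn hit.
have ex (i : 'I_n) : exists t, e t = bump p i :> nat.
  by apply: hit; have := ltn_ord i; rewrite /bump; lia.
have [d ed _] := op_section (fun i => svalP (cid (ex i))).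
suff -> : e = op_comp e d by [].
rewrite (@op_endo_id _ d) ?op_id_r // => i j dd.
have : op_comp e d i = op_comp e d j :> nat by rewrite /= dd.
by rewrite ed /= => H; apply: val_inj; move: H; rewrite /bump /=; lia.
Qed.

(* Partial maps are functional simplicial relations. *)
Section Relations.
Variables G A : sSet.
Definition srel := forall n, G n -> A n -> Prop.
Definition simplicial (R : srel) := forall m n (a : op m.+1 n.+1) x y,
  R n x y -> R m (act a x) (act a y).
Definition functional (R : srel) := forall n x y y', R n x y -> R n x y' -> y = y'.
Definition dom (R : srel) n (x : G n) := exists y, R n x y.
Definition subcomplex (V : forall n, G n -> Prop) :=
  forall m n (a : op m.+1 n.+1) x, V n x -> V m (act a x).
End Relations.

Definition ssub (G : sSet) (V : forall n, G n -> Prop) (hV : subcomplex V) : sSet.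
Proof.
exists (fun n => {x : G n | V n x})
  (fun m n a x => exist _ (act a (sval x)) (hV _ _ a _ (svalP x))).
- by move=> n [x h]; apply: eq_exist; rewrite act_id.
- by move=> k m n a b [x h]; apply: eq_exist; rewrite act_comp.
Defined.

Lemma rel_sMap (G A : sSet) (R : srel G A) (V : forall n, G n -> Prop)
    (hV : subcomplex V) :
  simplicial R -> functional R -> (forall n x, V n x -> dom R x) ->
  exists f : sMap (ssub hV) A, forall n (x : ssub hV n) y,
    R n (sval x) y -> smap f x = y.
Proof.
move=> Rs Rf Vd.
pose g n (x : ssub hV n) := sval (cid (Vd n _ (svalP x))).
have gP n (x : ssub hV n) : R n (sval x) (g n x) := svalP (cid _).
unshelve eexists (@SMap _ _ g _).
  by move=> m n a x; apply: Rf (gP _ _) _; apply: Rs (gP _ _).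
by move=> n x y; apply: Rf (gP _ _).
Qed.

Section Extension.
Variables (N k : nat) (k0 : 0 < k) (kN : k < N) (J : sSet).
Local Notation G := (Delta N \x J).

(* [tau] arises from its q-th face by inserting a vertex over k in front of a
   vertex over k+1, which is duplicated in the second component. *)
Definition doubled m (tau : G m.+1) (q : 'I_m.+1) :=
  [/\ (tau.1 : op _ _) (widen_ord (leqnSn _) q) = k :> nat,
      (tau.1 : op _ _) (lift ord0 q) = k.+1 :> nat &
      tau.2 = act (op_comp (face_op m.+1 q) (dgn_op q)) tau.2].

(** Required of two complexes: of [V], so that the simplex added in order to reach a missing one
    stays in [V]; of the domain of a partial map, as the invariant by which faces of that simplex
    are found in the domain. *)
Definition saturated (S : forall n, G n -> Prop) :=
  forall m (tau : G m.+1) q, doubled tau q ->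
    S m (act (face_op m.+1 q : op m.+1 m.+2) tau) -> S m.+1 tau.

Variables (A : sSet) (hA : quasi_category A).
Variables (V : forall n, G n -> Prop) (hV : subcomplex V) (sV : saturated V).

Definition good (R : srel G A) :=
  [/\ simplicial R, functional R, forall n (x : G n), dom R x -> V x & saturated (fun n x => dom R x)].

Variable R : srel G A.
Hypothesis gR : good R.
Hypothesis hornR : forall n (x : G n) (i : 'I_N.+1), V x -> i <> k :> nat ->
  (forall j, (x.1 : op _ _) j <> i) -> dom R x.

(** The second component of the measure, after the dimension: moving the first vertex over k+1 down
    to k keeps the dimension and lowers this number. *)
Definition kcount n (x : G n) := #|[pred j | (x.1 : op _ _) j == k.+1 :> nat]|.

Lemma dom_act m n (a : op m.+1 n.+1) (x : G n) : dom R x -> dom R (act a x).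
Proof. by case: gR => s _ _ _ [y h]; exists (act a y); apply: s. Qed.


Lemma nat_min (P : nat -> Prop) : (exists n, P n) ->
  exists2 n, P n & forall m, P m -> n <= m.
Proof.
move=> [n Pn]; have ex : exists n, `[< P n >] by exists n; apply/asboolP.
exists (ex_minn ex); case: ex_minnP => [m /asboolP Pm] // mn m' Pm'.
by apply: mn; apply/asboolP.
Qed.

Lemma minimal_missing n (x : G n) : V x -> ~ dom R x ->
  exists m (sigma : G m), [/\ V sigma, ~ dom R sigma,
    forall m' (x' : G m'), V x' -> m' < m -> dom R x' &
    forall x' : G m, V x' -> kcount x' < kcount sigma -> dom R x'].
Proof.
move=> Vx nx; pose P1 m := exists x' : G m, V x' /\ ~ dom R x'.
have [m Pm mP] : exists2 m, P1 m & forall m', P1 m' -> m <= m'.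
  by apply: nat_min; exists n, x.
pose P2 c := exists x' : G m, [/\ V x', ~ dom R x' & kcount x' = c].
have [c [s [Vs ns sc]] cP] : exists2 c, P2 c & forall c', P2 c' -> c <= c'.
  by case: Pm => x' [Vx' nx']; apply: nat_min; exists (kcount x'), x'.
exists m, s; split=> // [m' x' Vx' mm|x' Vx' cc]; apply: contrapT => nx'.
- by have := mP m' (ex_intro _ x' (conj Vx' nx')); rewrite leqNgt mm.
- by have := cP _ (ex_intro _ x' (And3 Vx' nx' erefl)); rewrite leqNgt -sc cc.
Qed.

(* For a minimal missing sigma, let tau insert a vertex over k in front of the
   first vertex p over k+1.  By minimality and saturation the faces of tau other
   than the p-th one, sigma, are in the domain of R, so R is defined exactly on
   the p-th horn of tau; this horn is inner since sigma has a vertex over 0. *)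
Lemma good_step n (x : G n) : V x -> ~ dom R x ->
  exists R' : srel G A, [/\ good R', forall n x y, R x y -> R' n x y &
     exists n (x : G n), dom R' x /\ ~ dom R x].
Proof.
move=> Vx nx.
have [m [sigma [Vs ns mdim mk]]] := minimal_missing Vx nx.
have [Rs Rf RV RS] := gR; clear x Vx nx n.
have hit (i : 'I_N.+1) : i <> k :> nat -> exists j, (sigma.1 : op _ _) j = i.
  by move=> ik; apply: contrapT => /forallNP H; apply/ns/(hornR Vs ik).
have [p up minp] : exists2 p : 'I_m.+1, (sigma.1 : op _ _) p = k.+1 :> nat &
    forall j : 'I_m.+1, j < p -> (sigma.1 : op _ _) j <= k.
  have [|j0 Ej] := hit (Ordinal (kN : k.+1 < N.+1)); first by rewrite /=; lia.
  pose Q t := exists2 j : 'I_m.+1, j = t :> nat & (sigma.1 : op _ _) j = k.+1 :> nat.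
  have [|t [p pt up] tP] := @nat_min Q; first by exists j0, j0; rewrite ?Ej.
  exists p => // j jp; have := op_mono (sigma.1 : op _ _) (ltnW jp).
  rewrite up leq_eqVlt ltnS => /orP[/eqP E|//].
  by have := tP j (ex_intro2 _ _ j erefl E); rewrite -pt leqNgt jp.
have p0 : 0 < p.
  have [|j Ej] := hit ord0; first by rewrite /=; lia.
  rewrite lt0n; apply/eqP => p0.
  by have := @op_mono _ _ (sigma.1 : op _ _) p j; rewrite Ej up p0 /=; lia.
pose u := sigma.1 : op m.+1 N.+1.
have kN' : k < N.+1 by lia.
have umono := @op_nat_mono _ _ u; have ulo := @op_nat_lt _ _ u.
have upn : op_nat u p = k.+1 by rewrite op_natE.
have um t : t < p -> op_nat u t <= k.
  by move=> tp; rewrite (op_natE u (Ordinal (ltn_trans tp (ltn_ord p)))) minp.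
have pm := ltn_ord p.
pose vn j := if j == p :> nat then k else op_nat u (unbump p j).
have vlt j : j < m.+2 -> vn j < N.+1.
  by rewrite /vn; case: ifP => // _ jm; apply: ulo; rewrite /unbump; lia.
have vmono i j : i <= j -> j < m.+2 -> vn i <= vn j.
  move=> ij jm; rewrite /vn.
  have := @umono (unbump p i) (unbump p j); have := @umono p (unbump p j).
  have := @um (unbump p i); rewrite upn.
  by case: ifP => /eqP; case: ifP => /eqP; rewrite /unbump; lia.
have [v Ev] := op_ex vlt vmono; rewrite /vn in Ev.
pose tau : G m.+1 := (v : Delta N m.+1, act (dgn_op p) sigma.2).
have tauE : act (face_op m.+1 p) tau = sigma.
  rewrite [RHS]surjective_pairing; congr pair.
    apply: op_ext => j; rewrite /= Ev /= -op_natE.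
    case: eqP => [|_]; first by rewrite /bump; lia.
    by congr op_nat; rewrite /bump /unbump; lia.
  rewrite /= -act_comp -[RHS]act_id; congr (act _ _).
  by apply: op_ext => j /=; rewrite /bump /unbump; lia.
have dtau : doubled tau p.
  split.
  - by rewrite /= Ev /= eqxx.
  - by rewrite /= Ev /= -upn; case: eqP => [|_]; [rewrite /bump; lia|];
      congr op_nat; rewrite /bump /unbump; lia.
  - rewrite /= -act_comp; congr (act _ _).
    by apply: op_ext => j /=; rewrite /bump /unbump; lia.
have Vt : V tau by apply: (sV dtau); rewrite tauE.
have faces i : i <= m.+1 -> i <> p -> dom R (act (face_op m.+1 i) tau).
  have Vti : V (act (face_op m.+1 i) tau) by apply: hV.
  (* Deleting [p.+1] amounts to moving the vertex [p] of [sigma] from k+1 to k, so [kcount] drops.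
     Any other face is again doubled, and its face at the inserted vertex is a face of [sigma], of
     smaller dimension. *)
  move=> im ip; have [iq|iq] := eqVneq i p.+1.
    apply: mk => //; apply: proper_card; apply/properP; split.
      apply/subsetP => j; rewrite !inE /= Ev /= iq => /eqP E; apply/eqP; move: E.
      case: ifP => /eqP; first lia.
      rewrite -(op_natE _ j) -/u => jp; have [jp'|jp'] := ltnP j p.
        by rewrite /bump /unbump => <-; congr op_nat; lia.
      by move: jp; rewrite /bump /unbump => jp <-; congr op_nat; lia.
    exists p; first by rewrite inE up.
    rewrite inE /= Ev /= iq /bump ltnn /= add0n eqxx; apply/eqP; lia.
  have [m' Em] : exists m', m = m'.+1 by exists m.-1; lia.
  subst m.
  have qlt : (if i < p then p.-1 else p : nat) < m'.+1 by case: ifP; lia.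
  have E : act (face_op m'.+1 (Ordinal qlt)) (act (face_op m'.+2 i) tau) =
           act (face_op m'.+1 (if i < p then i else i.-1)) sigma.
    rewrite -tauE -!act_comp; congr (act _ _); apply: op_ext => j /=.
    by rewrite /bump; case: ifP; lia.
  apply: (RS m' _ (Ordinal qlt)); last first.
    by rewrite E; apply: mdim => //; apply: hV.
  split.
  - by rewrite /= Ev /= ifT //; rewrite /bump /=; apply/eqP; case: ifP; lia.
  - rewrite /= Ev /= ifF -?upn; last first.
      by apply/eqP; rewrite /bump /=; case: ifP; lia.
    by congr op_nat; rewrite /bump /unbump /=; case: ifP; lia.
  - rewrite /= -!act_comp; congr (act _ _); apply: op_ext => j /=.
    by rewrite /bump /unbump; case: ifP; lia.
(* If [a] hits every vertex except possibly [p], a section of [a] recovers [sigma] from [act a tau],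
   which is therefore outside the domain. *)
have missE j (a : op j.+1 m.+2) :
    dom R (act a tau) <-> exists i, [/\ i <= m.+1, i <> p & forall t, a t <> i :> nat].
  split=> [da|[i [im ip ai]]].
  - apply: contrapT => no; apply: ns.
    have ex (i : 'I_m.+1) : exists t, a t = bump p i :> nat.
      apply: contrapT => /forallNP H; apply: no; exists (bump p i); split=> //.
      - by have := ltn_ord i; rewrite /bump; lia.
      - by rewrite /bump; lia.
    have [b ab _] := op_section (fun i => svalP (cid (ex i))).
    rewrite -tauE -ab act_comp; exact: dom_act.
  - have [a' ->] := face_factor im ai; rewrite act_comp; apply: dom_act; exact: faces.
(* This makes the new values single-valued. A section of [a'] through [t] restricts [act a' tau] to
   [sigma]; composed with it, [b'] must also hit all vertices but [p], hence be the same coface, so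
   [a'] and [b'] agree at [t]. *)
have inj j (a b : op j.+1 m.+2) : act a tau = act b tau -> ~ dom R (act a tau) -> a = b.
  have half (a' b' : op j.+1 m.+2) : act a' tau = act b' tau -> ~ dom R (act a' tau) ->
      forall t, a' t <> p :> nat -> b' t = a' t :> nat.
    move=> E na t atp.
    have hits i : i <= m.+1 -> i <> p -> exists t, a' t = i :> nat.
      move=> im ip; apply: contrapT => /forallNP H; apply/na/missE.
      by exists i.
    have ex (i : 'I_m.+1) : exists t, a' t = bump p i :> nat.
      by apply: hits; have := ltn_ord i; rewrite /bump; lia.
    pose c (i : 'I_m.+1) := if a' t == bump p i :> nat then t else sval (cid (ex i)).
    have cP i : a' (c i) = bump p i :> nat.
      by rewrite /c; case: eqP => // _; case: cid.
    have [s as_ sc] := op_section cP.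
    have bs : op_comp b' s = face_op m.+1 p.
      apply: op_hits_face => [|i im ip]; first lia.
      apply: contrapT => /forallNP H; apply: ns.
      rewrite -tauE -as_ act_comp E -act_comp; apply/missE.
      by exists i.
    have tb : unbump p (a' t) < m.+1 by have := ltn_ord (a' t); rewrite /unbump; lia.
    have ct : c (Ordinal tb) = t.
      by rewrite /c; case: eqP => // -[]; rewrite /= /bump /unbump; lia.
    have : op_comp b' s (Ordinal tb) = op_comp a' s (Ordinal tb) :> nat by rewrite bs as_.
    by rewrite /= sc ct.
  move=> E na; apply: op_ext => t.
  have [ap|ap] := eqVneq (a t : nat) p; last by rewrite (half _ _ E na t) //; apply/eqP.
  have [bp|bp] := eqVneq (b t : nat) p; first by rewrite ap bp.
  by rewrite (half b a) // -?E //; apply/eqP.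
have pp : p < m.+2 by lia.
pose p' : 'I_m.+2 := Ordinal pp.
have hornE j (a : horn p' j) : dom R (act (sval a : op _ _) tau).
  case: (svalP a) => i [ip ai]; apply/missE; exists i; split.
  - by have := ltn_ord i; lia.
  - by move=> E; apply: ip; apply: val_inj.
  - by move=> t E; apply: (ai t); apply: val_inj.
pose g j (a : horn p' j) := sval (cid (hornE j a)).
have gP j (a : horn p' j) : R (act (sval a : op _ _) tau) (g j a) := svalP (cid _).
have [gm gmE] : exists gm : sMap (horn p') A, forall j (a : horn p' j), smap gm a = g j a.
  unshelve eexists (@SMap (horn p') A g _) => //.
  move=> i j b a; apply: Rf (gP _ _) _; rewrite /= act_comp.
  exact: Rs (gP _ a).
have [w wE] := hA (k := p') (ltac:(rewrite /=; lia)) gm.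
have wP j (a : op j.+1 m.+2) : dom R (act a tau) -> R (act a tau) (smap w (a : Delta _ _)).
  move=> /missE[i [im ip ai]].
  have ha : exists i : 'I_m.+2, i <> p' /\ forall t, a t <> i.
    exists (Ordinal (im : i < m.+2)); split; first by move=> /(f_equal val).
    by move=> t /(f_equal val) /=; apply: ai.
  have := gP _ (exist _ a ha : horn p' j); rewrite -gmE.
  by have /(f_equal (fun f : sMap _ _ => smap f (exist _ a ha : horn p' j))) /= <- := wE.
pose R' j (x : G j) y := R x y \/ exists2 a : op j.+1 m.+2, x = act a tau & y = smap w (a : Delta _ _).
exists R'; split; first split.
- move=> i j b x y [h|[a -> ->]]; first by left; apply: (Rs _ _ b).
  by right; exists (op_comp a b); rewrite ?act_comp // -smap_act.
- move=> j x y y' [h|[a Ea ->]] [h'|[b Eb ->]].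
  + exact: Rf h h'.
  + by rewrite Eb in h; exact: (Rf _ _ _ _ h (wP _ b (ex_intro _ y h))).
  + by rewrite Ea in h'; exact: (Rf _ _ _ _ (wP _ a (ex_intro _ y' h')) h').
  + have [d|nd] := pselect (dom R (act a tau)).
      have Eab : act a tau = act b tau by rewrite -Ea -Eb.
      by apply: Rf (wP _ _ d) _; rewrite Eab; apply: wP; rewrite -Eab.
    by congr (smap w _); apply: inj nd; rewrite -Ea -Eb.
- move=> j x [y [h|[a -> _]]]; first by apply: RV; exists y.
  exact: hV.
(* Saturation of the new domain. If the face of [rho] is a new simplex [act a tau], then [a] sends
   [q] to [p.+1], and inserting the value [p] in front of it presents [rho] as a restriction of
   [tau]. *)
- move=> j rho q dq [y [h|[a Ea _]]].
    by have [|y' h'] := RS _ _ _ dq; [exists y|exists y'; left].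
  have [d|nd] := pselect (dom R (act a tau)).
    by have [|y' h'] := RS _ _ _ dq; [rewrite Ea|exists y'; left].
  have [t0 at0] : exists t, a t = p.+1 :> nat.
    apply: contrapT => /forallNP H; apply/nd/missE; exists p.+1; split=> //; lia.
  case: dq; set r : op _ _ := rho.1 => r1 r2 r3.
  have Er (t : 'I_j.+1) : op_nat r (bump q t) = v (a t).
    have /(f_equal (fun x : G j => (x.1 : op _ _) t : nat)) /= <- := Ea.
    by rewrite -op_natE.
  have rq : op_nat r q = k by rewrite -r1 -op_natE.
  have rq1 : op_nat r q.+1 = k.+1 by rewrite -r2 -op_natE.
  have qm := ltn_ord q.
  have vE (x : 'I_m.+2) : (p < x) = (k < v x).
    rewrite Ev; case: ifP => /eqP xp; first by rewrite xp !ltnn.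
    have [px|px] := ltnP p x.
      by rewrite -upn umono //; have := ltn_ord x; rewrite /unbump; lia.
    by apply/esym/negbTE; rewrite -leqNgt um //; rewrite /unbump; lia.
  have lowa (t : 'I_j.+1) : t < q -> a t <= p.
    move=> tq; rewrite leqNgt vE -leqNgt -Er -rq.
    by apply: op_nat_mono; rewrite /bump; lia.
  have aq : a q = p.+1 :> nat.
    apply/eqP; rewrite eqn_leq vE -Er /bump leqnn add1n rq1 ltnSn andbT -at0.
    by apply: op_mono; rewrite leqNgt; apply/negP => /lowa; rewrite at0 ltnn.
  have aqn : op_nat a q = p.+1 by rewrite op_natE.
  have alo t : t < q -> op_nat a t <= p.
    by move=> tq; rewrite (op_natE a (Ordinal (ltn_trans tq qm))) lowa.
  pose an t := if t == q :> nat then p : nat else op_nat a (unbump q t).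
  have anlt t : t < j.+2 -> an t < m.+2.
    rewrite /an; case: ifP => [_ _|/eqP tq tj]; first lia.
    by apply: op_nat_lt; rewrite /unbump; lia.
  have anmono t t' : t <= t' -> t' < j.+2 -> an t <= an t'.
    move=> tt tj; rewrite /an.
    have := @op_nat_mono _ _ a (unbump q t) (unbump q t').
    have := @op_nat_mono _ _ a q (unbump q t'); have := alo (unbump q t).
    by rewrite aqn; case: ifP => /eqP; case: ifP => /eqP; rewrite /unbump; lia.
  have [a' Ea'] := op_ex anlt anmono; rewrite /an in Ea'.
  suff -> : rho = act a' tau.
    by exists (smap w (a' : Delta _ _)); right; exists a'.
  have /(f_equal snd) Ea2 := Ea; rewrite /= in Ea2.
  rewrite [LHS]surjective_pairing; congr pair.
    apply: op_ext => t /=; have [tq|tq] := eqVneq (t : nat) q.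
      have -> : a' t = Ordinal pp by apply: val_inj; rewrite /= Ea' tq eqxx.
      by rewrite Ev /= eqxx -rq -op_natE tq.
    have tj : unbump q t < j.+1 by have := ltn_ord t; move/eqP: tq; rewrite /unbump; lia.
    have -> : a' t = a (Ordinal tj).
      by apply: val_inj; rewrite /= Ea' (negbTE tq) -op_natE.
    rewrite -Er -op_natE; congr op_nat; move/eqP: tq; rewrite /bump /unbump /=; lia.
  rewrite r3 act_comp Ea2 /= -!act_comp; congr (act _ _).
  apply: op_ext => t /=; rewrite Ea'; case: ifP => [/eqP tq|/eqP tq].
    suff -> : a (dgn_op q t) = p.+1 :> nat by rewrite /unbump; lia.
    by rewrite -aq; apply: op_eq; rewrite /= tq /unbump; lia.
  by rewrite -op_natE.
- by move=> j x y h; left.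
- exists m, sigma; split=> //; eexists; right; exists (face_op m.+1 p) => //.
Qed.

End Extension.

(** A maximal good partial map is total on [V], since [good_step] would enlarge it otherwise. *)
Theorem extension (N k : nat) (J A : sSet) (V : forall n, (Delta N \x J) n -> Prop)
    (hV : subcomplex V) (R : srel (Delta N \x J) A) :
  0 < k -> k < N -> quasi_category A -> saturated k V -> good k V R ->
  (forall n (x : (Delta N \x J) n) (i : 'I_N.+1), V n x -> i <> k :> nat ->
     (forall j, (x.1 : op _ _) j <> i) -> dom R x) ->
  exists F : sMap (ssub hV) A,
    forall n (x : ssub hV n) y, R n (sval x) y -> smap F x = y.
Proof.
move=> k0 kN hA sV gR hornR; set G := Delta N \x J in V hV R sV gR hornR *.
pose T := {n : nat & (G n * A n)%type}.
(* [R] is joined to every set, so that the union of the empty chain is good and the maximal element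
   extends [R]. *)
pose U (S : T -> Prop) : srel G A := fun n x y => R n x y \/ S (existT _ n (x, y)).
have [|S [gS maxS]] := @classical_sets.Zorn_bigcup T (fun S => good k V (U S)).
  move=> F Fgood Ftot; set B := classical_sets.bigcup _ _.
  have pick n x y : U B n x y -> R n x y \/ exists2 S, F S & U S n x y.
    by move=> [h|[S FS h]]; [left|right; exists S => //; right].
  have emb S n x y : F S -> U S n x y -> U B n x y.
    by move=> FS [h|h]; [left|right; exists S].
  have embR n x y : R n x y -> U B n x y by left.
  have [Rs Rf RV RS] := gR; split.
  - move=> m n a x y /pick[h|[S FS h]]; first by left; apply: (Rs _ _ a).
    by apply: (emb S) => //; have [s _ _ _] := Fgood _ FS; apply: (s _ _ a).
  - move=> n x y y' /pick[h|[S FS h]] /pick[h'|[S' FS' h']].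
    + exact: Rf h h'.
    + by have [_ f _ _] := Fgood _ FS'; apply: f h'; left.
    + by have [_ f _ _] := Fgood _ FS; apply: f h _; left.
    + have [SS|SS] := Ftot _ _ FS FS'.
      * have [_ f _ _] := Fgood _ FS'; apply: f h'.
        by case: h => h; [left|right; apply: SS].
      * have [_ f _ _] := Fgood _ FS; apply: f h _.
        by case: h' => h; [left|right; apply: SS].
  - move=> n x [y /pick[h|[S FS h]]]; first by apply: RV; exists y.
    by have [_ _ v _] := Fgood _ FS; apply: v; exists y.
  - move=> m tau q dq [y /pick[h|[S FS h]]].
      by have [|y' h'] := RS _ _ _ dq; [exists y|exists y'; left].
    have [_ _ _ s] := Fgood _ FS.
    by have [|y' h'] := s _ _ _ dq; [exists y|exists y'; apply: (emb S)].
have total n (x : G n) : V n x -> dom (U S) x.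
  move=> Vx; apply: contrapT => nx.
  have [|R' [gR' RR' [m [z [[y zy] nz]]]]] := good_step k0 kN hA hV sV gS _ Vx nx.
    move=> m z i Vz ik zi; have [y h] := hornR m z i Vz ik zi.
    by exists y; left.
  pose S' : T -> Prop := fun t => R' (tag t) (tagged t).1 (tagged t).2.
  have UR' : U S' = R'.
    apply: functional_extensionality_dep => j; apply/funext => w; apply/funext => w'.
    by apply: propext; split=> [[h|//]|h]; [apply: RR'; left|right].
  apply: (maxS S'); last by rewrite UR'.
  split; first by move=> [j [w w']] h; apply: RR'; right.
  move=> sub; apply: nz; exists y; right; exact: (sub (existT _ m (z, y)) zy).
have [Us Uf _ _] := gS.
have [F FP] := rel_sMap hV Us Uf total.
by exists F => n x y h; apply: FP; left.
Qed.

(** * Horns and triangles *)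

Lemma cofaceE n (i : 'I_n.+1) : coface i = face_op n i.
Proof. exact: op_ext. Qed.

Lemma sMap_of_rel (G A : sSet) (R : srel G A) :
  simplicial R -> functional R -> (forall n (x : G n), dom R x) ->
  exists f : sMap G A, forall n (x : G n) y, R n x y -> smap f x = y.
Proof.
move=> Rs Rf Rd.
pose g n (x : G n) := sval (cid (Rd n x)).
have gP n (x : G n) : R n x (g n x) := svalP (cid _).
unshelve eexists (@SMap G A g _).
  by move=> m n a x; apply: Rf (gP _ _) _; apply: Rs (gP _ _).
by move=> n x y; apply: Rf (gP _ _).
Qed.

(** Compatibility is stated on arbitrary common restrictions; this form also covers the horns of
    Delta^1. The entry [y k] is a dummy. *)
Lemma horn_glue (A : sSet) n (k : 'I_n.+2) (y : 'I_n.+2 -> A n) :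
  (forall i j m (c d : op m.+1 n.+1), i <> k -> j <> k ->
     op_comp (face_op n.+1 i) c = op_comp (face_op n.+1 j) d ->
     act c (y i) = act d (y j)) ->
  exists u : sMap (horn k) A, forall i m (c : op m.+1 n.+1) (a : horn k m),
    i <> k -> sval a = op_comp (face_op n.+1 i) c -> smap u a = act c (y i).
Proof.
move=> compat.
pose R : srel (horn k) A := fun m a x =>
  exists i (c : op m.+1 n.+1), [/\ i <> k, sval a = op_comp (face_op n.+1 i) c & x = act c (y i)].
have [||m [a [i [ik ai]]]|u uP] := @sMap_of_rel _ _ R.
- move=> m l b [a ha] x [i [c [ik /= E ->]]]; exists i, (op_comp c b).
  by split; rewrite // ?act_comp //= E -op_compA.
- move=> m a x x' [i [c [ik E ->]]] [j [d [jk E' ->]]].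
  by apply: compat => //; rewrite -E -E'.
- have [||c E] := @face_factor _ _ a i; first by have := ltn_ord i.
    by move=> t /val_inj; apply: ai.
  by exists (act c (y i)), i, c.
- exists u => i m c a ik E; apply: uP; exists i, c.
  by split.
Qed.

(** Two facets meet in a face of codimension two, so compatibility on a horn reduces to the
    simplicial identities. *)
Lemma face_face_factor m n i j (c d : op m.+1 n.+2) : i < j -> j <= n.+2 ->
  op_comp (face_op n.+2 i) c = op_comp (face_op n.+2 j) d ->
  exists e : op m.+1 n.+1, c = op_comp (face_op n.+1 j.-1) e /\
                           d = op_comp (face_op n.+1 i) e.
Proof.
move=> ij jn E.
have Et t : bump i (c t) = bump j (d t).
  by have /(f_equal (fun a : op _ _ => a t : nat)) := E.
have [||e ed] := @face_factor _ _ d i; first lia.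
  by move=> t; have := Et t; rewrite /bump; lia.
exists e; split=> //; apply: op_ext => t; have := Et t.
by rewrite ed /= /bump; lia.
Qed.

Lemma face_op_inj m n i (c d : op m n) :
  op_comp (face_op n i) c = op_comp (face_op n i) d -> c = d.
Proof.
move=> E; apply: op_ext => t.
have /(f_equal (fun a : op _ _ => a t : nat)) /= := E.
by rewrite /bump; lia.
Qed.

Lemma horn_glue_faces (A : sSet) n (k : 'I_n.+3) (y : 'I_n.+3 -> A n.+1) :
  (forall i j : 'I_n.+3, i < j -> i <> k -> j <> k ->
     act (face_op n.+1 i) (y j) = act (face_op n.+1 j.-1) (y i)) ->
  exists u : sMap (horn k) A, forall i m (c : op m.+1 n.+2) (a : horn k m),
    i <> k -> sval a = op_comp (face_op n.+2 i) c -> smap u a = act c (y i).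
Proof.
move=> H; apply: horn_glue => i j m c d ik jk E.
have [ij|ji|/val_inj ij] := ltngtP i j.
- have [e [-> ->]] := face_face_factor ij (ltn_ord j : j <= n.+2) E.
  by rewrite !act_comp H.
- have [e [-> ->]] := face_face_factor ji (ltn_ord i : i <= n.+2) (esym E).
  by rewrite !act_comp -H.
- by subst j; rewrite (face_op_inj E).
Qed.

Lemma horn_fill (A : sSet) n (k : 'I_n.+3) (y : 'I_n.+3 -> A n.+1) :
  quasi_category A -> 0 < k < n.+2 ->
  (forall i j : 'I_n.+3, i < j -> i <> k -> j <> k ->
     act (face_op n.+1 i) (y j) = act (face_op n.+1 j.-1) (y i)) ->
  exists t : A n.+2, forall i, i <> k -> act (face_op n.+2 i) t = y i.
Proof.
move=> hA hk /horn_glue_faces[u uP].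
have [v vE] := hA _ _ hk u.
exists (smap v (op_id _ : Delta _ _)) => i ik.
have hi : exists j : 'I_n.+3, j <> k /\ forall t, face_op n.+2 i t <> j.
  exists i; split=> // t /(f_equal val) /=; rewrite /bump; lia.
rewrite -smap_act -[RHS]act_id -(uP i _ _ (exist _ (face_op n.+2 i) hi : horn k _)) //.
by rewrite -vE /=; congr (smap v _); apply: op_ext.
Qed.

(** The edges are 01, 12 and 02 in this order: [h] is a composite of [f] followed by [g]. *)
Definition tri (S : sSet) (f g h : S 1) :=
  exists t : S 2, [/\ d2 t = f, d0 t = g & d1 t = h].

Lemma face_face (S : sSet) n i j (t : S n.+2) : i < j ->
  act (face_op n.+1 i) (act (face_op n.+2 j) t) =
  act (face_op n.+1 j.-1) (act (face_op n.+2 i) t).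
Proof.
move=> ij; rewrite -!act_comp; congr (act _ t); apply: op_ext => s /=.
by rewrite /bump; lia.
Qed.

(** * Composition of edges up to homotopy *)

Section Triangles.
Variables (S : sSet) (hS : quasi_category S).
Implicit Types f g h : S 1.

Lemma tri_src f g h : tri f g h -> src h = src f.
Proof.
move=> [t [<- _ <-]]; rewrite /src /face2 -!act_comp; congr (act _ t).
by apply: op_ext => -[[|//] ?].
Qed.

Lemma tri_tgt f g h : tri f g h -> tgt h = tgt g.
Proof.
move=> [t [_ <- <-]]; rewrite /tgt /face2 -!act_comp; congr (act _ t).
by apply: op_ext => -[[|//] ?].
Qed.

Lemma tri_mid f g h : tri f g h -> tgt f = src g.
Proof.
move=> [t [<- <- _]]; rewrite /tgt /src /face2 -!act_comp; congr (act _ t).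
by apply: op_ext => -[[|//] ?].
Qed.

Lemma src_degen (x : S 0) : src (degen x) = x.
Proof.
rewrite /src /degen -act_comp -[RHS]act_id; congr (act _ _).
by apply: op_ext => -[[|//] ?].
Qed.

Lemma tgt_degen (x : S 0) : tgt (degen x) = x.
Proof.
rewrite /tgt /degen -act_comp -[RHS]act_id; congr (act _ _).
by apply: op_ext => -[[|//] ?].
Qed.

Lemma tri_comp f g : tgt f = src g -> exists h, tri f g h.
Proof.
move=> fg.
pose y (i : 'I_3) := if i == 0 :> nat then g else f.
have [|i j ij|t tE] := @horn_fill S 0 (@Ordinal 3 1 isT) y hS; first by [].
- have : i <> 1 :> nat -> j <> 1 :> nat -> i = 0 :> nat /\ j = 2 :> nat.
    by have := ltn_ord j; lia.
  move=> H ik jk; have [||i0 j2] := H.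
  + by move=> E; apply: ik; apply: val_inj.
  + by move=> E; apply: jk; apply: val_inj.
  + by rewrite /y i0 j2 /=; move: fg; rewrite /tgt /src !cofaceE.
- exists (d1 t), t; split=> //; rewrite /face2 cofaceE tE //.
Qed.

Lemma tri_degen_l f : tri (degen (src f)) f f.
Proof.
exists (act (dgn_op (@Ordinal 2 0 isT) : op 3 2) f).
split; rewrite /face2 /degen /src -?act_comp; [|rewrite -[RHS]act_id..];
  by congr (act _ _); apply: op_ext => -[[|[|//]] ?].
Qed.

Lemma tri_degen_r f : tri f (degen (tgt f)) f.
Proof.
exists (act (dgn_op (@Ordinal 2 1 isT) : op 3 2) f).
split; rewrite /face2 /degen /tgt -?act_comp; [rewrite -[RHS]act_id| |rewrite -[RHS]act_id];
  by congr (act _ _); apply: op_ext => -[[|[|//]] ?].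
Qed.

(* The edge from i to j of a tetrahedron is called fij. *)
Lemma tri_fill1 f01 f12 f23 f02 f13 f03 :
  tri f01 f12 f02 -> tri f12 f23 f13 -> tri f01 f13 f03 -> tri f02 f23 f03.
Proof.
move=> [t3 [a1 a2 a3]] [t0 [b1 b2 b3]] [t2 [c1 c2 c3]].
pose y (i : 'I_4) := match i : nat with 0 => t0 | 2 => t2 | _ => t3 end.
move: a1 a2 a3 b1 b2 b3 c1 c2 c3; rewrite /face2 !cofaceE /= => a1 a2 a3 b1 b2 b3 c1 c2 c3.
have [|i j ij ik jk|t tE] := @horn_fill S 1 (@Ordinal 4 1 isT) y hS; first by [].
- have ik' : i <> 1 :> nat by move=> E; apply: ik; apply: val_inj.
  have jk' : j <> 1 :> nat by move=> E; apply: jk; apply: val_inj.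
  rewrite {}/y; case: i ij ik' {ik} => -[|[|[|[|//]]]] ? //=;
  case: j jk' {jk} => -[|[|[|[|//]]]] ? //= *;
  by rewrite ?a1 ?a2 ?a3 ?b1 ?b2 ?b3 ?c1 ?c2 ?c3.
- have E0 := tE (@Ordinal 4 0 isT); have E2 := tE (@Ordinal 4 2 isT).
  have E3 := tE (@Ordinal 4 3 isT); rewrite /y /= in E0 E2 E3.
  exists (act (face_op 3 1) t); rewrite /face2 !cofaceE /=; split.
  + by rewrite -[2]/(3.-1) -face_face // E3.
  + by rewrite face_face // E0.
  + by rewrite -[X in face_op 2 X]/(2.-1) -face_face // E2.
Qed.

Lemma tri_fill2 f01 f12 f23 f02 f13 f03 :
  tri f01 f12 f02 -> tri f12 f23 f13 -> tri f02 f23 f03 -> tri f01 f13 f03.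
Proof.
move=> [t3 [a1 a2 a3]] [t0 [b1 b2 b3]] [t1 [c1 c2 c3]].
pose y (i : 'I_4) := match i : nat with 0 => t0 | 1 => t1 | _ => t3 end.
move: a1 a2 a3 b1 b2 b3 c1 c2 c3; rewrite /face2 !cofaceE /= => a1 a2 a3 b1 b2 b3 c1 c2 c3.
have [|i j ij ik jk|t tE] := @horn_fill S 1 (@Ordinal 4 2 isT) y hS; first by [].
- have ik' : i <> 2 :> nat by move=> E; apply: ik; apply: val_inj.
  have jk' : j <> 2 :> nat by move=> E; apply: jk; apply: val_inj.
  rewrite {}/y; case: i ij ik' {ik} => -[|[|[|[|//]]]] ? //=;
  case: j jk' {jk} => -[|[|[|[|//]]]] ? //= *;
  by rewrite ?a1 ?a2 ?a3 ?b1 ?b2 ?b3 ?c1 ?c2 ?c3.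
- have E0 := tE (@Ordinal 4 0 isT); have E1 := tE (@Ordinal 4 1 isT).
  have E3 := tE (@Ordinal 4 3 isT); rewrite /y /= in E0 E1 E3.
  exists (act (face_op 3 2) t); rewrite /face2 !cofaceE /=; split.
  + by rewrite -[X in face_op 2 X]/(3.-1) -face_face // E3.
  + by rewrite face_face // E0.
  + by rewrite face_face // E1.
Qed.

Definition homotopic f g := tri f (degen (tgt f)) g.

Lemma homotopic_refl f : homotopic f f. Proof. exact: tri_degen_r. Qed.

Lemma homotopic_tgt f g : homotopic f g -> tgt g = tgt f.
Proof. by move/tri_tgt->; apply: tgt_degen. Qed.

Lemma tri_degen2 (x : S 0) : tri (degen x) (degen x) (degen x).
Proof. by have := tri_degen_r (degen x); rewrite tgt_degen. Qed.

Lemma homotopic_sym f g : homotopic f g -> homotopic g f.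
Proof.
move=> h; rewrite /homotopic (homotopic_tgt h).
exact: tri_fill1 h (tri_degen2 _) (tri_degen_r f).
Qed.

Lemma homotopic_trans f g h : homotopic f g -> homotopic g h -> homotopic f h.
Proof.
rewrite {2}/homotopic => fg; rewrite (homotopic_tgt fg).
exact: tri_fill2 fg (tri_degen2 _).
Qed.

Lemma homotopic_l f g : homotopic f g <-> tri (degen (src f)) f g.
Proof.
split; first exact: tri_fill2 (tri_degen_l f) (tri_degen_r f).
exact: tri_fill1 (tri_degen_l f) (tri_degen_r f).
Qed.

Lemma tri_unique f g h h' : tri f g h -> tri f g h' -> homotopic h h'.
Proof.
move=> H H'; rewrite /homotopic (tri_tgt H).
exact: tri_fill1 H (tri_degen_r g) H'.
Qed.

Lemma tri_homotopic f f' g g' h h' : tri f g h -> homotopic f f' -> homotopic g g' -> homotopic h h' ->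
  tri f' g' h'.
Proof.
move=> H Hf Hg Hh.
have H1 : tri f g h' by apply: (tri_fill2 H (tri_degen_r g)); rewrite -(tri_tgt H).
have H2 : tri f g' h'.
  apply: (tri_fill2 H1 Hg); rewrite -(tri_tgt H1); exact: tri_degen_r.
apply: (tri_fill1 (iffLR (homotopic_l _ _) Hf) H2).
rewrite -(tri_src H2); exact: tri_degen_l.
Qed.
End Triangles.

(** * The homotopy category of a quasi-category *)

Lemma tri_weq (S : sSet) (f g h : S 1) x y z p q p' q' p'' q'' : tri f g h ->
  weq (Wcmp (@Wedge S y z g p' q') (@Wedge S x y f p q)) (@Wedge S x z h p'' q'').
Proof.
move=> [t [E2 E0 E1]]; subst f g h; exact: weq_face.
Qed.

Lemma weq_degen_edge (S : sSet) (x : S 0) p q : weq (@Wedge S x x (degen x) p q) (Wid x).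
Proof. exact: weq_degen. Qed.

Section HCat.
Variables (S : sSet) (hS : quasi_category S).

Lemma comp_sig x y z (f : {e : S 1 | src e = x /\ tgt e = y})
    (g : {e : S 1 | src e = y /\ tgt e = z}) :
  exists h : {e : S 1 | src e = x /\ tgt e = z}, tri (sval f) (sval g) (sval h).
Proof.
case: f => f [fx fy]; case: g => g [gy gz] /=.
have [|h t] := tri_comp hS (f := f) (g := g); first by rewrite fy.
have hh : src h = x /\ tgt h = z by rewrite (tri_src t) (tri_tgt t).
by exists (exist _ h hh).
Qed.

(** An edge representing a formal composite. Each composite is chosen by filling an inner horn, so
    only the homotopy class of the edge is meaningful. *)
Fixpoint word_edge x y (u : word x y) : {e : S 1 | src e = x /\ tgt e = y} :=
  match u with
  | Wid x => exist _ (degen x) (conj (src_degen x) (tgt_degen x))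
  | Wedge x y e p q => exist _ e (conj p q)
  | Wcmp x y z v u => sval (cid (comp_sig (word_edge u) (word_edge v)))
  end.

Local Notation we u := (sval (word_edge u)).

Lemma we_src x y (u : word x y) : src (we u) = x.
Proof. by case: (svalP (word_edge u)). Qed.
Lemma we_tgt x y (u : word x y) : tgt (we u) = y.
Proof. by case: (svalP (word_edge u)). Qed.

Lemma we_cmp x y z (v : word y z) (u : word x y) : tri (we u) (we v) (we (Wcmp v u)).
Proof. exact: (svalP (cid (comp_sig (word_edge u) (word_edge v)))). Qed.

(** Composites in a quasi-category are unique up to homotopy, and each relation of the presentation
    is a statement about composites. Equations in [hCat S] can thus be read back as homotopies of
    edges. *)
Lemma weq_we x y (u v : word x y) : weq u v -> homotopic (we u) (we v).
Proof.
elim=> {x y u v} [x y u|x y u v _|x y u v w _ IH1 _ IH2|x y z v v' u u' _ IH1 _ IH2|x y u|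
  x y u|x y z t w v u|x p q|x y z t p2 q2 p0 q0 p1 q1].
- exact: homotopic_refl.
- exact: homotopic_sym.
- exact: homotopic_trans IH1 IH2.
- apply: (tri_unique hS) (we_cmp v' u').
  exact: (tri_homotopic hS (we_cmp v u) IH2 IH1 (homotopic_refl _)).
- apply: (tri_unique hS (we_cmp _ _)); have := tri_degen_r (we u).
  by rewrite we_tgt.
- apply: (tri_unique hS (we_cmp _ _)); have := tri_degen_l (we u).
  by rewrite we_src.
- apply: (tri_unique hS _ (we_cmp _ _)).
  exact: (tri_fill2 hS (we_cmp v u) (we_cmp w v) (we_cmp w (Wcmp v u))).
- exact: homotopic_refl.
- by apply: (tri_unique hS (we_cmp _ _)); exists t.
Qed.

Lemma we_weq x y (u : word x y) p q : weq u (@Wedge S x y (we u) p q).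
Proof.
elim: {x y} u p q => [x|x y e p q|x y z v IHv u IHu] p' q'.
- exact/weq_sym/weq_degen_edge.
- by rewrite (Prop_irrelevance p' p) (Prop_irrelevance q' q); apply: weq_refl.
- apply: weq_trans (weq_cmp (IHv (we_src _) (we_tgt _)) (IHu (we_src _) (we_tgt _))) _.
  exact/tri_weq/we_cmp.
Qed.

Lemma hom_edge (x y : S 0) (c : @hom (hCat S) x y) :
  exists e p q, c = cls (@Wedge S x y e p q).
Proof.
elim/cls_ind: c => u; exists (we u), (we_src u), (we_tgt u).
exact/cls_eqP/we_weq.
Qed.

Lemma cls_cmp_tri (f g h : S 1) x y z p q p' q' p'' q'' :
  @cmp (hCat S) x y z (cls (@Wedge S y z g p' q')) (cls (@Wedge S x y f p q)) =
  cls (@Wedge S x z h p'' q'') <-> tri f g h.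
Proof.
rewrite /= cls_cmp cls_eqP; split; last exact: tri_weq.
move/weq_we => /= H; have := we_cmp (Wedge g p' q') (Wedge f p q) => T.
exact: (tri_homotopic hS T (homotopic_refl _) (homotopic_refl _) H).
Qed.

Lemma cls_edge_eq (f g : S 1) x y p q p' q' :
  cls (@Wedge S x y f p q) = cls (@Wedge S x y g p' q') <-> homotopic f g.
Proof.
rewrite cls_eqP; split; first exact: weq_we.
rewrite /homotopic => t.
have e1 : src (degen (tgt f)) = y by rewrite src_degen.
have e2 : tgt (degen (tgt f)) = y by rewrite tgt_degen.
apply: weq_trans (tri_weq p q e1 e2 p' q' t).
subst y; apply: weq_trans (weq_sym (weq_1m _)) _.
exact: weq_cmp (weq_sym (weq_degen_edge _ _)) (weq_refl _).
Qed.

Lemma cls_id (x : S 0) p q : cls (@Wedge S x x (degen x) p q) = idm (x : hCat S).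
Proof. exact/cls_eqP/weq_degen. Qed.
End HCat.

(** * Internal homs *)

(** The only additional vertex of [v] lies over k. This makes the simplices over a horn a saturated
    family. *)
Lemma lift_misses m n (v : op m.+2 n.+1) (q : 'I_m.+1) k (i : 'I_n.+1) :
  v (widen_ord (leqnSn _) q) = k :> nat -> i <> k :> nat ->
  (forall j, op_comp v (face_op m.+1 q) j <> i) -> forall j, v j <> i.
Proof.
move=> vq ik H j E; have [jq|jq] := eqVneq (j : nat) q.
  by apply: ik; rewrite -E -vq; apply: (op_eq v).
have bd : unbump q j < m.+1 by have := ltn_ord j; have := ltn_ord q; move/eqP: jq; rewrite /unbump; lia.
apply: (H (Ordinal bd)); rewrite -E; apply: val_inj; apply: (op_eq v) => /=.
by move/eqP: jq; rewrite /bump /unbump; lia.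
Qed.

(** The filler extends a map [g] prescribed on Delta^n x J'. With J' empty this fills inner horns in
    [sexp A J]; with J' the two ends of Delta^1 it fills a horn of paths with given end
    simplices. *)
Theorem sexp_fill (A J : sSet) (J' : forall m, J m -> Prop) n (k : 'I_n.+1)
    (h : sMap (horn k) (sexp A J)) (g : srel (Delta n \x J) A) :
  quasi_category A -> subcomplex J' -> 0 < k < n ->
  simplicial g -> functional g -> (forall m (w : (Delta n \x J) m), dom g w <-> J' m w.2) ->
  (forall m (a : horn k m) z x, g m (sval a, z) x ->
     smap (smap h a) (z, op_id _ : Delta _ _) = x) ->
  exists s : sexp A J n, (forall m (a : horn k m), smap h a = act (sval a : op _ _) s) /\
    forall m c z x, g m (c, z) x -> smap s (z, c) = x.
Proof.
move=> hA hJ' /andP[k0 kn] gs gf gd gh.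
pose V m (w : (Delta n \x J) m) := True.
have hV : subcomplex V by [].
pose R : srel (Delta n \x J) A := fun m w x =>
  (exists2 a : horn k m, w.1 = sval a & x = smap (smap h a) (w.2, op_id _ : Delta _ _)) \/ g m w x.
have [|||F FP] := extension hV (R := R) k0 kn hA.
- by [].
- split.
  + move=> l m b w x [[a Ea ->]|H]; last by right; apply: gs.
    left; exists (act b a); first by rewrite /= Ea.
    rewrite smap_act /= -smap_act /=; congr (smap (smap h a) (_, _)).
  + move=> m w x x' [[a Ea ->]|H] [[a' Ea' ->]|H'].
    * suff -> : a = a' by [].
      case: a a' Ea Ea' => [a1 p] [a2 p'] /= Ea Ea'; apply: eq_exist.
      by rewrite -Ea -Ea'.
    * by apply: gh; rewrite -Ea -surjective_pairing.
    * by apply/esym/gh; rewrite -Ea' -surjective_pairing.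
    * exact: gf H H'.
  + by [].
  + move=> m [v y] q [/= vq vq1 yq] [x [[[a [i [ik ai]]] /= Ea _]|H]].
      have mis : exists i : 'I_n.+1, i <> k /\ forall j, (v : op _ _) j <> i.
        exists i; split=> //; apply: (lift_misses vq); first by move=> /val_inj.
        by move=> j; rewrite Ea; apply: ai.
      exists (smap (smap h (exist _ v mis : horn k m.+1)) (y, op_id _ : Delta _ _)); left.
      by exists (exist _ v mis : horn k m.+1).
    have Jy : J' _ y.
      by rewrite yq act_comp; apply: hJ'; apply: ((gd _ _).1 (ex_intro _ x H)).
    by have [x' H'] := (gd _ (v, y)).2 Jy; exists x'; right.
- move=> m w i _ ik wi; have mis : exists i : 'I_n.+1, i <> k /\ forall j, (w.1 : op _ _) j <> i.
    by exists i; split=> // E; apply: ik; rewrite E.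
  exists (smap (smap h (exist _ w.1 mis : horn k m)) (w.2, op_id _ : Delta _ _)); left.
  by exists (exist _ (w.1 : op _ _) mis : horn k m).
unshelve eexists (@SMap (J \x Delta n) A (fun m w => smap F (exist _ (w.2, w.1) I : ssub hV m)) _).
  by move=> m l b w; rewrite -smap_act; congr (smap F _); apply: eq_exist.
split.
- move=> m a; apply: sMap_ext => l [z c] /=.
  transitivity (smap F (exist _ (op_comp (sval a) c : Delta n l, z) I : ssub hV l)); last by [].
  apply/esym/FP; left; exists (act (c : op _ _) a) => //=.
  rewrite smap_act /=; congr (smap (smap h a) (_, _)).
  by rewrite op_id_r.
- by move=> m c z x H; apply: FP; right.
Qed.

Theorem sexp_qcat (A J : sSet) : quasi_category A -> quasi_category (sexp A J).
Proof.
move=> hA n k hk u.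
have [//|//|//||//|s [sP _]] :=
  @sexp_fill A J (fun _ _ => False) n k u (fun _ _ _ => False) hA _ hk.
  by move=> m w; split=> [[]|].
unshelve eexists (@SMap (Delta n) (sexp A J) (fun m a => act (a : op _ _) s) _).
  by move=> m l b a; rewrite -act_comp.
by apply: sMap_ext => m a; rewrite /= sP.
Qed.

(** * Cones and the simplices of Delta^0 * (Delta^n x X) *)

Definition uncurry (W A J : sSet) (f : sMap W (sexp A J)) : sMap (W \x J) A.
Proof.
exists (fun n w => smap (smap f w.1) (w.2, op_id _ : Delta _ _)).
move=> m n a [w z] /=; rewrite (smap_act f) -(smap_act (smap f w)) /=.
by congr (smap (smap f w) _); congr pair; apply: op_ext.
Defined.

Lemma uncurryE (W A J : sSet) (f : sMap W (sexp A J)) n m (w : W n) (z : J m)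
  (c : Delta n m) : smap (smap f w) (z, c) = smap (uncurry f) ((act (c : op _ _) w, z) : (W \x J) m).
Proof.
rewrite /= (smap_act f) /=; congr (smap (smap f w) _); congr pair; exact: op_ext.
Qed.

Lemma uncurry_inj (W A J : sSet) (f g : sMap W (sexp A J)) :
  (forall n (w : W n) (z : J n), smap (uncurry f) (w, z) = smap (uncurry g) (w, z)) -> f = g.
Proof.
move=> H; apply: sMap_ext => n w; apply: sMap_ext => m [z c].
by rewrite !uncurryE H.
Qed.

Lemma uncurry_transpose (W A J : sSet) (f : sMap (W \x J) A) n (w : W n) (z : J n) :
  smap (uncurry (transpose f)) (w, z) = smap f (w, z).
Proof. by rewrite /= act_id. Qed.

Section Cone.
Variable X : sSet.
Notation J := (join (Delta 0) X).

Lemma aug_point p (y y' : aug (Delta 0) p) : y = y'.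
Proof.
case: p y y' => [|p] /=; first by case=> -[].
by move=> y y'; apply: op_ext => i; rewrite !(ord1 (_ i)).
Qed.

Lemma cone_eq n p p' q q' (e : p + q = n) (e' : p' + q' = n) y y' r
  (v : op q r) (v' : op q' r) (x : aug X r) : p = p' ->
  (forall (i : 'I_q) (i' : 'I_q'), i = i' :> nat -> v i = v' i' :> nat) ->
  @JoinSplx (Delta 0) X n p q e y (aug_act v x) =
  @JoinSplx (Delta 0) X n p' q' e' y' (aug_act v' x).
Proof.
move=> pp; subst p'; have qq : q = q' by apply/eqP; rewrite -(eqn_add2l p) e e'.
subst q' => Hv; rewrite (eq_irrelevance e e') (aug_point y y').
by have -> : v = v' by apply: op_ext => i; apply: Hv.
Qed.

Definition apexes n (z : J n) : nat := jl (z : join_splx (Delta 0) X n.+1).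
Notation incl := (join_incl (Delta 0) X).

Lemma apexesP m n (a : op m.+1 n.+1) (z : J n) (j : 'I_m.+1) :
  (j < apexes (act a z)) = (a j < apexes z).
Proof. exact: cutP. Qed.

Lemma apexes_incl n (x : X n) : apexes (smap incl x) = 0.
Proof. by []. Qed.

Lemma incl_surj n (z : J n) : apexes z = 0 -> exists x, z = smap incl x.
Proof.
case: z => p q e y x; rewrite /apexes /= => p0; subst p.
have qn : q = n.+1 by rewrite -e.
subst q; exists x; rewrite /= (eq_irrelevance e (add0n n.+1)).
by rewrite (aug_point y tt).
Qed.

Lemma incl_inj n (x x' : X n) : smap incl x = smap incl x' -> x = x'.
Proof.
(* A partial inverse that reads off the dependent component; [x] is a default where [jr w] is not
   n+1. *)
pose f (w : join_splx (Delta 0) X n.+1) : X n :=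
  (if jr w =P n.+1 is ReflectT E then eq_rect (jr w) (aug X) (jx w) n.+1 E else x).
move/(f_equal f); rewrite /f /=; case: eqP => // E.
by rewrite (eq_irrelevance E erefl).
Qed.

(* [thick n] is (Delta^0 * (Delta^n x X)) x Y, encoded in
   Delta^(n+1) x ((Delta^0 * X) x Y): the vertices over 0 are the apexes. *)
Section Special.
Variables (A Y : sSet).

Definition fibred n m (w : (Delta n.+1 \x (J \x Y)) m) : Prop :=
  forall j, ((w.1 : op _ _) j == 0 :> nat) = (j < apexes w.2.1).

Lemma fibred_subcomplex n : subcomplex (@fibred n).
Proof. by move=> m l a [u [z y]] H j; rewrite apexesP -H. Qed.

(** A vertex inserted over 1 takes its cone component from a vertex over 2, which is off the apex,
    so both sides of the equation in [fibred] are false there. *)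
Lemma fibred_saturated n : saturated 1 (@fibred n).
Proof.
move=> m [v [z y]] q [vq vq1 zyq] H.
have zq : z = act (op_comp (face_op m.+1 q) (dgn_op q)) z by case: zyq.
rewrite [(_, _).1]/= in vq vq1.
have Hj (j : 'I_m.+2) : j <> q :> nat -> ((v : op _ _) j == 0 :> nat) = (j < apexes z).
  move=> jq; have bd : unbump q j < m.+1.
    by have := ltn_ord j; have := ltn_ord q; move: jq; rewrite /unbump; lia.
  have : ((v : op _ _) (face_op m.+1 q (Ordinal bd)) == 0 :> nat) =
      (Ordinal bd < apexes (act (face_op m.+1 q) z)) := H (Ordinal bd).
  rewrite apexesP; suff -> : face_op m.+1 q (Ordinal bd) = j by [].
  by apply: val_inj => /=; move: jq; rewrite /bump /unbump; lia.
move=> j /=; have [jq|/eqP/Hj//] := eqVneq (j : nat) q.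
have -> : j = widen_ord (leqnSn _) q by apply: val_inj.
rewrite vq zq apexesP -Hj; last by rewrite /= /bump /unbump; lia.
apply/esym/eqP => E; move: vq1.
suff -> : lift ord0 q = op_comp (face_op m.+1 q) (dgn_op q) (widen_ord (leqnSn _) q).
  by rewrite E.
by apply: val_inj; rewrite /= /bump /unbump; lia.
Qed.

Definition thick n : sSet := ssub (@fibred_subcomplex n).

(** [op_suc a] is the ordinal sum of the identity of [0] with [a], acting on the coordinate in which
    0 marks the apexes. *)
Definition op_suc_fun k l (a : op k l) (i : nat) : nat :=
  if i is j.+1 then (op_nat a j).+1 else 0.
Lemma op_suc_lt k l (a : op k l) i : i < k.+1 -> op_suc_fun a i < l.+1.
Proof. by case: i => // i ik; apply: (op_nat_lt a (t := i)). Qed.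
Lemma op_suc_mono k l (a : op k l) i j : i <= j -> j < k.+1 ->
  op_suc_fun a i <= op_suc_fun a j.
Proof. by case: i j => [|i] [|j] //= ij jk; exact: (@op_nat_mono _ _ a i j ij jk). Qed.
Definition op_suc k l (a : op k l) : op k.+1 l.+1 :=
  mk_op (@op_suc_lt k l a) (@op_suc_mono k l a).

Lemma op_suc_comp k l m (a : op l m) (b : op k l) (i : nat) : i < k.+1 ->
  op_suc_fun (op_comp a b) i = op_suc_fun a (op_suc_fun b i).
Proof.
case: i => // i ik; rewrite /= (op_natE _ (Ordinal (ik : i < k))) /=.
by rewrite (op_natE b (Ordinal (ik : i < k))) op_natE.
Qed.

Definition thick_map m n (a : op m.+1 n.+1) : sMap (thick m) (thick n).
Proof.
unshelve eexists (fun l (w : thick m l) => exist _ (op_comp (op_suc a) (sval w).1 : Delta _ _, (sval w).2) _).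
  move=> j /=; rewrite -(svalP w j) /=.
  by case: (nat_of_ord ((sval w).1 j)).
move=> k l b w; apply: eq_exist => /=; congr pair; exact: op_ext.
Defined.

Definition special : sSet.
Proof.
exists (fun n => sMap (thick n) A) (fun m n a F => F \s thick_map a).
- move=> n F; apply: sMap_ext => m [[u zy] h] /=; congr (smap F _).
  apply: eq_exist => /=; congr pair; apply: op_ext => j /=.
  by case: (u j) => -[|i] //= hi; rewrite (op_natE _ (Ordinal (hi : i < n.+1))).
- move=> k m n a b F; apply: sMap_ext => l [[u zy] h] /=; congr (smap F _).
  apply: eq_exist => /=; congr pair; apply: op_ext => j /=.
  by rewrite op_suc_comp // ltn_ord.
Defined.

(** The first coordinate of the map from Delta^n x (Delta^0 * X) to Delta^0 * (Delta^n x X) that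
    collapses the copy of Delta^n over the apex. Precomposition with this map is [underlying]. *)
Definition apex_op n m (t : op m.+1 n.+1) (z : J m) : op m.+1 n.+2.
Proof.
exists (fun j : 'I_m.+1 => if j < apexes z then ord0 else lift ord0 (t j)).
move=> i j ij; case: ltnP => // zi; case: ltnP => [jz|zj].
  by have := leq_ltn_trans (leq_trans zi ij) jz; rewrite ltnn.
by rewrite /= /bump !add1n ltnS; apply: op_mono.
Defined.

Lemma apex_opE n m (t : op m.+1 n.+1) (z : J m) (j : 'I_m.+1) :
  apex_op t z j = (if j < apexes z then 0 else (t j).+1) :> nat.
Proof. by rewrite /=; case: ifP. Qed.

Lemma apex_op_fibred n m (t : op m.+1 n.+1) (z : J m) (y : Y m) :
  fibred ((apex_op t z : Delta n.+1 m), (z, y)).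
Proof. by move=> j; rewrite apex_opE; case: ifP. Qed.

Definition thick_splx n m (t : op m.+1 n.+1) (z : J m) (y : Y m) : thick n m :=
  exist _ _ (apex_op_fibred t z y).

Lemma act_thick_splx n m l (b : op l.+1 m.+1) (t : op m.+1 n.+1) (z : J m) (y : Y m) :
  act b (thick_splx t z y) = thick_splx (op_comp t b) (act b z) (act b y).
Proof.
apply: eq_exist => /=; congr pair; apply: op_ext => j.
by rewrite [RHS]apex_opE apexesP /=; case: ifP.
Qed.

Lemma thick_mapE n m l (a : op n.+1 l.+1) (t : op m.+1 n.+1) (z : J m) (y : Y m) :
  smap (thick_map a) (thick_splx t z y) = thick_splx (op_comp a t) z y.
Proof.
apply: eq_exist => /=; congr pair; apply: op_ext => j /=.
by case: ifP => //= _; rewrite /bump /= op_natE.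
Qed.

Definition underlying_map n (F : special n) : sMap ((Y \x Delta n) \x J) A.
Proof.
exists (fun m w => smap F (thick_splx (w.1.2 : op _ _) w.2 w.1.1)).
by move=> l m b w; rewrite -act_thick_splx smap_act.
Defined.

Definition underlying : sMap special (sexp (sexp A J) Y).
Proof.
exists (fun n (F : special n) => transpose (underlying_map F) : sexp (sexp A J) Y n).
move=> m n a F; apply: uncurry_inj => l [y t] z.
rewrite uncurry_transpose.
transitivity (smap (uncurry (transpose (underlying_map F)))
  (((y, op_comp a (t : op _ _) : Delta _ _), z) : ((Y \x Delta n) \x J) l)); last by [].
rewrite uncurry_transpose; exact: (f_equal (smap F) (thick_mapE _ _ _ _)).
Defined.

Lemma underlyingE n (F : special n) m (y : Y m) (t : Delta n m) (z : J m) :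
  smap (uncurry (smap underlying F)) (((y, t), z) : ((Y \x Delta n) \x J) m) =
  smap F (thick_splx (t : op _ _) z y).
Proof. exact: uncurry_transpose. Qed.

Definition base : sMap special (sexp (sexp A X) Y) :=
  postcomp Y (precomp A incl) \s underlying.

Lemma baseE n (F : special n) m (y : Y m) (t : Delta n m) (x : X m) :
  smap (uncurry (smap base F)) (((y, t), x) : ((Y \x Delta n) \x X) m) =
  smap F (thick_splx (t : op _ _) (smap incl x) y).
Proof. exact: underlyingE. Qed.

Lemma op_eta0 n (i : 'I_n.+1) : i <> ord0 -> i <> 0 :> nat.
Proof. by move=> i0 E; apply: i0; apply: val_inj. Qed.

Lemma hat_subproof m n (u : op m.+1 n.+2) (j : 'I_m.+1) : (u j).-1 < n.+1.
Proof. by have := ltn_ord (u j); case: (nat_of_ord _). Qed.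

Definition hat m n (u : op m.+1 n.+2) : op m.+1 n.+1.
Proof.
exists (fun j => Ordinal (hat_subproof u j)) => i j ij /=.
by have := op_mono u ij; lia.
Defined.

(* The values of [hat] over 0 are junk.  They do not matter: both sides are
   restrictions of [h] at the simplex a with the vertex 0 put in front. *)
Lemma horn_hat n (h : sMap (horn (ord0 : 'I_n.+1)) special) l m
    (a : horn (ord0 : 'I_n.+1) l) (w : thick l m) (c : horn (ord0 : 'I_n.+1) m) :
  sval c = hat (op_comp (op_suc (sval a)) (sval w).1) :> op _ _ ->
  smap (smap h a) w = smap (smap h c) (thick_splx (op_id m.+1) (sval w).2.1 (sval w).2.2).
Proof.
case: a c => [a ha] [c hc] /= Ec.
have [e Ee] : exists e : op l.+2 n.+1, forall j : 'I_l.+2,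
    e j = (if (j : nat) is i.+1 then op_nat a i else 0) :> nat.
  apply: (@op_ex l.+2 n.+1 (fun j => if j is i.+1 then op_nat a i else 0)).
  - by case=> // i il; apply: op_nat_lt.
  - by case=> [|i] [|j] // ij jl; apply: op_nat_mono.
have he : exists i : 'I_n.+1, i <> ord0 /\ forall j, e j <> i.
  have [i [i0 ai]] := ha; exists i; split=> // -[j jl] E.
  have := Ee (Ordinal jl); rewrite E /=; case: j jl E => [|j] jl E; first exact: op_eta0.
  by rewrite (op_natE _ (Ordinal (jl : j < l.+1))) => /val_inj Ei; exact: (ai (Ordinal (jl : j < l.+1)) (esym Ei)).
pose e' : horn (ord0 : 'I_n.+1) l.+1 := exist _ e he.
have Ea : exist _ a ha = act (face_op l.+1 0) e' :> horn (ord0 : 'I_n.+1) l.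
  apply: eq_exist; apply: op_ext => j; rewrite /= Ee /=.
  by rewrite op_natE.
have Ec' : exist _ c hc = act (sval w).1 e' :> horn (ord0 : 'I_n.+1) m.
  apply: eq_exist; rewrite Ec; apply: op_ext => j; rewrite /= Ee.
  by case: (nat_of_ord ((sval w).1 j)).
rewrite Ea Ec' !(smap_act h).
suff E : smap (thick_map (face_op l.+1 0)) w = smap (thick_map (sval w).1)
    (thick_splx (op_id m.+1) (sval w).2.1 (sval w).2.2).
  exact: (f_equal (smap (smap h e')) E).
rewrite thick_mapE; case: w {Ec Ec' c hc} => [[u [z y]] hw]; apply: eq_exist => /=.
congr pair; apply: op_ext => j; rewrite apex_opE /= -hw /=.
case: (nat_of_ord (u j)) (ltn_ord (u j)) => [|i] //= il.
by rewrite (op_natE _ (Ordinal (il : i < l.+1))).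
Qed.

Lemma incl_act m n (a : op m.+1 n.+1) (x : X n) : act a (smap incl x) = smap incl (act a x).
Proof. by rewrite smap_act. Qed.

Theorem special_lift n (h : sMap (horn (ord0 : 'I_n.+1)) special)
    (sigma : sexp (sexp A X) Y n) : quasi_category A -> 0 < n ->
  (forall m (a : horn (ord0 : 'I_n.+1) m), smap base (smap h a) = act (sval a : op _ _) sigma) ->
  exists F : special n, (forall m (a : horn (ord0 : 'I_n.+1) m),
     smap h a = act (sval a : op _ _) F) /\ smap base F = sigma.
Proof.
move=> hA n0 hs.
(* The data over the horn of Delta^(n+1) at 1: opposite the vertex 0 there is no apex and [sigma]
   gives the value; opposite i+1 with i positive the value comes from [h]. *)
pose R : srel (Delta n.+1 \x (J \x Y)) A := fun m w r => fibred w /\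
  ((exists2 c : horn (ord0 : 'I_n.+1) m, sval c = hat (w.1 : op _ _) &
      r = smap (smap h c) (thick_splx (op_id m.+1) w.2.1 w.2.2)) \/
   (exists2 x, w.2.1 = smap incl x &
      r = smap (uncurry sigma) (((w.2.2, hat (w.1 : op _ _) : Delta _ _), x) : ((Y \x Delta n) \x X) m))).
have hatc m l (u : op m.+1 n.+2) (b : op l.+1 m.+1) : hat (op_comp u b) = op_comp (hat u) b.
  by apply: op_ext.
have [|||F FP] := extension (@fibred_subcomplex n) (R := R) (ltn0Sn 0) (n0 : 1 < n.+1) hA.
- exact: fibred_saturated.
- split.
  + move=> l m b [u [z y]] r [wf H]; split; first exact: fibred_subcomplex.
    case: H => [[c Ec ->]|[x Ex ->]]; [left|right].
      exists (act b c); first by rewrite /= Ec hatc.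
      rewrite smap_act -smap_act act_thick_splx.
      transitivity (smap (smap h c) (smap (thick_map b) (thick_splx (op_id l.+1) (act b z) (act b y)))).
        by rewrite thick_mapE op_id_l op_id_r.
      by [].
    exists (act b x); first by rewrite -incl_act -Ex.
    by rewrite -smap_act /= -hatc.
  + have mixed m (u : op m.+1 n.+2) (y : Y m) (x : X m) (c : horn (ord0 : 'I_n.+1) m) :
        sval c = hat u -> smap (smap h c) (thick_splx (op_id m.+1) (smap incl x) y) =
        smap (uncurry sigma) (((y, hat u : Delta _ _), x) : ((Y \x Delta n) \x X) m).
      move=> Ec; rewrite -(baseE (smap h c) y (op_id m.+1 : Delta m m) x) hs.
      transitivity (smap (uncurry sigma) (((y, op_comp (sval c) (op_id _) : Delta _ _), x)
        : ((Y \x Delta n) \x X) m)); first by [].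
      by rewrite op_id_r Ec.
    move=> m [u [z y]] r r' [_ H] [_ H'].
    case: H => [[c /= Ec ->]|[x /= Ex ->]]; case: H' => [[c' /= Ec' ->]|[x' /= Ex' ->]].
    * suff -> : c = c' by [].
      by case: c c' Ec Ec' => [c p] [c' p'] /= Ec Ec'; apply: eq_exist; rewrite Ec Ec'.
    * by rewrite Ex'; apply: mixed.
    * by rewrite Ex; apply/esym/mixed.
    * by move: Ex'; rewrite Ex => /incl_inj ->.
  + by move=> m w [r []].
  + move=> m [v [z y]] q dq [r [wf H]].
    have wf' : fibred ((v : Delta n.+1 m.+1), (z, y)) := fibred_saturated dq wf.
    case: dq => vq vq1 zyq; rewrite [(_, _).1]/= in vq vq1.
    have zq : z = act (op_comp (face_op m.+1 q) (dgn_op q)) z by case: zyq.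
    case: H => [[[c [i [i0 ci]]] /= Ec _]|[x /= Ex _]].
      have hv : exists i : 'I_n.+1, i <> ord0 /\ forall j, hat (v : op _ _) j <> i.
        exists i; split=> // j E; have [jq|/eqP jq] := eqVneq (j : nat) q.
          apply: i0; rewrite -E; apply: val_inj => /=.
          have -> : j = widen_ord (leqnSn _) q by apply: val_inj.
          by rewrite vq.
        have bd : unbump q j < m.+1.
          by have := ltn_ord j; have := ltn_ord q; move: jq; rewrite /unbump; lia.
        apply: (ci (Ordinal bd)); rewrite Ec -E hatc; apply: val_inj; apply: (op_eq (hat (v : op _ _))) => /=.
        by move: jq; rewrite /bump /unbump; lia.
      eexists; split=> //; left; exists (exist _ (hat (v : op _ _)) hv : horn ord0 m.+1) => //.
    eexists; split=> //; right; exists (act (dgn_op q) x) => //.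
    by rewrite -incl_act [LHS]zq act_comp; congr (act _ _).
- move=> m [u [z y]] i wf i1 ui; case: i i1 ui => [[|i] il] i1 ui.
    have z0 : apexes z = 0.
      apply/eqP; rewrite -leqn0 leqNgt; apply/negP => z0.
      have := wf ord0; rewrite /= z0 => /eqP E; apply: (ui ord0); exact: val_inj.
    have [x Ex] := incl_surj z0.
    by eexists; split=> //; right; exists x.
  have ip : i <> 0 by move=> i0; apply: i1; rewrite /= i0.
  have hu : exists i : 'I_n.+1, i <> ord0 /\ forall j, hat (u : op _ _) j <> i.
    exists (Ordinal (il : i < n.+1)); split; first by move/(f_equal val).
    move=> j /(f_equal val) /= E; apply: (ui j); apply: val_inj => /=; lia.
  by eexists; split=> //; left; exists (exist _ (hat (u : op _ _)) hu : horn ord0 m).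
exists F; split.
  move=> m a; apply: sMap_ext => l w.
  have hw : exists i : 'I_n.+1, i <> ord0 /\
      forall j, hat (op_comp (op_suc (sval a)) (sval w).1) j <> i.
    case: (svalP a) => i [i0 ai]; exists i; split=> // j /(f_equal val) /=.
    case: (nat_of_ord _) (ltn_ord ((sval w).1 j)) => [|j'] jl /= E.
      by apply: i0; apply: val_inj.
    apply: (ai (Ordinal (jl : j' < m.+1))); apply: val_inj.
    by rewrite /= -E -op_natE.
  rewrite (@horn_hat _ h m l a w (exist _ _ hw)) //.
  apply/esym/FP; split; first exact: (svalP (smap (thick_map (sval a)) w)).
  by left; exists (exist _ _ hw : horn ord0 l).
apply: uncurry_inj => m [y t] x; rewrite baseE; apply: FP; split.
  exact: apex_op_fibred.
right; exists x => //=.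
by have -> : hat (apex_op (t : op _ _) (smap incl x)) = t by apply: op_ext.
Qed.
End Special.
End Cone.

(** * Cells as homotopy classes of edges *)

Section Cells.
Variables (A B C Y : sSet).

Lemma whiskerl_edge (f : sMap B A) (b b' : sMap Y B) (Z : sexp B Y 1)
    (p : src Z = name b) (q : tgt Z = name b')
    (p' : src (smap (postcomp Y f) Z) = name (f \s b))
    (q' : tgt (smap (postcomp Y f) Z) = name (f \s b')) :
  whiskerl f (cls (Wedge Z p q) : cell b b') = cls (Wedge (smap (postcomp Y f) Z) p' q').
Proof. by rewrite /whiskerl hmap_cls; apply: cast_Wedge. Qed.

Lemma whiskerr_edge (u v : sMap C A) (L : sexp A C 1) (y : sMap Y C)
    (p : src L = name u) (q : tgt L = name v)
    (p' : src (smap (precomp A y) L) = name (u \s y))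
    (q' : tgt (smap (precomp A y) L) = name (v \s y)) :
  whiskerr (cls (Wedge L p q) : cell u v) y = cls (Wedge (smap (precomp A y) L) p' q').
Proof. by rewrite /whiskerr hmap_cls; apply: cast_Wedge. Qed.

Lemma cell_cast_edge (f f' g g' : sMap Y A) (ef : f = f') (eg : g = g') (H : sexp A Y 1)
    (p : src H = name f) (q : tgt H = name g) (p' : src H = name f') (q' : tgt H = name g') :
  cell_cast ef eg (cls (Wedge H p q)) = cls (Wedge H p' q').
Proof. exact: cast_Wedge. Qed.
End Cells.

Lemma smap_src (X Y : sSet) (f : sMap X Y) (e : X 1) : src (smap f e) = smap f (src e).
Proof. exact/esym/smap_act. Qed.

Lemma smap_tgt (X Y : sSet) (f : sMap X Y) (e : X 1) : tgt (smap f e) = smap f (tgt e).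
Proof. exact/esym/smap_act. Qed.

Lemma smap_degen (X Y : sSet) (f : sMap X Y) (x : X 0) : degen (smap f x) = smap f (degen x).
Proof. exact/esym/smap_act. Qed.

Lemma smap_tri (X Y : sSet) (F : sMap X Y) (f g h : X 1) : tri f g h ->
  tri (smap F f) (smap F g) (smap F h).
Proof.
by move=> [t [<- <- <-]]; exists (smap F t); split; apply/esym/smap_act.
Qed.

Lemma smap_homotopic (X Y : sSet) (F : sMap X Y) (f g : X 1) : homotopic f g ->
  homotopic (smap F f) (smap F g).
Proof. by move/(smap_tri F); rewrite -smap_degen -smap_tgt. Qed.

Definition factors (A B C Y : sSet) (f : sMap B A) (l : sMap C B) (L : sexp A C 1)
  (b : sMap Y B) (y : sMap Y C) (H : sexp A Y 1) (Z : sexp B Y 1) : Prop :=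
  [/\ src Z = name b, tgt Z = name (l \s y) &
      tri (smap (postcomp Y f) Z) (smap (precomp A y) L) H].

(** Cells become edges whose end points are given by equations instead of types, so the casts
    disappear. Unique existence splits into existence of an edge and uniqueness up to homotopy. *)
Lemma abs_right_liftingP (A B C : sSet) (f : sMap B A) (g : sMap C A) (l : sMap C B)
    (L : sexp A C 1) (p : src L = name (f \s l)) (q : tgt L = name g) :
  quasi_category A -> quasi_category B ->
  abs_right_lifting (cls (Wedge L p q) : cell (f \s l) g) <->
  forall Y : sSet, quasi_category Y -> forall (b : sMap Y B) (y : sMap Y C) (H : sexp A Y 1),
    src H = name (f \s b) -> tgt H = name (g \s y) ->
    (exists Z, factors f l L b y H Z) /\
    (forall Z Z', factors f l L b y H Z -> factors f l L b y H Z' -> homotopic Z Z').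
Proof.
move=> hA hB.
have eqn (Y : sSet) (b : sMap Y B) (y : sMap Y C) (Z : sexp B Y 1) (H : sexp A Y 1) pZ qZ pH qH :
    (cls (@Wedge _ (name (f \s b)) (name (g \s y)) H pH qH) = vcomp (whiskerr (cls (Wedge L p q) : cell (f \s l) g) y)
       (cell_cast erefl (scompA f l y) (whiskerl f (cls (@Wedge _ (name b) (name (l \s y)) Z pZ qZ) : cell b (l \s y))))) <->
    tri (smap (postcomp Y f) Z) (smap (precomp A y) L) H.
  have p1 : src (smap (postcomp Y f) Z) = name (f \s b).
    by rewrite smap_src pZ name_postcomp.
  have q1 : tgt (smap (postcomp Y f) Z) = name (f \s (l \s y)).
    by rewrite smap_tgt qZ name_postcomp.
  have q1' : tgt (smap (postcomp Y f) Z) = name (f \s l \s y).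
    by rewrite q1 scompA.
  have p2 : src (smap (precomp A y) L) = name (f \s l \s y).
    by rewrite smap_src p name_precomp.
  have q2 : tgt (smap (precomp A y) L) = name (g \s y).
    by rewrite smap_tgt q name_precomp.
  rewrite (whiskerr_edge p q p2 q2) (whiskerl_edge pZ qZ p1 q1).
  rewrite (cell_cast_edge _ _ p1 q1 p1 q1').
  split=> [/esym E|T].
  - exact: (iffLR (cls_cmp_tri (sexp_qcat hA) _ _ _ _ _ _) E).
  - apply/esym; exact: (iffRL (cls_cmp_tri (sexp_qcat hA) _ _ _ _ _ _) T).
split=> [arl Y hY b y H pH qH|arl Y hY b y chi].
- have [zeta [z1 z2]] := arl Y hY b y (cls (Wedge H pH qH)).
  have [Z [pZ [qZ Ez]]] := hom_edge (sexp_qcat hB) zeta.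
  split; first by exists Z; split=> //; move: z1; rewrite Ez => /eqn.
  move=> Z1 Z2 [p1 q1 t1] [p2 q2 t2].
  apply/(cls_edge_eq (sexp_qcat hB) p1 q1 p2 q2).
  rewrite -(z2 (cls (Wedge Z1 p1 q1))); last by apply/eqn.
  by apply: z2; apply/eqn.
- have [H [pH [qH ->]]] := hom_edge (sexp_qcat hA) chi.
  have [[Z [pZ qZ tZ]] uniq] := arl Y hY b y H pH qH.
  exists (cls (Wedge Z pZ qZ)); split; first exact/eqn.
  move=> zeta; have [Z' [pZ' [qZ' ->]]] := hom_edge (sexp_qcat hB) zeta.
  move/eqn => tZ'; apply/(cls_edge_eq (sexp_qcat hB)).
  by apply: uniq.
Qed.

Lemma cell_edge (A Y : sSet) (f g : sMap Y A) (c : cell f g) : quasi_category A ->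
  exists H p q, c = cls (@Wedge (sexp A Y) (name f) (name g) H p q).
Proof. by move=> hA; apply: hom_edge; apply: sexp_qcat. Qed.

Lemma cell_iso_edge (A Y : sSet) (f g : sMap Y A) (L M : sexp A Y 1) p q :
  quasi_category A -> tri L M (degen (name f)) -> tri M L (degen (name g)) ->
  cell_iso (cls (@Wedge (sexp A Y) (name f) (name g) L p q)).
Proof.
move=> hA t1 t2.
have p' : src M = name g by rewrite -(tri_mid t1).
have q' : tgt M = name f by rewrite -(tri_tgt t1) tgt_degen.
exists (cls (Wedge M p' q')); split.
- rewrite -(cls_id (src_degen _) (tgt_degen _)).
  exact/(cls_cmp_tri (sexp_qcat hA)).
- rewrite -(cls_id (src_degen _) (tgt_degen _)).
  exact/(cls_cmp_tri (sexp_qcat hA)).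
Qed.

Lemma eq_cell_edge (A Y : sSet) (f g : sMap Y A) (e : f = g)
    (p : src (degen (name f : sexp A Y 0)) = name f)
    (q : tgt (degen (name f : sexp A Y 0)) = name g) :
  eq_cell e = cls (@Wedge (sexp A Y) (name f) (name g) (degen (name f : sexp A Y 0)) p q).
Proof.
rewrite /eq_cell -(cls_id (src_degen _) (tgt_degen _)).
exact: cell_cast_edge.
Qed.

(** * The contraction of Delta^0 * X *)

Section Contraction.
Variable X : sSet.
Notation J := (join (Delta 0) X).
Notation incl := (join_incl (Delta 0) X).

Definition const_op k l (i : 'I_l) : op k l := @Op k l (fun=> i) (fun _ _ _ => leqnn i).

Lemma op_const_comp k l m (i : 'I_m) (b : op k l) : op_comp (const_op l i) b = const_op k i.
Proof. exact: op_ext. Qed.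

Definition apex n : J n :=
  @JoinSplx (Delta 0) X n.+1 n.+1 0 (addn0 n.+1) (const_op n.+1 ord0 : Delta 0 n) tt.

Lemma apex_eq n (z : J n) : apexes z = n.+1 -> z = apex n.
Proof.
case: z => p q e y x; rewrite /apexes /= => pn; subst p.
have q0 : q = 0 by lia.
subst q; case: x; rewrite /apex; congr (JoinSplx _ _ _); first exact: eq_irrelevance.
exact: aug_point.
Qed.

Lemma apexes_le n (z : J n) : apexes z <= n.+1.
Proof. by case: z => p q e y x; rewrite /apexes /= -e leq_addr. Qed.

Lemma eq_from_ord n a b : a <= n -> b <= n ->
  (forall j : 'I_n, (j < a) = (j < b)) -> a = b.
Proof.
move=> an bn H; have [ab|ba|//] := ltngtP a b.
  by have := H (Ordinal (leq_trans ab bn)); rewrite /= ltnn ab.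
by have := H (Ordinal (leq_trans ba an)); rewrite /= ltnn ba.
Qed.

Lemma act_apex m n (a : op m.+1 n.+1) : act a (apex n) = apex m.
Proof.
apply: apex_eq; apply: (eq_from_ord (apexes_le _) (leqnn _)) => j.
by rewrite apexesP !ltn_ord.
Qed.

Section Collapse.
Variables (n : nat) (z : join_splx (Delta 0) X n) (p : nat) (zp : jl z <= p) (pn : p <= n).

Lemma collapse_lt i : i < n - p -> p - jl z + i < jr z.
Proof. by have := jlr z; lia. Qed.
Lemma collapse_mono i j : i <= j -> j < n - p -> p - jl z + i <= p - jl z + j.
Proof. by lia. Qed.
Definition collapse_op : op (n - p) (jr z) := mk_op collapse_lt collapse_mono.

Definition point_splx k : aug (Delta 0) k :=
  if k is m.+1 return aug (Delta 0) k then const_op m.+1 ord0 else tt.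

(** The first [p] vertices become the apex; those of them that belonged to the base, [p - jl z] in
    number, are dropped from [jx z]. *)
Definition collapse : join_splx (Delta 0) X n :=
  JoinSplx (subnKC pn) (point_splx p) (aug_act collapse_op (jx z)).
End Collapse.

Lemma cut_mono m n (a : op m n) p p' : p <= p' -> cut a p <= cut a p'.
Proof.
by move=> pp; apply/subset_leq_card/subsetP => i; rewrite !inE => h; apply: leq_trans pp.
Qed.

Lemma act_collapse m n (a : op m n) (z : join_splx (Delta 0) X n) p
    (zp : jl z <= p) (pn : p <= n) p' (zp' : jl (join_act a z) <= p') (pm : p' <= m) :
  p' = cut a p -> join_act a (collapse zp pn) = collapse zp' pm.
Proof.
move=> Ep; rewrite /collapse /join_act /= -!aug_act_comp.
apply: cone_eq => [|i i' ii]; first by rewrite Ep.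
have c1 : p <= a (rshift_cut i) by rewrite leqNgt -cutP -leqNgt leq_addr.
have c2 := cut_mono a zp.
have Ea : a (rshift_cut i) =
    a (rshift_cut (collapse_op zp' pm i' : 'I_(m - cut a (jl z)))) :> nat.
  by apply: op_eq => /=; rewrite /= in ii zp' *; lia.
transitivity (a (rshift_cut i) - jl z); [rewrite /=; lia|by congr (_ - _)].
Qed.

Definition contract_bound n (z : J n) (t : op n.+1 2) := maxn (apexes z) (cut t 1).

Lemma contract_le n (z : J n) (t : op n.+1 2) : contract_bound z t <= n.+1.
Proof. by rewrite geq_max apexes_le cut_le. Qed.

(* The vertices at which t is 0 are moved to the apex. *)
Definition contract n (z : J n) (t : op n.+1 2) : J n :=
  collapse (leq_maxl _ _ : apexes z <= contract_bound z t) (contract_le z t).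

Lemma contractP n (z : J n) (t : op n.+1 2) (j : 'I_n.+1) :
  (j < apexes (contract z t)) = (j < apexes z) || (t j == 0 :> nat).
Proof.
rewrite /apexes /= /contract_bound leq_max; congr orb.
by rewrite cutP ltnS leqn0.
Qed.

(** Naturality makes [contract] a map J x Delta^1 -> J, a homotopy from the constant map at the apex
    ([contract0]) to the identity ([contract1]). *)
Lemma act_contract m n (a : op m.+1 n.+1) (z : J n) (t : op n.+1 2) :
  act a (contract z t) = contract (act a z) (op_comp t a).
Proof.
apply: act_collapse; apply: (@eq_from_ord m.+1) => [||j].
- exact: contract_le.
- exact: cut_le.
- by rewrite /contract_bound leq_max -/(_ < _) apexesP !cutP /contract_bound leq_max cutP.
Qed.

Lemma contract_eq n (z : J n) (t t' : op n.+1 2) :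
  (forall j : 'I_n.+1, (j < apexes z) || (t j == 0 :> nat) = (j < apexes z) || (t' j == 0 :> nat)) ->
  contract z t = contract z t'.
Proof.
move=> H; have E : contract_bound z t = contract_bound z t'.
  by apply: (eq_from_ord (contract_le _ _) (contract_le _ _)) => j; have := H j; rewrite -!contractP.
rewrite /contract /collapse; apply: cone_eq => // i i' ii /=.
by rewrite ii E.
Qed.

Lemma contract1 n (z : J n) (t : op n.+1 2) :
  (forall j : 'I_n.+1, j < apexes z \/ t j <> 0 :> nat) -> contract z t = z.
Proof.
move=> H; have E : contract_bound z t = apexes z.
  apply: (eq_from_ord (contract_le _ _) (apexes_le _)) => j.
  rewrite -[LHS]/(j < apexes (contract z t)) contractP.
  by case: (H j) => [->|/eqP/negbTE->]; rewrite ?orbT ?orbF.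
rewrite /contract /collapse; case: z E {H} => p q e y x; rewrite /apexes /= => E.
rewrite -[in RHS](aug_act_id x); apply: cone_eq => // i i' ii /=.
by rewrite ii E /apexes /=; lia.
Qed.

Lemma contract0 n (z : J n) (t : op n.+1 2) :
  (forall j, t j = 0 :> nat) -> contract z t = apex n.
Proof.
move=> H; apply: apex_eq; apply: (eq_from_ord (apexes_le _) (leqnn _)) => j.
by rewrite contractP H eqxx orbT ltn_ord.
Qed.

Lemma contract_apex n (t : op n.+1 2) : contract (apex n) t = apex n.
Proof.
apply: contract1 => j; left; exact: ltn_ord.
Qed.

(** The map from Delta^0 * X to Delta^0 * Delta^0 = Delta^1 induced by X -> Delta^0. *)
Definition indic n (z : J n) : op n.+1 2.
Proof.
exists (fun j : 'I_n.+1 => if j < apexes z then ord0 else ord_max).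
move=> i j ij; case: ltnP => // zi; case: ltnP => // jz.
by have := leq_ltn_trans (leq_trans zi ij) jz; rewrite ltnn.
Defined.

Lemma indicE n (z : J n) (j : 'I_n.+1) : indic z j = (if j < apexes z then 0 else 1) :> nat.
Proof. by rewrite /=; case: ifP. Qed.

End Contraction.

(** * Families of cones *)

Section Vertices.
Variables (E Y : sSet).

Definition unname (v : sexp E Y 0) : sMap Y E.
Proof.
exists (fun n y => smap v (y, const_op n.+1 ord0 : Delta 0 n)).
by move=> m n a y; rewrite -smap_act /= op_const_comp.
Defined.

Lemma name_unname (v : sexp E Y 0) : name (unname v) = v.
Proof.
apply: sMap_ext => n [y t] /=; congr (smap v _); congr pair.
by apply: op_ext => j; rewrite !(ord1 (_ j)).
Qed.

Lemma name_inj (f g : sMap Y E) : name f = name g -> f = g.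
Proof.
move=> /(f_equal (fun v : sMap (Y \x Delta 0) E => v)) H; apply: sMap_ext => n y.
exact: (f_equal (fun v : sMap (Y \x Delta 0) E => smap v ((y, const_op n.+1 ord0 : Delta 0 n) : (Y \x Delta 0) n)) H).
Qed.
End Vertices.

Section FamilyOps.
Variables (A J Y : sSet).
Notation E := (sexp A J).

(** Families of cones are compared through these values: [sexp_eq] detects equality on them, and
    operators on the family only change [t]. *)
Definition value n (T : sexp E Y n) m (y : Y m) (t : op m.+1 n.+1) (z : J m) : A m :=
  smap (uncurry (T : sMap (Y \x Delta n) E)) (((y, t : Delta n m), z) : ((Y \x Delta n) \x J) m).

Lemma sexp_eq n (T T' : sexp E Y n) :
  (forall m (y : Y m) t (z : J m), value T y t z = value T' y t z) -> T = T'.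
Proof. by move=> H; apply: uncurry_inj => m [y t] z; apply: H. Qed.

Lemma at_act m n (a : op m.+1 n.+1) (T : sexp E Y n) l (y : Y l) t (z : J l) :
  value (act a T) y t z = value T y (op_comp a t) z.
Proof. by []. Qed.

Lemma act_at n (T : sexp E Y n) l m (b : op l.+1 m.+1) (y : Y m) t (z : J m) :
  act b (value T y t z) = value T (act b y) (op_comp t b) (act b z).
Proof. by rewrite /value -smap_act. Qed.

Lemma at_name (f : sMap Y E) m (y : Y m) t (z : J m) :
  value (name f : sexp E Y 0) y t z = smap (uncurry f) (y, z).
Proof. by []. Qed.

Lemma coface1_const m (t : op m 1) : op_comp (@coface 1 (@Ordinal 2 1 isT)) t = const_op m ord0.
Proof. by apply: op_ext => j /=; rewrite (ord1 (t j)). Qed.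

Lemma coface0_const m (t : op m 1) : op_comp (@coface 1 (@Ordinal 2 0 isT)) t = const_op m ord_max.
Proof. by apply: op_ext => j /=; rewrite (ord1 (t j)). Qed.

Lemma op1_const m (t : op m 1) : t = const_op m ord0.
Proof. by apply: op_ext => j; rewrite (ord1 (t j)). Qed.

Lemma at_src (T : sexp E Y 1) l (y : Y l) t (z : J l) :
  value (src T) y t z = value T y (const_op l.+1 ord0) z.
Proof. by rewrite /src at_act coface1_const. Qed.

Lemma at_tgt (T : sexp E Y 1) l (y : Y l) t (z : J l) :
  value (tgt T) y t z = value T y (const_op l.+1 ord_max) z.
Proof. by rewrite /tgt at_act coface0_const. Qed.

Lemma at_degen (T : sexp E Y 0) l (y : Y l) t (z : J l) :
  value (degen T) y t z = value T y (const_op l.+1 ord0) z.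
Proof. by rewrite /degen at_act; congr value; apply: op1_const. Qed.

Lemma at_transpose n (g : sMap ((Y \x Delta n) \x J) A) m (y : Y m) t (z : J m) :
  value (transpose g : sexp E Y n) y t z = smap g (((y, t : Delta n m), z) : ((Y \x Delta n) \x J) m).
Proof. exact: uncurry_transpose. Qed.

Lemma uncurry_name (T : sexp E Y 0) (f : sMap Y E) :
  (forall m (y : Y m) t (z : J m), value T y t z = smap (uncurry f) (y, z)) -> T = name f.
Proof. by move=> H; apply: sexp_eq => m y t z; rewrite H. Qed.
End FamilyOps.

Lemma at_precomp (A J Y K : sSet) (s : sMap K Y) n (T : sexp (sexp A J) Y n) m (y : K m) t (z : J m) :
  value (smap (precomp (sexp A J) s) T) y t z = value T (smap s y) t z.
Proof. by []. Qed.

Section Cones.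
Variables (A X : sSet).
Notation J := (join (Delta 0) X).
Notation incl := (join_incl (Delta 0) X).
Notation E := (sexp A J).
Notation D := (sexp A X).
Notation special := (special X A).

Definition eval_apex : sMap E A.
Proof.
exists (fun n (s : E n) => smap s ((apex X n, op_id n.+1 : Delta n n) : (J \x Delta n) n)).
move=> m n a s; rewrite -smap_act -(act_apex X a); congr (smap s _).
Defined.

Section Family.
Variable Y : sSet.

Lemma res_at n (T : sexp E Y n) m (y : Y m) t (x : X m) :
  value (smap (postcomp Y (res A X)) T) y t x = value T y t (smap incl x).
Proof. by []. Qed.

Lemma const_at (f : sMap Y A) n (y : Y n) (z : J n) :
  smap (uncurry (const_diag A J \s f)) (y, z) = smap f y.
Proof. by rewrite /= act_id. Qed.

(** The contraction fixes the apex, so it factors through [thick]; the junk values of [hat] are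
    harmless because [contract] ignores [t] over the apexes. The underlying edge [eps b] is the
    counit at [b] of the adjunction between constant cones and evaluation at the apex. *)
Definition eps_special (b : sMap Y E) : special Y 1.
Proof.
exists (fun m (w : thick X Y 1 m) =>
  smap (uncurry b) (((sval w).2.2, contract (sval w).2.1 (hat ((sval w).1 : op _ _))) : (Y \x J) m)).
move=> m n a w; rewrite -smap_act; congr (smap (uncurry b) _); congr pair.
by rewrite act_contract; congr contract; apply: op_ext.
Defined.

Definition eps (b : sMap Y E) : sexp E Y 1 := smap (underlying X A Y) (eps_special b).

Lemma underlying_at n (F : special Y n) m (y : Y m) t (z : J m) :
  value (smap (underlying X A Y) F) y t z = smap F (thick_splx t z y).
Proof. exact: underlyingE. Qed.

Lemma base_postcomp n (F : special Y n) :
  smap (base X A Y) F = smap (postcomp Y (res A X)) (smap (underlying X A Y) F).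
Proof. by []. Qed.

Lemma eps_at (b : sMap Y E) m (y : Y m) t (z : J m) :
  value (eps b) y t z = smap (uncurry b) (y, contract z t).
Proof.
rewrite underlying_at /=; congr (smap (smap b _) _); congr pair.
apply: contract_eq => j /=; by case: (ltnP j (apexes z)).
Qed.

Lemma src_eps (b : sMap Y E) : src (eps b) = name (const_diag A J \s (eval_apex \s b)).
Proof.
apply: uncurry_name => m y t z; rewrite at_src eps_at const_at contract0 //.
Qed.

Lemma tgt_eps (b : sMap Y E) : tgt (eps b) = name b.
Proof.
apply: uncurry_name => m y t z; rewrite at_tgt eps_at contract1 // => j.
by right.
Qed.

Lemma eps_const (f : sMap Y A) : eps (const_diag A J \s f) =
  degen (name (const_diag A J \s f) : sexp E Y 0).
Proof.
by apply: sexp_eq => m y t z; rewrite eps_at at_degen at_name !const_at.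
Qed.

Definition slide_op n m (t : op m.+1 n.+1) (z : J m) : op m.+1 n.+1.
Proof.
exists (fun j : 'I_m.+1 => if j < apexes z then t j else ord_max).
move=> i j ij; case: (ltnP j (apexes z)) => jz.
  by rewrite (leq_ltn_trans ij jz) op_mono.
by rewrite /= -ltnS ltn_ord.
Defined.

Lemma slide_op_act n m l (b : op l.+1 m.+1) (t : op m.+1 n.+1) (z : J m) :
  op_comp (slide_op t z) b = slide_op (op_comp t b) (act b z).
Proof. apply: op_ext => j.
by rewrite -[LHS]/(nat_of_ord (if b j < apexes z then t (b j) else ord_max)) -apexesP. Qed.

Lemma slide_op_incl n m (t : op m.+1 n.+1) (x : X m) :
  slide_op t (smap incl x) = const_op m.+1 ord_max.
Proof. exact: op_ext. Qed.

Lemma slide_op_indic m (z : J m) : slide_op (const_op m.+1 ord0) z = indic z.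
Proof. exact: op_ext. Qed.

(* The simplex of cones with the base of the last cone and moving apex. *)
Definition slide n (T : sexp E Y n) : sexp E Y n.
Proof.
refine (transpose (_ : sMap ((Y \x Delta n) \x J) A)).
exists (fun m w => value T w.1.1 (slide_op (w.1.2 : op _ _) w.2) w.2).
by move=> l m b [[y t] z]; rewrite act_at slide_op_act.
Defined.

Lemma slide_at n (T : sexp E Y n) m (y : Y m) t (z : J m) :
  value (slide T) y t z = value T y (slide_op t z) z.
Proof. exact: at_transpose. Qed.

(** The cone with the apex of the source of [T] and the base of its target: [T] restricted along
    [indic]. *)
Definition slide_src (T : sexp E Y 1) : sMap Y E := unname (src (slide T)).

Lemma name_slide_src (T : sexp E Y 1) : name (slide_src T) = src (slide T).
Proof. exact: name_unname. Qed.

Lemma slide_src_at (T : sexp E Y 1) m (y : Y m) (z : J m) :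
  smap (uncurry (slide_src T)) (y, z) = value T y (indic z) z.
Proof.
rewrite -(at_name _ y (const_op m.+1 ord0)) name_slide_src at_src slide_at.
by rewrite slide_op_indic.
Qed.

Lemma tgt_slide (T : sexp E Y 1) : tgt (slide T) = tgt T.
Proof.
apply: sexp_eq => m y t z; rewrite !at_tgt slide_at; congr (value T).
by apply: op_ext => j /=; case: ifP.
Qed.

Lemma res_slide (T : sexp E Y 1) :
  smap (postcomp Y (res A X)) (slide T) = degen (smap (postcomp Y (res A X)) (tgt T)).
Proof.
apply: sexp_eq => m y t x.
by rewrite at_degen !res_at at_tgt slide_at slide_op_incl.
Qed.

(** A special edge does not move the apex, so nothing moves once the base is held fixed. *)
Lemma slide_underlying (F : special Y 1) :
  slide (smap (underlying X A Y) F) = degen (tgt (smap (underlying X A Y) F)).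
Proof.
apply: sexp_eq => m y t z.
rewrite slide_at at_degen at_tgt !underlying_at; congr (smap F _).
apply: eq_exist => /=; congr pair; apply: op_ext => j.
by rewrite !apex_opE; case jz: (j < apexes z) => //=; rewrite jz.
Qed.

Lemma slide_src_underlying (F : special Y 1) :
  name (slide_src (smap (underlying X A Y) F)) = tgt (smap (underlying X A Y) F).
Proof. by rewrite name_slide_src slide_underlying src_degen. Qed.

(** Sliding commutes with the faces that keep the last vertex, here d0 and d1. The remaining face of
    the slid simplex supplies [mu]. *)
Lemma slide_tri (f g h : sexp E Y 1) : tri f g h ->
  exists mu, tri mu (slide g) (slide h) /\
    smap (postcomp Y (res A X)) mu = degen (smap (postcomp Y (res A X)) (tgt g)).
Proof.
move=> [T [_ <- <-]]; exists (d2 (slide T)); split.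
  exists (slide T); split=> //; apply: sexp_eq => m y t z;
    rewrite at_act !slide_at at_act; congr value; apply: op_ext => j /=; by case: ifP.
apply: sexp_eq => m y t x.
rewrite at_degen !res_at at_act slide_at slide_op_incl at_tgt at_act; congr value.
by apply: op_ext.
Qed.

(* The triangle is the image of the edges 01 and 12 of
   (apex, 0), (x, 0), (x, 1) under [T]. *)
Lemma res_eps_slide_src (T : sexp E Y 1) (f : sMap Y A) : quasi_category A ->
  src T = name (const_diag A J \s f) ->
  homotopic (smap (postcomp Y (res A X)) T) (smap (postcomp Y (res A X)) (eps (slide_src T))).
Proof.
move=> hA sT.
have T0 m (y : Y m) (z : J m) : value T y (const_op m.+1 ord0) z = smap f y.
  by rewrite -(at_src T y (const_op m.+1 ord0)) sT at_name const_at.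
pose q0 : op 3 2 := dgn_op (@Ordinal 2 0 isT); pose q1 : op 3 2 := dgn_op (@Ordinal 2 1 isT).
have [t2 t2E] : exists t2 : sexp D Y 2, forall m (y : Y m) t (x : X m),
    value t2 y t x = value T y (op_comp q0 t) (contract (smap incl x) (op_comp q1 t)).
  unshelve eexists (transpose (@SMap ((Y \x Delta 2) \x X) A (fun m w =>
     value T w.1.1 (op_comp q0 (w.1.2 : op _ _)) (contract (smap incl w.2) (op_comp q1 (w.1.2 : op _ _)))) _)).
    move=> l m b [[y t] x]; rewrite act_at act_contract smap_act; congr value; exact: op_ext.
  by move=> m y t x; rewrite at_transpose.
apply/(homotopic_l (sexp_qcat (sexp_qcat hA))); exists t2; split; apply: sexp_eq => m y t x.
- rewrite at_act t2E at_degen at_src res_at.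
  suff -> : op_comp q0 (op_comp (coface (@Ordinal 3 2 isT)) t) = const_op m.+1 ord0 by rewrite !T0.
  by apply: op_ext => j /=; have := ltn_ord (t j); rewrite /bump /unbump /=; lia.
- rewrite at_act t2E res_at contract1.
    by congr (value T); apply: op_ext => j /=; rewrite /bump /unbump /=; lia.
  by move=> j; right; rewrite /= /bump /unbump /=; lia.
- rewrite at_act t2E res_at eps_at slide_src_at.
  have E1 : op_comp q1 (op_comp (coface (@Ordinal 3 1 isT)) t) = t.
    by apply: op_ext => j /=; have := ltn_ord (t j); rewrite /bump /unbump /=; lia.
  rewrite E1; congr (value T); apply: op_ext => j; rewrite indicE contractP apexes_incl /=.
  by have := ltn_ord (t j); rewrite /bump /unbump /=; case: eqP; lia.
Qed.

(** In Delta^1 the position of a vertex is determined by whether it is 0, so [thick X Y 0] is J x Y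
    and a special vertex is just a family of cones. *)
Lemma special_eq0 (F F' : special Y 0) :
  smap (underlying X A Y) F = smap (underlying X A Y) F' -> F = F'.
Proof.
move=> E; apply: sMap_ext => m [[u [z y]] h].
have -> : exist _ (u, (z, y)) h = thick_splx (const_op m.+1 ord0) z y :> thick X Y 0 m.
  apply: eq_exist; congr pair; apply: op_ext => j; rewrite apex_opE.
  have := h j; rewrite /=; have := ltn_ord (u j); case: ifP => _; lia.
by rewrite -!underlying_at E.
Qed.

Lemma special_tri (F G : special Y 1) (H : sexp D Y 1) : quasi_category A ->
  src F = src G -> tri (smap (base X A Y) F) H (smap (base X A Y) G) ->
  exists K : special Y 1, tri F K G /\ smap (base X A Y) K = H.
Proof.
move=> hA FG [s [s2 s0 s1]].
(* The horn at 0 has [F] as its edge 01, opposite 2, and [G] as its edge 02, opposite 1; the entry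
   at 0 is a dummy. *)
pose y (i : 'I_3) := if i == 1 :> nat then G else F.
have yE (i : 'I_3) : i <> ord0 -> smap (base X A Y) (y i) = act (face_op 2 i) s.
  move=> i0; rewrite /y; case: ifP => /eqP i1.
    by rewrite -s1 /face2 cofaceE i1.
  rewrite -s2 /face2 cofaceE; congr (act (face_op 2 _) s) => /=.
  have : i <> 0 :> nat by move=> E; apply: i0; apply: val_inj.
  by have := ltn_ord i; lia.
have [|h hE] := @horn_glue_faces (special Y) 0 ord0 y.
  move=> i j ij i0 j0.
  have [i1 j2] : i = 1 :> nat /\ j = 2 :> nat.
    have : i <> 0 :> nat by move=> E; apply: i0; apply: val_inj.
    by have := ltn_ord j; lia.
  by rewrite /y i1 j2 /=; move: FG; rewrite /src cofaceE.
have [|N [hN bN]] := special_lift (h := h) (sigma := s) hA isT.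
  move=> m a; case: (svalP a) => i [i0 ai].
  have [||c Ec] := @face_factor _ _ (sval a) i; first by have := ltn_ord i; lia.
    by move=> t /val_inj; apply: ai.
  by rewrite (hE i m c a i0 Ec) smap_act yE // -act_comp -Ec.
have face i : i <> ord0 -> act (face_op 2 i) N = y i.
  move=> i0.
  have hi : exists j : 'I_3, j <> ord0 /\ forall t, face_op 2 i t <> j.
    exists i; split=> // t /(f_equal val) /=; rewrite /bump; lia.
  rewrite -(hN _ (exist _ (face_op 2 i) hi : horn ord0 1)) (hE i _ (op_id 2)) ?act_id //.
exists (d0 N); split; last by rewrite smap_act bN.
by exists N; split=> //; rewrite /face2 cofaceE face.
Qed.

(** The horn of Delta^1 at 0 is a point, so this case of [special_lift] transports [b] along [H],
    strictly over [H]. *)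
Lemma special_lift1 (b : sMap Y E) (H : sexp D Y 1) : quasi_category A ->
  src H = name (res A X \s b) ->
  exists F : special Y 1, src (smap (underlying X A Y) F) = name b /\ smap (base X A Y) F = H.
Proof.
move=> hA sH.
have [v vE] : exists v : special Y 0, smap (underlying X A Y) v = name b.
  unshelve eexists (@SMap (thick X Y 0) A (fun m w =>
    smap (uncurry b) (((sval w).2.2, (sval w).2.1) : (Y \x J) m)) _).
    by move=> l m a w; rewrite -smap_act.
  by apply: sexp_eq => m y t z; rewrite underlying_at.
have [|h hE] := @horn_glue (special Y) 0 ord0 (fun=> v).
  move=> i j m c d i0 j0 _; congr (act _ v); apply: op_ext => t.
  by rewrite (ord1 (c t)) (ord1 (d t)).
have [|N [hN bN]] := special_lift (h := h) (sigma := H) hA isT.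
  move=> m a; case: (svalP a) => i [i0 ai].
  have i1 : i = 1 :> nat.
    have : i <> 0 :> nat by move=> E; apply: i0; apply: val_inj.
    by have := ltn_ord i; lia.
  have [||c Ec] := @face_factor _ _ (sval a) i; first by have := ltn_ord i; lia.
    by move=> t /val_inj; apply: ai.
  rewrite (hE i m c a i0 Ec) smap_act Ec act_comp; congr (act c _).
  rewrite i1 -[RHS]/(act (face_op 1 (@Ordinal 2 1 isT)) H) -cofaceE -/(src H) sH.
  by rewrite base_postcomp vE name_postcomp.
exists N; split=> //; rewrite smap_src -vE; congr (smap _ _).
have i0 : @Ordinal 2 1 isT <> ord0 by [].
have hi : exists j : 'I_2, j <> ord0 /\ forall t, face_op 1 1 t <> j.
  exists (@Ordinal 2 1 isT); split=> // t /(f_equal val) /=; rewrite /bump.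
  by rewrite (ord1 t).
rewrite /src cofaceE -(hN _ (exist _ (face_op 1 1) hi : horn ord0 0)).
rewrite (hE (@Ordinal 2 1 isT) _ (op_id 1)) ?act_id //.
Qed.

Lemma eps_special_src (b b' : sMap Y E) : eval_apex \s b = eval_apex \s b' ->
  src (eps_special b) = src (eps_special b').
Proof. by move=> H; apply: special_eq0; rewrite -!smap_src !src_eps H. Qed.

(* [eps b] is weakly cocartesian over [res A X], up to moving the apex. *)
Theorem special_factor (b : sMap Y E) (T : sexp E Y 1) (H : sexp D Y 1) : quasi_category A ->
  src T = name (const_diag A J \s (eval_apex \s b)) ->
  tri (smap (postcomp Y (res A X)) (eps b)) H (smap (postcomp Y (res A X)) T) ->
  exists F : special Y 1, [/\ src (smap (underlying X A Y) F) = name b,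
    tgt (smap (underlying X A Y) F) = name (slide_src T) & smap (base X A Y) F = H].
Proof.
move=> hA sT tH; have hD := sexp_qcat (sexp_qcat hA : quasi_category D) (J := Y).
(* Up to homotopy of restrictions, [T] is replaced by the special edge [eps (slide_src T)]. It
   starts at the same constant cone as [eps b], so the two form a horn at 0. *)
have tH' := tri_homotopic hD tH (homotopic_refl _) (homotopic_refl _) (res_eps_slide_src hA sT).
have [|K [tK bK]] := @special_tri (eps_special b) (eps_special (slide_src T)) H hA _ tH'.
  apply: eps_special_src; apply: sMap_ext => n y.
  rewrite [RHS]slide_src_at.
  have -> : indic (apex X n) = const_op n.+1 ord0 :> op _ _.
    by apply: op_ext => j; rewrite indicE ltn_ord.
  by rewrite -(at_src T y (const_op n.+1 ord0)) sT at_name const_at.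
exists K; split=> //.
- by rewrite smap_src -(tri_mid tK) -smap_tgt; apply: tgt_eps.
- by rewrite smap_tgt -(tri_tgt tK) -smap_tgt; apply: tgt_eps.
Qed.
End Family.

Section Restriction.
Variables (Y K : sSet) (s : sMap K Y).

Definition thick_pre n : sMap (thick X K n) (thick X Y n).
Proof.
unshelve eexists (fun m (w : thick X K n m) =>
  exist _ ((sval w).1, ((sval w).2.1, smap s (sval w).2.2)) _).
  exact: (svalP w).
by move=> l m a w; apply: eq_exist; rewrite /= smap_act.
Defined.

Definition special_pre n (F : special Y n) : special K n := F \s thick_pre n.

Lemma underlying_pre n (F : special Y n) :
  smap (underlying X A K) (special_pre F) = smap (precomp E s) (smap (underlying X A Y) F).
Proof.
apply: sexp_eq => m y t z; rewrite at_precomp !underlying_at.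
by congr (smap F _); apply: eq_exist.
Qed.

Lemma slide_pre n (T : sexp E Y n) : slide (smap (precomp E s) T) = smap (precomp E s) (slide T).
Proof. by apply: sexp_eq => m y t z; rewrite at_precomp !slide_at at_precomp. Qed.
End Restriction.
End Cones.

(** * Comma objects *)

Section Homotopies.
Variables (P Y : sSet).

Lemma sexp_ext n (T T' : sexp P Y n) :
  (forall m (y : Y m) (t : Delta n m), smap T (y, t) = smap T' (y, t)) -> T = T'.
Proof. by move=> H; apply: sMap_ext => m [y t]. Qed.

Lemma src_ev (T : sexp P Y 1) m (y : Y m) (t : Delta 0 m) :
  smap (src T) (y, t) = smap T (y, const_op m.+1 ord0 : Delta 1 m).
Proof. by rewrite /= coface1_const. Qed.

Lemma tgt_ev (T : sexp P Y 1) m (y : Y m) (t : Delta 0 m) :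
  smap (tgt T) (y, t) = smap T (y, const_op m.+1 ord_max : Delta 1 m).
Proof. by rewrite /= coface0_const. Qed.

Lemma src_nameP (T : sexp P Y 1) (f : sMap Y P) : src T = name f <->
  forall m (y : Y m), smap T (y, const_op m.+1 ord0 : Delta 1 m) = smap f y.
Proof.
split=> [sT m y|H].
  rewrite -(src_ev T y (const_op m.+1 ord0 : Delta 0 m)).
  exact: (f_equal (fun v : sexp P Y 0 => smap v (y, const_op m.+1 ord0 : Delta 0 m)) sT).
by apply: sexp_ext => m y t; rewrite src_ev H.
Qed.

Lemma tgt_nameP (T : sexp P Y 1) (f : sMap Y P) : tgt T = name f <->
  forall m (y : Y m), smap T (y, const_op m.+1 ord_max : Delta 1 m) = smap f y.
Proof.
split=> [sT m y|H].
  rewrite -(tgt_ev T y (const_op m.+1 ord0 : Delta 0 m)).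
  exact: (f_equal (fun v : sexp P Y 0 => smap v (y, const_op m.+1 ord0 : Delta 0 m)) sT).
by apply: sexp_ext => m y t; rewrite tgt_ev H.
Qed.
End Homotopies.

(** [G] and [Z] combine to a square Y x Delta^1 x Delta^1 -> Q, which its diagonal [M] divides into
    two triangles. *)
Lemma naturality (P Q Y : sSet) (G : sexp Q P 1) (g0 g1 : sMap P Q) (Z : sexp P Y 1)
    (b b' : sMap Y P) :
  src G = name g0 -> tgt G = name g1 -> src Z = name b -> tgt Z = name b' ->
  exists M, tri (smap (postcomp Y g0) Z) (smap (precomp Q b') G) M /\
            tri (smap (precomp Q b) G) (smap (postcomp Y g1) Z) M.
Proof.
move=> /src_nameP sG /tgt_nameP tG /src_nameP sZ /tgt_nameP tZ.
pose q0 : op 3 2 := dgn_op (@Ordinal 2 0 isT); pose q1 : op 3 2 := dgn_op (@Ordinal 2 1 isT).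
have mk n (p q : op n.+1 2) : exists S : sexp Q Y n, forall m (y : Y m) (t : op m.+1 n.+1),
    smap S (y, t : Delta n m) = smap G (smap Z (y, op_comp p t : Delta 1 m), op_comp q t : Delta 1 m).
  unshelve eexists (@SMap (Y \x Delta n) Q (fun m w =>
    smap G (smap Z (w.1, op_comp p (w.2 : op _ _) : Delta 1 m), op_comp q (w.2 : op _ _) : Delta 1 m)) _).
    move=> l m c [y t]; rewrite -smap_act; congr (smap G _).
    by rewrite [RHS]/= -smap_act.
  by [].
have [M ME] := mk 1 (op_id 2) (op_id 2).
(* [S] runs along [Z] first and then along [G]; [S'] does so in the opposite order. *)
have [S SE] := mk 2 q1 q0; have [S' SE'] := mk 2 q0 q1.
have e2q0 m (t : op m.+1 2) : op_comp q0 (op_comp (coface (@Ordinal 3 2 isT)) t) = const_op m.+1 ord0.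
  by apply: op_ext => j /=; have := ltn_ord (t j); rewrite /bump /unbump /=; lia.
have e2q1 m (t : op m.+1 2) : op_comp q1 (op_comp (coface (@Ordinal 3 2 isT)) t) = t.
  by apply: op_ext => j /=; have := ltn_ord (t j); rewrite /bump /unbump /=; lia.
have e0q0 m (t : op m.+1 2) : op_comp q0 (op_comp (coface (@Ordinal 3 0 isT)) t) = t.
  by apply: op_ext => j /=; have := ltn_ord (t j); rewrite /bump /unbump /=; lia.
have e0q1 m (t : op m.+1 2) : op_comp q1 (op_comp (coface (@Ordinal 3 0 isT)) t) = const_op m.+1 ord_max.
  by apply: op_ext => j /=; have := ltn_ord (t j); rewrite /bump /unbump /=; lia.
have e1q0 m (t : op m.+1 2) : op_comp q0 (op_comp (coface (@Ordinal 3 1 isT)) t) = t.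
  by apply: op_ext => j /=; have := ltn_ord (t j); rewrite /bump /unbump /=; lia.
have e1q1 m (t : op m.+1 2) : op_comp q1 (op_comp (coface (@Ordinal 3 1 isT)) t) = t.
  by apply: op_ext => j /=; have := ltn_ord (t j); rewrite /bump /unbump /=; lia.
exists M; split; [exists S|exists S']; split; apply: sexp_ext => m y t.
- by rewrite [LHS]SE e2q0 e2q1 sG.
- by rewrite [LHS]SE e0q0 e0q1 tZ.
- by rewrite [LHS]SE e1q0 e1q1 ME !op_id_l.
- by rewrite [LHS]SE' e2q0 e2q1 sZ.
- by rewrite [LHS]SE' e0q0 e0q1 tG.
- by rewrite [LHS]SE' e1q0 e1q1 ME !op_id_l.
Qed.

(** * The comma object and its strict universal property *)

Section Comma.
Variables (E D K : sSet) (f : sMap E D) (k : sMap K D).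
Notation G := (E \x (sexp D (Delta 1) \x K)).

Definition comma_pred n (w : G n) : Prop :=
  smap w.2.1 ((const_op n.+1 ord0 : Delta 1 n), (op_id n.+1 : Delta n n)) = smap f w.1 /\
  smap w.2.1 ((const_op n.+1 ord_max : Delta 1 n), (op_id n.+1 : Delta n n)) = smap k w.2.2.

Lemma end_act m n (a : op m.+1 n.+1) (d : sexp D (Delta 1) n) (i : 'I_2) :
  smap (act a d) (const_op m.+1 i : Delta 1 m, op_id m.+1 : Delta m m) =
  act a (smap d (const_op n.+1 i : Delta 1 n, op_id n.+1 : Delta n n)).
Proof.
rewrite -smap_act; congr (smap d _).
Qed.

Lemma comma_subcomplex : subcomplex comma_pred.
Proof.
by move=> m n a [e [d x]] [/= H1 H2]; split; rewrite !smap_act -?H1 -?H2; apply: (end_act a d).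
Qed.

Definition comma : sSet := ssub comma_subcomplex.
Definition comma_dom : sMap comma E := @SMap comma E (fun n w => (sval w).1) (fun _ _ _ _ => erefl).
Definition comma_cod : sMap comma K := @SMap comma K (fun n w => (sval w).2.2) (fun _ _ _ _ => erefl).
Definition comma_path : sMap comma (sexp D (Delta 1)) :=
  @SMap comma (sexp D (Delta 1)) (fun n w => (sval w).2.1) (fun _ _ _ _ => erefl).

Definition comma_cell : sexp D comma 1 := uncurry comma_path.

Lemma src_comma_cell : src comma_cell = name (f \s comma_dom).
Proof. by apply/src_nameP => m w; case: (svalP w). Qed.

Lemma tgt_comma_cell : tgt comma_cell = name (k \s comma_cod).
Proof. by apply/tgt_nameP => m w; case: (svalP w). Qed.

Lemma comma_eq (W : sSet) (u v : sMap W comma) :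
  comma_dom \s u = comma_dom \s v -> comma_cod \s u = comma_cod \s v ->
  smap (precomp D u) comma_cell = smap (precomp D v) comma_cell -> u = v.
Proof.
move=> Ed Ec Ep.
have Ep' : comma_path \s u = comma_path \s v.
  apply: uncurry_inj => m w t.
  exact: (f_equal (fun T : sexp D W 1 => smap T (w, t)) Ep).
apply: sMap_ext => n w.
have := f_equal (fun g : sMap W _ => smap g w) Ed.
have := f_equal (fun g : sMap W _ => smap g w) Ec.
have := f_equal (fun g : sMap W _ => smap g w) Ep'.
rewrite /=; case: (smap u w) (smap v w) => [[e [d x]] h] [[e' [d' x']] h'] /= E1 E2 E3.
by apply: eq_exist; rewrite E1 E2 E3.
Qed.

Lemma comma_pair (W : sSet) (b : sMap W E) (y : sMap W K) (H : sexp D W 1) :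
  src H = name (f \s b) -> tgt H = name (k \s y) ->
  exists u : sMap W comma, [/\ comma_dom \s u = b, comma_cod \s u = y &
    smap (precomp D u) comma_cell = H].
Proof.
move=> /src_nameP sH /tgt_nameP tH.
pose path : sMap W (sexp D (Delta 1)) := transpose (H : sMap (W \x Delta 1) D).
have pathE n (w : W n) (i : 'I_2) :
    smap (smap path w) (const_op n.+1 i : Delta 1 n, op_id n.+1 : Delta n n) =
    smap H (w, const_op n.+1 i : Delta 1 n) by exact: uncurry_transpose.
have ok n (w : W n) : comma_pred (smap b w, (smap path w, smap y w)).
  by split; rewrite pathE ?sH ?tH.
unshelve eexists (@SMap W comma (fun n w => exist _ _ (ok n w)) _).
  by move=> m n a w; apply: eq_exist; rewrite !smap_act.
split; [exact: sMap_ext|exact: sMap_ext|].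
by apply: sexp_ext => m w t; exact: uncurry_transpose.
Qed.

(** Fillers in [E] and [K] are chosen first; their images in [D] prescribe the two ends, relative to
    which the path component is then filled. *)
Theorem comma_qcat : quasi_category E -> quasi_category D -> quasi_category K ->
  quasi_category comma.
Proof.
move=> hE hD hK n i hi h.
have [ve veE] := hE n i hi (comma_dom \s h).
have [vk vkE] := hK n i hi (comma_cod \s h).
have veP m (a : horn i m) : smap ve (sval a : Delta n m) = (sval (smap h a)).1.
  exact: (f_equal (fun g : sMap _ _ => smap g a) veE).
have vkP m (a : horn i m) : smap vk (sval a : Delta n m) = (sval (smap h a)).2.2.
  exact: (f_equal (fun g : sMap _ _ => smap g a) vkE).
pose J' m (z : Delta 1 m) := z = const_op m.+1 ord0 \/ z = const_op m.+1 ord_max.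
pose g : srel (Delta n \x Delta 1) D := fun m w x =>
  (w.2 = const_op m.+1 ord0 /\ x = smap f (smap ve w.1)) \/
  (w.2 = const_op m.+1 ord_max /\ x = smap k (smap vk w.1)).
have [|||||s [sP sg]] := @sexp_fill D (Delta 1) J' n i (comma_path \s h) g hD _ hi.
- by move=> m l a z [->|->]; [left|right]; apply: op_ext.
- move=> m l a [c z] x [[/= -> ->]|[/= -> ->]]; [left|right].
    by split; rewrite ?smap_act //; apply: op_ext.
  by split; rewrite ?smap_act //; apply: op_ext.
- move=> m [c z] x x' [[/= -> ->]|[/= -> ->]] [[/= E' ->]|[/= E' ->]] //.
    by have := f_equal (fun a : op m.+1 2 => a ord0 : nat) E'.
  by have := f_equal (fun a : op m.+1 2 => a ord0 : nat) E'.
- move=> m [c z]; split=> [[x [[/= -> _]|[/= -> _]]]|[/= ->|/= ->]].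
  + by left.
  + by right.
  + by exists (smap f (smap ve c)); left.
  + by exists (smap k (smap vk c)); right.
- move=> m a z x [[/= -> ->]|[/= -> ->]]; rewrite ?veP ?vkP.
    by case: (svalP (smap h a)).
  by case: (svalP (smap h a)).
have ok m (a : Delta n m) : comma_pred (smap ve a, (act (a : op _ _) s, smap vk a)).
  split.
    transitivity (smap s (const_op m.+1 ord0 : Delta 1 m, op_comp (a : op _ _) (op_id _) : Delta n m)); first by [].
    by apply: sg; left; rewrite op_id_r.
  transitivity (smap s (const_op m.+1 ord_max : Delta 1 m, op_comp (a : op _ _) (op_id _) : Delta n m)); first by [].
  by apply: sg; right; rewrite op_id_r.
unshelve eexists (@SMap (Delta n) comma (fun m a => exist _ _ (ok m a)) _).
  move=> m l b a; apply: eq_exist; congr pair; first exact: smap_act.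
  by congr pair; [apply: act_comp|apply: smap_act].
apply: sMap_ext => m a; have := sP m a; rewrite /=.
have := veP m a; have := vkP m a.
case: (smap h a) => [[e [d x]] hw] /= E1 E2 E3; apply: eq_exist.
by rewrite E1 E2 E3.
Qed.
End Comma.

(** * Limits as absolute right liftings *)

Lemma scomp_sid (X Y : sSet) (f : sMap X Y) : f \s sid X = f.
Proof. exact: sMap_ext. Qed.

Lemma sid_scomp (X Y : sSet) (f : sMap X Y) : sid Y \s f = f.
Proof. exact: sMap_ext. Qed.

Lemma precomp_sid (A Y : sSet) n (T : sexp A Y n) : smap (precomp A (sid Y)) T = T.
Proof. by apply: sexp_ext. Qed.

Lemma precomp_degen (A Y K : sSet) (s : sMap K Y) (f : sMap Y A) :
  smap (precomp A s) (degen (name f : sexp A Y 0)) = degen (name (f \s s) : sexp A K 0).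
Proof. by apply: sexp_ext. Qed.

Lemma postcomp_degen (A B Y : sSet) (g : sMap A B) (f : sMap Y A) :
  smap (postcomp Y g) (degen (name f : sexp A Y 0)) = degen (name (g \s f) : sexp B Y 0).
Proof. by apply: sexp_ext. Qed.

Section Limits.
Variables (A X : sSet) (hA : quasi_category A).
Notation J := (join (Delta 0) X).
Notation E := (sexp A J).
Notation D := (sexp A X).
Notation r := (res A X).
Notation cJ := (const_diag A J).
Notation cX := (const_diag A X).
Notation ev := (eval_apex A X).

Let hE : quasi_category E := sexp_qcat hA.
Let hD : quasi_category D := sexp_qcat hA.
Let hEY Y : quasi_category (sexp E Y) := sexp_qcat hE.
Let hDY Y : quasi_category (sexp D Y) := sexp_qcat hD.
Let hAY Y : quasi_category (sexp A Y) := sexp_qcat hA.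

Lemma res_const : r \s cJ = cX.
Proof. by apply: uncurry_inj => n w z. Qed.

Lemma res_const_comp Y (a : sMap Y A) : r \s (cJ \s a) = cX \s a.
Proof. by rewrite scompA res_const. Qed.

Lemma eval_const Y (a : sMap Y A) : ev \s (cJ \s a) = a.
Proof. by apply: sMap_ext => n y; rewrite [LHS]const_at. Qed.

Lemma eval_at Y n (T : sexp E Y n) m (y : Y m) (t : Delta n m) :
  smap (smap (postcomp Y ev) T) (y, t) = value T y t (apex X m).
Proof. by []. Qed.

Lemma eval_eps Y (b : sMap Y E) :
  smap (postcomp Y ev) (eps b) = degen (name (ev \s b) : sexp A Y 0).
Proof. by apply: sexp_ext => m y t; rewrite eval_at eps_at contract_apex. Qed.

Lemma precomp_eps Y Z (b : sMap Y E) (s : sMap Z Y) :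
  smap (precomp E s) (eps b) = eps (b \s s).
Proof. by apply: sexp_eq => m y t z; rewrite at_precomp !eps_at. Qed.

Lemma eval_underlying Y (F : special X A Y 1) :
  smap (postcomp Y ev) (src (smap (underlying X A Y) F)) =
  smap (postcomp Y ev) (tgt (smap (underlying X A Y) F)).
Proof.
apply: sexp_ext => m y t; rewrite !eval_at at_src at_tgt !underlying_at.
congr (smap F _); apply: eq_exist; congr pair; apply: op_ext => j.
by rewrite !apex_opE ltn_ord.
Qed.

(** Transporting [ran] along [lambda] gives an edge [T] to a cone [ran'] that restricts to [k]. The
    identity of [k] factors through [lambda] by some [Z] from [ran'] to [ran]. The composite [W] of
    [T] and [Z] factors [lambda] through itself, so it is an identity, and the restriction of [Z]
    inverts [lambda]. *)
Lemma lifting_iso (K : sSet) (hK : quasi_category K) (k : sMap K D) (ran : sMap K E)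
  (lambda : cell (r \s ran) k) : abs_right_lifting lambda -> cell_iso lambda.
Proof.
have [L [p [q ->]]] := cell_edge lambda hD.
move/(abs_right_liftingP p q hD hE)/(_ K hK) => arl.
have [F [sF bF]] := special_lift1 hA p.
rewrite base_postcomp in bF; set T := smap (underlying X A K) F in sF bF.
pose ran' := unname (tgt T); have tT : tgt T = name ran' by rewrite name_unname.
have rk : r \s ran' = k.
  by apply: name_inj; rewrite -q -bF smap_tgt tT name_postcomp.
have [||[Z [sZ tZ fZ]] _] := arl ran' (sid K) (degen (name k : sexp D K 0)).
- by rewrite src_degen rk.
- by rewrite tgt_degen scomp_sid.
rewrite precomp_sid in fZ; rewrite scomp_sid in tZ.
have [|W tW] := tri_comp (@hEY K) (f := T) (g := Z); first by rewrite tT sZ.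
have tW' := smap_tri (postcomp K r) tW; rewrite bF in tW'.
have tLL : tri L (degen (name k : sexp D K 0)) L by rewrite -q; apply: tri_degen_r.
have rW := tri_fill1 (@hDY K) tW' fZ tLL.
have [||_ uniq] := arl ran (sid K) L; [exact: p|by rewrite scomp_sid|].
have hW : homotopic W (degen (name ran : sexp E K 0)).
  apply: uniq; split.
  - by rewrite (tri_src tW).
  - by rewrite (tri_tgt tW) scomp_sid.
  - by rewrite precomp_sid.
  - by rewrite src_degen.
  - by rewrite tgt_degen scomp_sid.
  - by rewrite precomp_sid postcomp_degen -p; apply: tri_degen_l.
have := smap_homotopic (postcomp K r) hW; rewrite postcomp_degen => hW'.
have t1 := tri_homotopic (@hDY K) tW' (homotopic_refl _) (homotopic_refl _) hW'.
exact: (cell_iso_edge p q hD t1 fZ).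
Qed.

(** Naturality of [eps] along [Z], with [eps] degenerate at constant cones. A cell out of a constant
    cone is thus determined by its value at the apex. *)
Lemma eps_counit Y (a : sMap Y A) (Z : sexp E Y 1) (b : sMap Y E) :
  src Z = name (cJ \s a) -> tgt Z = name b ->
  tri (smap (postcomp Y cJ) (smap (postcomp Y ev) Z)) (eps b) Z.
Proof.
move=> sZ tZ.
have [M [t1 t2]] := naturality (src_eps (sid E)) (tgt_eps (sid E)) sZ tZ.
rewrite !precomp_eps !sid_scomp in t1 t2.
have E1 : smap (postcomp Y (sid E)) Z = Z by apply: sexp_ext.
have E2 : smap (postcomp Y (cJ \s (ev \s sid E))) Z = smap (postcomp Y cJ) (smap (postcomp Y ev) Z).
  by apply: sexp_ext.
rewrite E1 eps_const -sZ in t2; rewrite E2 in t1.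
apply: (tri_homotopic (@hEY Y) t1 (homotopic_refl _) (homotopic_refl _)).
exact/homotopic_sym/homotopic_l.
Qed.

Lemma limits_of_lifting (K : sSet) (hK : quasi_category K) (k : sMap K D) (ran : sMap K E)
  (lambda : cell (r \s ran) k) : abs_right_lifting lambda -> admits_limits k.
Proof.
have [L [p [q ->]]] := cell_edge lambda hD.
move/(abs_right_liftingP p q hD hE) => arl.
(* The limit cell is the restricted counit at [ran] followed by [L]; transposing along the
   adjunction then matches the factorizations through [L1] with those through [L]. *)
have [|L1 tL1] := tri_comp (@hDY K) (f := smap (postcomp K r) (eps ran)) (g := L).
  by rewrite smap_tgt tgt_eps p name_postcomp.
have p1 : src L1 = name (cX \s (ev \s ran)).
  by rewrite (tri_src tL1) smap_src src_eps name_postcomp res_const_comp.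
have q1 : tgt L1 = name k by rewrite (tri_tgt tL1).
exists (ev \s ran), (cls (Wedge L1 p1 q1)).
apply/(abs_right_liftingP p1 q1 hD hA) => Y hY a y H sH tH.
have [||[Z [sZ tZ fZ]] uniq] := arl Y hY (cJ \s a) y H.
- by rewrite res_const_comp.
- by [].
have tL1y := smap_tri (precomp D y) tL1.
have Ec (z : sexp A Y 1) : smap (postcomp Y r) (smap (postcomp Y cJ) z) = smap (postcomp Y cX) z.
  by rewrite -res_const; apply: sexp_ext.
have Ee : smap (precomp D y) (smap (postcomp K r) (eps ran)) = smap (postcomp Y r) (eps (ran \s y)).
  by rewrite -precomp_eps; apply: sexp_ext.
rewrite Ee in tL1y.
split.
  exists (smap (postcomp Y ev) Z); split.
  - by rewrite smap_src sZ name_postcomp eval_const.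
  - by rewrite smap_tgt tZ name_postcomp scompA.
  - have := smap_tri (postcomp Y r) (eps_counit sZ tZ); rewrite Ec => t.
    exact: (tri_fill2 (@hDY Y) t tL1y fZ).
(* Evaluating the transpose [Zz] at the apex gives [z] back, since it turns [eps] into an
   identity. *)
have back z : factors cX (ev \s ran) L1 a y H z ->
    exists Zz, factors r ran L (cJ \s a) y H Zz /\ homotopic z (smap (postcomp Y ev) Zz).
  move=> [sz tz fz].
  have [|Zz tZz] := tri_comp (@hEY Y) (f := smap (postcomp Y cJ) z) (g := eps (ran \s y)).
    by rewrite smap_tgt tz name_postcomp src_eps !scompA.
  exists Zz; split; first split.
  - by rewrite (tri_src tZz) smap_src sz name_postcomp.
  - by rewrite (tri_tgt tZz) tgt_eps.
  - have := smap_tri (postcomp Y r) tZz; rewrite Ec => t.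
    exact: (tri_fill1 (@hDY Y) t tL1y fz).
  have := smap_tri (postcomp Y ev) tZz; rewrite eval_eps scompA -tz.
  suff -> : smap (postcomp Y ev) (smap (postcomp Y cJ) z) = z by [].
  by apply: sexp_ext => m v t; rewrite [LHS]const_at.
move=> z z' /back[Z1 [f1 h1]] /back[Z2 [f2 h2]].
have h12 := smap_homotopic (postcomp Y ev) (uniq _ _ f1 f2).
exact: (homotopic_trans (@hAY Y) h1 (homotopic_trans (@hAY Y) h12 (homotopic_sym (@hAY Y) h2))).
Qed.

(* The square on (s, t) with corners (0,0), (1,0), (0,1), (1,1) sent to
   0, 1, 2, 2. *)
Definition fold_op m (s t : op m.+1 2) : op m.+1 3.
Proof.
exists (fun j : 'I_m.+1 => if t j == 0 :> nat then lift ord_max (s j) else ord_max).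
move=> i j ij; have := op_mono t ij; have := op_mono s ij.
case: eqP => ti; case: eqP => tj //=; rewrite /bump; have := ltn_ord (s i);
  have := ltn_ord (s j); lia.
Defined.

(** * Comparison of a factorization with the universal one *)

Section Uniqueness.
Variables (K : sSet) (hK : quasi_category K) (k : sMap K D) (ran : sMap K E).
Hypothesis rk : r \s ran = k.
Notation C := (comma r k).
Notation b0 := (comma_dom r k).
Notation y0 := (comma_cod r k).
Notation X0 := (comma_cell r k).
Variables (U : sexp E C 1) (s : sMap K C).
Hypotheses (sU : src U = name b0) (tU : tgt U = name (ran \s y0)).
Hypotheses (s1 : b0 \s s = ran) (s2 : y0 \s s = sid K)
  (s3 : smap (precomp D s) X0 = degen (name k : sexp D K 0)).

(** [Z] lifts to an edge [v] between maps Y -> C, from [u], which classifies [H], to [s \s y], which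
    classifies an identity. The claim is naturality of [U] along [v], whose component in [K] is
    constant. *)
Lemma universal_cell_factor Y (Z : sexp E Y 1) (b : sMap Y E) (y : sMap Y K)
    (H : sexp D Y 1) (u : sMap Y C) :
  src Z = name b -> tgt Z = name (ran \s y) -> homotopic (smap (postcomp Y r) Z) H ->
  b0 \s u = b -> y0 \s u = y -> smap (precomp D u) X0 = H ->
  tri Z (smap (precomp E (s \s y)) U) (smap (precomp E u) U).
Proof.
move=> sZ tZ [S [S2 S0 S1]] u1 u2 u3.
have rkE n (x : K n) : smap r (smap ran x) = smap k x.
  exact: (f_equal (fun g : sMap _ _ => smap g x) rk).
have sZ' := iffLR (src_nameP _ _) sZ; have tZ' := iffLR (tgt_nameP _ _) tZ.
(* In this square the side s = 0 is [H], the side s = 1 is an identity, the side t = 0 is the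
   restriction of [Z], and the side t = 1 is constant. *)
have [HW HWE] : exists HW : sexp D (Y \x Delta 1) 1, forall m (w : (Y \x Delta 1) m) (t : op m.+1 2),
    smap HW (w, t : Delta 1 m) = smap S (w.1, fold_op (w.2 : op _ _) t : Delta 2 m).
  unshelve eexists (@SMap ((Y \x Delta 1) \x Delta 1) D (fun m w =>
     smap S (w.1.1, fold_op (w.1.2 : op _ _) (w.2 : op _ _) : Delta 2 m)) _) => //.
  move=> l m c [[y' v] t]; rewrite -smap_act; congr (smap S _); congr pair.
have S2E m (y' : Y m) (t : op m.+1 2) : smap S (y', op_comp (coface (@Ordinal 3 2 isT)) t : Delta 2 m) =
    smap r (smap Z (y', t : Delta 1 m)).
  exact: (f_equal (fun T : sexp D Y 1 => smap T (y', t : Delta 1 m)) S2).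
have S1E m (y' : Y m) (t : op m.+1 2) : smap S (y', op_comp (coface (@Ordinal 3 1 isT)) t : Delta 2 m) =
    smap H (y', t : Delta 1 m).
  exact: (f_equal (fun T : sexp D Y 1 => smap T (y', t : Delta 1 m)) S1).
have S0E m (y' : Y m) (t : op m.+1 2) : smap S (y', op_comp (coface (@Ordinal 3 0 isT)) t : Delta 2 m) =
    smap k (smap y y').
  have := f_equal (fun T : sexp D Y 1 => smap T (y', t : Delta 1 m)) S0.
  by rewrite smap_tgt tZ name_postcomp => E1; rewrite [LHS]E1; apply: rkE.
have [||v [v1 v2 v3]] := @comma_pair E D K r k (Y \x Delta 1) Z (y \s @sfst Y (Delta 1)) HW.
- apply/src_nameP => m w; rewrite HWE.
  have -> : fold_op (w.2 : op _ _) (const_op m.+1 ord0) = op_comp (coface (@Ordinal 3 2 isT)) w.2.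
    exact: op_ext.
  by rewrite S2E -surjective_pairing.
- apply/tgt_nameP => m w; rewrite HWE.
  have -> : fold_op (w.2 : op _ _) (const_op m.+1 ord_max) =
      op_comp (coface (@Ordinal 3 0 isT)) (const_op m.+1 ord_max).
    exact: op_ext.
  by rewrite S0E.
pose inj i : sMap Y (Y \x Delta 1) :=
  @SMap Y (Y \x Delta 1) (fun n y' => (y', const_op n.+1 i : Delta 1 n)) (fun _ _ _ _ => erefl).
have v0u : v \s inj ord0 = u.
  apply: comma_eq.
  - by rewrite scompA v1 u1; apply: sMap_ext => n y'; apply: sZ'.
  - by rewrite scompA v2 u2; apply: sMap_ext.
  - rewrite u3; transitivity (smap (precomp D (inj ord0)) HW); first by rewrite -v3; apply: sexp_ext.
    apply: sexp_ext => m y' t; rewrite [LHS]HWE -S1E; congr (smap S _); congr pair.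
    apply: op_ext => j /=; have := ltn_ord (t j).
    by case: ifP => /eqP /=; rewrite /bump /=; lia.
have v1s : v \s inj ord_max = s \s y.
  apply: comma_eq.
  - by rewrite !scompA v1 s1; apply: sMap_ext => n y'; apply: tZ'.
  - by rewrite !scompA v2 s2; apply: sMap_ext.
  - transitivity (smap (precomp D (inj ord_max)) HW); first by rewrite -v3; apply: sexp_ext.
    transitivity (smap (precomp D y) (smap (precomp D s) X0)); last by apply: sexp_ext.
    rewrite s3 precomp_degen; apply: sexp_ext => m y' t; rewrite [LHS]HWE; apply: (etrans _ (S0E m y' t)).
    congr (smap S _); congr pair.
    apply: op_ext => j /=; have := ltn_ord (t j).
    by case: ifP => /eqP /=; rewrite /bump /=; lia.
have sv : src (v : sexp C Y 1) = name u.
  by apply/src_nameP => m y'; rewrite -v0u.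
have tv : tgt (v : sexp C Y 1) = name (s \s y).
  by apply/tgt_nameP => m y'; rewrite -v1s.
have [M [t1 t2]] := naturality sU tU sv tv.
have E1 : smap (postcomp Y b0) (v : sexp C Y 1) = Z by rewrite -[RHS]v1.
have E2 : smap (postcomp Y (ran \s y0)) (v : sexp C Y 1) = degen (name (ran \s y) : sexp E Y 0).
  transitivity (ran \s (y0 \s v)); first by apply: sMap_ext.
  by rewrite v2; apply: sMap_ext.
rewrite E1 in t1; rewrite E2 in t2.
apply: (tri_homotopic (@hEY Y) t1 (homotopic_refl _) (homotopic_refl _)).
apply: (homotopic_sym (@hEY Y)); rewrite /homotopic.
suff -> : tgt (smap (precomp E u) U) = name (ran \s y) by [].
by rewrite smap_tgt tU name_precomp -scompA u2.
Qed.
End Uniqueness.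

(** Filling the horn on [F] and an identity yields only a left inverse. It is again special over the
    identity, so a second application makes it two-sided. *)
Lemma special_degen_inv Y (F : special X A Y 1) (f : sMap Y D) :
  smap (base X A Y) F = degen (name f : sexp D Y 0) ->
  exists F' : special X A Y 1, smap (base X A Y) F' = degen (name f : sexp D Y 0) /\
    tri (smap (underlying X A Y) F) (smap (underlying X A Y) F')
        (degen (src (smap (underlying X A Y) F))).
Proof.
move=> bF; have [||F' [tF' bF']] := @special_tri A X Y F (degen (src F)) (degen (name f : sexp D Y 0)) hA.
- by rewrite src_degen.
- by rewrite bF -smap_degen -smap_src bF src_degen; apply: tri_degen2.
exists F'; split=> //.
by have := smap_tri (underlying X A Y) tF'; rewrite -smap_degen -smap_src.
Qed.

Theorem lifting_of_limits (K : sSet) (hK : quasi_category K) (k : sMap K D) :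
  admits_limits k ->
  exists (ran : sMap K E) (e : r \s ran = k), abs_right_lifting (eq_cell e).
Proof.
move=> [l [la]]; have [L [p [q ->]]] := cell_edge la hD.
move/(abs_right_liftingP p q hD hA) => lim.
have pJ : src L = name (r \s (cJ \s l)) by rewrite res_const_comp.
(* [T0] lies strictly over [L], so [ran] restricts to [k] on the nose and the final cell can be an
   identity. Being special, [T0] also keeps the apex [l]. *)
have [F0 [sF0 bF0]] := special_lift1 hA pJ.
rewrite base_postcomp in bF0; set T0 := smap (underlying X A K) F0 in sF0 bF0.
pose ran := unname (tgt T0); have tT0 : tgt T0 = name ran by rewrite name_unname.
have rk : r \s ran = k.
  by apply: name_inj; rewrite -q -bF0 smap_tgt tT0 name_postcomp.
have evran : ev \s ran = l.
  apply: name_inj; have := eval_underlying F0; rewrite -/T0 sF0 tT0 !name_postcomp.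
  by rewrite eval_const => ->.
exists ran, rk.
pose C := comma r k; pose b0 := comma_dom r k; pose y0 := comma_cod r k.
pose X0 := comma_cell r k.
have hC : quasi_category C := comma_qcat hE hD hK.
have sX0 : src X0 = name (r \s b0) := src_comma_cell r k.
have tX0 : tgt X0 = name (k \s y0) := tgt_comma_cell r k.
(* Composing the universal cell [X0] with the counit makes its source a constant cone, to which the
   limit applies: [Z0] is the factorization, and [Th] is its constant cone followed by [T0]. *)
have [|H0 tH0] := tri_comp (@hDY C) (f := smap (postcomp C r) (eps b0)) (g := X0).
  by rewrite smap_tgt tgt_eps sX0 name_postcomp.
have [||[Z0 [sZ0 tZ0 fZ0]] _] := lim C hC (ev \s b0) y0 H0.
- by rewrite (tri_src tH0) smap_src src_eps name_postcomp res_const_comp.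
- by rewrite (tri_tgt tH0).
have [|Th tTh] := tri_comp (@hEY C) (f := smap (postcomp C cJ) Z0) (g := smap (precomp E y0) T0).
  by rewrite smap_tgt tZ0 name_postcomp smap_src sF0 name_precomp scompA.
have Ec Y (z : sexp A Y 1) : smap (postcomp Y r) (smap (postcomp Y cJ) z) = smap (postcomp Y cX) z.
  by rewrite -res_const; apply: sexp_ext.
have rT0 Y (y : sMap Y K) : smap (postcomp Y r) (smap (precomp E y) T0) = smap (precomp D y) L.
  by rewrite -bF0; apply: sexp_ext.
have hTh : homotopic H0 (smap (postcomp C r) Th).
  have := smap_tri (postcomp C r) tTh; rewrite Ec rT0; exact: (tri_unique (@hDY C) fZ0).
have sTh : src Th = name (cJ \s (ev \s b0)).
  by rewrite (tri_src tTh) smap_src sZ0 name_postcomp.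
have tgTh : tgt Th = name (ran \s y0) by rewrite (tri_tgt tTh) smap_tgt tT0 name_precomp.
have tX0' := tri_homotopic (@hDY C) tH0 (homotopic_refl _) (homotopic_refl _) hTh.
(* [Th] starts at a constant cone instead of [b0]. It is traded for a special edge [Q] out of [b0]
   over [X0], followed by [slide Th], which moves only the apex. *)
have [F [sF tF bF]] := special_factor hA sTh tX0'.
rewrite base_postcomp in bF; set Q := smap (underlying X A C) F in sF tF bF.
have [|U tU] := tri_comp (@hEY C) (f := Q) (g := slide Th); first by rewrite tF name_slide_src.
have sU : src U = name b0 by rewrite (tri_src tU).
have tgU : tgt U = name (ran \s y0) by rewrite (tri_tgt tU) tgt_slide.
have hU : homotopic X0 (smap (postcomp C r) U).
  have := smap_tri (postcomp C r) tU; rewrite bF res_slide => t.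
  by have := tri_mid t; rewrite src_degen /homotopic => ->.
have [||s [s1 s2 s3]] := @comma_pair E D K r k K ran (sid K) (degen (name k : sexp D K 0)).
- by rewrite src_degen rk.
- by rewrite tgt_degen scomp_sid.
have tX0s := smap_tri (precomp D s) tH0.
have reps : smap (precomp D s) (smap (postcomp C r) (eps b0)) = smap (postcomp K r) (eps ran).
  by rewrite -s1 -precomp_eps; apply: sexp_ext.
rewrite reps s3 in tX0s.
have hL : homotopic L (smap (precomp D s) H0).
  have := res_eps_slide_src hA sF0; rewrite bF0.
  have -> : slide_src T0 = ran by apply: name_inj; rewrite slide_src_underlying.
  move=> h; apply: (homotopic_trans (@hDY K) h); rewrite /homotopic.
  by have := tri_mid tX0s; rewrite src_degen => ->.
pose Z0s := smap (precomp A s) Z0.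
(* At [s] the cell factored by [Z0] is [L] up to homotopy, so uniqueness for the limit makes [Z0] an
   identity there. Consequently [Th] restricts to [T0] along [s]. *)
have hZ0s : homotopic Z0s (degen (name l : sexp A K 0)).
  have [||_ uniq] := lim K hK l (sid K) L; [exact: p|by rewrite scomp_sid|].
  apply: uniq; split.
  - by rewrite smap_src sZ0 name_precomp -scompA s1 evran.
  - by rewrite smap_tgt tZ0 name_precomp -scompA s2.
  - have := smap_tri (precomp D s) fZ0.
    have -> : smap (precomp D s) (smap (precomp D y0) L) = smap (precomp D (sid K)) L.
      by rewrite -s2; apply: sexp_ext.
    have -> : smap (precomp D s) (smap (postcomp C cX) Z0) = smap (postcomp K cX) Z0s.
      by apply: sexp_ext.
    move=> t; exact: (tri_homotopic (@hDY K) t (homotopic_refl _) (homotopic_refl _) (homotopic_sym (@hDY K) hL)).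
  - exact: src_degen.
  - by rewrite tgt_degen scomp_sid.
  - by rewrite precomp_sid postcomp_degen -p; apply: tri_degen_l.
pose Ths := smap (precomp E s) Th.
have hThs : homotopic T0 Ths.
  have := smap_tri (precomp E s) tTh.
  have -> : smap (precomp E s) (smap (precomp E y0) T0) = T0.
    by rewrite -[RHS]precomp_sid -s2; apply: sexp_ext.
  have -> : smap (precomp E s) (smap (postcomp C cJ) Z0) = smap (postcomp K cJ) Z0s.
    by apply: sexp_ext.
  move=> t; have := smap_homotopic (postcomp K cJ) hZ0s; rewrite postcomp_degen -sF0 => h.
  exact/(homotopic_l (@hEY K))/(tri_homotopic (@hEY K) t h (homotopic_refl _) (homotopic_refl _)).
have tThs : tgt Ths = name ran by rewrite (homotopic_tgt hThs).
(* The slide of [T0] is degenerate, so sliding this homotopy produces a right inverse [mu] of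
   [slide Ths], over the identity. *)
have := iffLR (homotopic_l (@hEY K) _ _) (homotopic_sym (@hEY K) hThs).
move=> /slide_tri[mu [tmu rmu]]; rewrite slide_underlying -/T0 tT0 slide_pre in tmu.
rewrite tThs name_postcomp rk in rmu.
pose qs := smap (precomp E s) Q; pose om := smap (precomp E s) U.
have tom : tri qs (smap (precomp E s) (slide Th)) om := smap_tri (precomp E s) tU.
have qE : qs = smap (underlying X A K) (special_pre s F) by rewrite underlying_pre.
have bq : smap (base X A K) (special_pre s F) = degen (name k : sexp D K 0).
  rewrite base_postcomp -qE -s3 -[comma_cell _ _]bF; exact: sexp_ext.
have sq : src qs = name ran by rewrite smap_src sF name_precomp s1.
have [F1 [bF1 tF1]] := special_degen_inv bq.
have [F2 [bF2 tF2]] := special_degen_inv bF1.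
rewrite -qE sq in tF1.
set q1 := smap _ F1 in tF1 tF2; set q2 := smap _ F2 in tF2.
have tq1 : tgt q1 = name ran by rewrite -(tri_tgt tF1) tgt_degen.
have sq2 : src q2 = name ran by rewrite -(tri_mid tF2).
have hq : homotopic qs q2.
  rewrite /homotopic (tri_mid tF1); apply: (tri_fill2 (@hEY K) tF1 tF2).
  by rewrite -sq2; apply: tri_degen_l.
have tq := tri_homotopic (@hEY K) tF2 (homotopic_refl _) (homotopic_sym (@hEY K) hq) (homotopic_refl _).
have tq1om : tri q1 om (smap (precomp E s) (slide Th)).
  apply: (tri_fill2 (@hEY K) tq tom).
  by rewrite -(tri_mid tF1) (tri_mid tom); apply: tri_degen_l.
have [|xi txi] := tri_comp (@hEY K) (f := mu) (g := q1).
  by rewrite (tri_mid tmu) -(tri_mid tom) (tri_mid tF1).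
have txom := tri_fill1 (@hEY K) txi tq1om tmu.
(* Both [mu] and [q1] lie over the identity of [k]; hence [xi] factors the identity cell, and
   [factor] applies to it with [u = s]. *)
have hxi : homotopic (smap (postcomp K r) xi) (degen (name k : sexp D K 0)).
  have := smap_tri (postcomp K r) txi; rewrite rmu -base_postcomp bF1 => t.
  exact: (tri_unique (@hDY K) t (tri_degen2 _)).
have factor := @universal_cell_factor K k ran rk U s sU tgU s1 s2 s3.
have hom : homotopic om (degen (name ran : sexp E K 0)).
  have sxi : src xi = name ran by rewrite (tri_src txi) -(tri_src tmu) src_degen.
  have txi' : tgt xi = name (ran \s sid K) by rewrite (tri_tgt txi) tq1 scomp_sid.
  have := factor K xi ran (sid K) (degen (name k : sexp D K 0)) s sxi txi' hxi s1 s2 s3.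
  rewrite scomp_sid => t; exact: (tri_unique (@hEY K) t txom).
have pr : src (degen (name (r \s ran) : sexp D K 0)) = name (r \s ran) by apply: src_degen.
have qr : tgt (degen (name (r \s ran) : sexp D K 0)) = name k by rewrite tgt_degen rk.
rewrite (eq_cell_edge rk pr qr); apply/(abs_right_liftingP pr qr hD hE) => Y hY b y H sH tH.
have [u [u1 u2 u3]] := comma_pair sH tH.
have sUu : src (smap (precomp E u) U) = name b by rewrite smap_src sU name_precomp u1.
have tUu : tgt (smap (precomp E u) U) = name (ran \s y).
  by rewrite smap_tgt tgU name_precomp -scompA u2.
have rUu : homotopic H (smap (postcomp Y r) (smap (precomp E u) U)).
  have := smap_homotopic (precomp D u) hU; rewrite u3.
  suff -> : smap (precomp D u) (smap (postcomp C r) U) =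
            smap (postcomp Y r) (smap (precomp E u) U) by [].
  exact: sexp_ext.
split.
  exists (smap (precomp E u) U); split=> //; rewrite precomp_degen -scompA.
  rewrite -(name_postcomp r (ran \s y)) -tUu -smap_tgt.
  exact: (homotopic_sym (@hDY Y)).
have unique Z : factors r ran (degen (name (r \s ran) : sexp D K 0)) b y H Z ->
    homotopic Z (smap (precomp E u) U).
  move=> [sZ tZ fZ]; rewrite precomp_degen -scompA in fZ.
  rewrite -(name_postcomp r (ran \s y)) -tZ -smap_tgt in fZ.
  have t := factor Y Z b y H u sZ tZ fZ u1 u2 u3.
  have := smap_homotopic (precomp E y) hom; rewrite precomp_degen -tZ => h.
  apply: (tri_homotopic (@hEY Y) t (homotopic_refl _) _ (homotopic_refl _)).
  suff -> : smap (precomp E (s \s y)) U = smap (precomp E y) om by [].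
  exact: sexp_ext.
move=> Z Z' /unique h /unique h'.
exact: (homotopic_trans (@hEY Y) h (homotopic_sym (@hEY Y) h')).
Qed.
End Limits.

Theorem proposition5p2p19 (A X K : sSet) (hA : quasi_category A)
    (hK : quasi_category K) (k : sMap K (sexp A X)) :
  (admits_limits k <->
   exists (ran : sMap K (sexp A (join (Delta 0) X)))
          (lambda : cell (res A X \s ran) k), abs_right_lifting lambda) /\
  (forall (ran : sMap K (sexp A (join (Delta 0) X)))
          (lambda : cell (res A X \s ran) k),
     abs_right_lifting lambda -> cell_iso lambda) /\
  (admits_limits k ->
   exists (ran : sMap K (sexp A (join (Delta 0) X)))
          (e : res A X \s ran = k), abs_right_lifting (eq_cell e)).
Proof.
split; [split|split].
- by move=> /(lifting_of_limits hA hK)[ran [e arl]]; exists ran, (eq_cell e).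
- by move=> [ran [lambda]]; apply: (limits_of_lifting hA hK).
- by move=> ran lambda; apply: (lifting_iso hA hK).
- exact: (lifting_of_limits hA hK).
Qed.
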